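(* Let $H_0$ be a semisimple Hopf algebra, let $\mathfrak{B}(V)$ be a finite-dimensional Nichols algebra in the category of (left-left) Yetter–Drinfeld modules over $H_0$, and let $H=\mathfrak{B}(V)\# H_0$. If every $H_0$-equivariant Morita equivalence class of AM-exact $H_0$-comodule algebras is represented by a left coideal subalgebra of $H_0$, then every Loewy-graded AM-exact $H$-comodule algebra is $H$-equivariant Morita equivalent to a left coideal subalgebra of $H$.
   Context: Throughout, $\Bbbk$ is an algebraically closed field of characteristic zero; Hopf algebras, modules, comodules and comodule algebras are finite-dimensional over $\Bbbk$. For an algebra $A$, ${}_A\mathcal{M}$ is the category of finite-dimensional left $A$-modules. $H=\mathfrak{B}(V)\#H_0$ is the bosonization, graded by $H(n)=\mathfrak{B}^n(V)\#H_0$; it is coradically graded: its coradical filtration is $H_n=\bigoplus_{i=0}^nH(i)$, with coradical $H(0)=1\#H_0\cong H_0$. $H$-comodule algebra: an algebra $A$ with a left coaction $\lambda:A\to H\otimes A$, $\lambda(a)=a_{(-1)}\otimes a_{(0)}$, that is an algebra morphism. $A$ has trivial coinvariants if $A^{\mathrm{co}H}=\{a:\lambda(a)=1\otimes a\}$ is one-dimensional. $A$ is right $H$-simple if it has no right ideals $J$ with $\lambda(J)\subseteq H\otimes J$ other than $0$ and $A$. $A$ is AM-exact if it is right $H$-simple with trivial coinvariants. The same terminology is used with $H_0$ in place of $H$. A left coideal subalgebra of $H$ is a subalgebra $L\subseteq H$ with $\Delta(L)\subseteq H\otimes L$, viewed as an $H$-comodule algebra via $\Delta$. Loewy-graded: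 an $H$-comodule algebra $A$ with an algebra grading $A=\bigoplus_{n\ge0}A(n)$ such that $\lambda^{-1}(H_n\otimes A)=\bigoplus_{i=0}^nA(i)$ and $\lambda(A(n))\subseteq\bigoplus_{i=0}^nH(i)\otimes A(n-i)$ for all $n$. Morita equivalence: for an $H$-comodule algebra $A$, ${}_A\mathcal{M}$ is a left module category over the tensor category ${}_H\mathcal{M}$: for $X\in{}_H\mathcal{M}$, $M\in{}_A\mathcal{M}$, the object $X\otimes_\Bbbk M$ has action $a\cdot(x\otimes m)=a_{(-1)}x\otimes a_{(0)}m$. Two $H$-comodule algebras $A,B$ are $H$-equivariant Morita equivalent if ${}_A\mathcal{M}$ and ${}_B\mathcal{M}$ are equivalent as ${}_H\mathcal{M}$-module categories. *)

(* Defs.v *)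
From HB Require Import structures.
From mathcomp Require Import all_boot all_order all_algebra all_field.

Set Implicit Arguments.
Unset Strict Implicit.
Unset Printing Implicit Defensive.

Import GRing.Theory VectorInternalTheory.
Local Open Scope ring_scope.

(* Coordinates in the canonical bases given by [v2r] identify U (x) V with a
   space of matrices. *)
Definition tens (k : fieldType) (U V : vectType k) : vectType k :=
  'M[k]_(dim U, dim V).

Definition tpure (k : fieldType) (U V : vectType k) (u : U) (v : V) : tens U V :=
  (v2r u)^T *m v2r v.

Notation "u ⊗ v" := (tpure u v) (at level 40, left associativity).

(* For bilinear f, this is the linear map U (x) V -> W with u (x) v |-> f u v
   (see [tlift_pure]); with f written as a lambda term it plays the role of
   Sweedler's summation sign. *)
Definition tlift (k : fieldType) (U V : vectType k) (W : lmodType k)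
    (f : U -> V -> W) (t : tens U V) : W :=
  \sum_(i < dim U) \sum_(j < dim V)
    (t : 'M[k]_(dim U, dim V)) i j
      *: f (r2v (delta_mx 0 i)) (r2v (delta_mx 0 j)).

Notation "\tsum_ ( x , y <- t ) E" := (tlift (fun x y => E) t)
  (at level 41, x name, y name, t at level 40, E at level 41,
   format "\tsum_ ( x ,  y  <-  t )  E").

(* The subspace U' (x) V' of U (x) V. *)
Definition tensv (k : fieldType) (U V : vectType k)
    (U' : {vspace U}) (V' : {vspace V}) : {vspace tens U V} :=
  <<[seq u ⊗ v | u <- vbasis U', v <- vbasis V']>>%VS.

Section TensorTheory.
Variable k : fieldType.
Implicit Types U V W : vectType k.

Lemma tpure_linear U V (u : U) : linear (tpure u : V -> tens U V).
Proof. by move=> a v w; rewrite /tpure linearP /= mulmxDr -scalemxAr. Qed.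

HB.instance Definition _ U V (u : U) :=
  GRing.isLinear.Build k V (tens U V) _ (tpure u) (tpure_linear u).

Lemma tpure_linearl U V (v : V) : linear (fun u : U => u ⊗ v).
Proof.
by move=> a u w; rewrite /tpure linearP /= linearP /= mulmxDl -scalemxAl.
Qed.

Lemma tpureDl U V (u u' : U) (v : V) : (u + u') ⊗ v = u ⊗ v + u' ⊗ v.
Proof. by have := tpure_linearl v 1 u u'; rewrite !scale1r. Qed.

Lemma tpureZl U V a (u : U) (v : V) : (a *: u) ⊗ v = a *: (u ⊗ v).
Proof.
have z0 : (0 : U) ⊗ v = 0 by rewrite /tpure linear0 trmx0 mul0mx.
by have := tpure_linearl v a u 0; rewrite z0 !addr0.
Qed.

Lemma tlift_linear U V (W : lmodType k) (f : U -> V -> W) : linear (tlift f).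
Proof.
move=> a s t; rewrite /tlift scaler_sumr -big_split /=; apply: eq_bigr => i _.
rewrite scaler_sumr -big_split /=; apply: eq_bigr => j _.
by rewrite !mxE scalerDl scalerA.
Qed.

HB.instance Definition _ U V (W : lmodType k) (f : U -> V -> W) :=
  GRing.isLinear.Build k (tens U V) W _ (tlift f) (tlift_linear f).

Definition bilin U V (W : lmodType k) (f : U -> V -> W) :=
  (forall v, linear (f^~ v)) /\ (forall u, linear (f u)).

Definition lin_of (U W : lmodType k) (f : U -> W) (lf : linear f) :
  {linear U -> W} := HB.pack f (GRing.isLinear.Build k U W _ f lf).

Lemma linear_sumZ (U W : lmodType k) (f : U -> W) n (c : 'I_n -> k)
    (u : 'I_n -> U) : linear f ->
  f (\sum_i c i *: u i) = \sum_i c i *: f (u i).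
Proof.
move=> lf; have -> : f = lin_of lf by [].
by rewrite linear_sum; apply: eq_bigr => i _; rewrite linearZ.
Qed.

Lemma r2v_basis U (u : U) :
  u = \sum_(i < dim U) v2r u 0 i *: r2v (delta_mx 0 i).
Proof.
rewrite -[LHS]v2rK {1}(row_sum_delta (v2r u)) linear_sum.
by apply: eq_bigr => i _; rewrite linearZ.
Qed.

Lemma tlift_pure U V (W : lmodType k) (f : U -> V -> W) u v :
  bilin f -> tlift f (u ⊗ v) = f u v.
Proof.
move=> [fl fr]; rewrite {2}(r2v_basis u) (linear_sumZ _ _ (fl v)) /tlift.
apply: eq_bigr => i _; rewrite {2}(r2v_basis v) (linear_sumZ _ _ (fr _)).
rewrite scaler_sumr; apply: eq_bigr => j _.
by rewrite scalerA !mxE big_ord1 !mxE.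
Qed.

Lemma tlift_id U V (t : tens U V) : \tsum_(u, v <- t) (u ⊗ v) = t.
Proof.
rewrite /tlift [RHS](matrix_sum_delta (t : 'M[k]_(dim U, dim V))).
apply: eq_bigr => i _; apply: eq_bigr => j _; congr (_ *: _).
by rewrite /tpure !r2vK trmx_delta mul_delta_mx.
Qed.

Lemma linear_tlift U V (W W' : lmodType k) (g : {linear W -> W'})
    (f : U -> V -> W) t : g (tlift f t) = \tsum_(u, v <- t) g (f u v).
Proof.
rewrite /tlift linear_sum; apply: eq_bigr => i _.
by rewrite linear_sum; apply: eq_bigr => j _; rewrite linearZ.
Qed.

Lemma eq_tlift U V (W : lmodType k) (f g : U -> V -> W) t :
  (forall u v, f u v = g u v) -> tlift f t = tlift g t.
Proof.
by move=> e; apply: eq_bigr => i _; apply: eq_bigr => j _; rewrite e.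
Qed.

Lemma tlift_linP U V (W : lmodType k) a (f g : U -> V -> W) t :
  \tsum_(u, v <- t) (a *: f u v + g u v) = a *: tlift f t + tlift g t.
Proof.
rewrite /tlift scaler_sumr -big_split /=; apply: eq_bigr => i _.
rewrite scaler_sumr -big_split /=; apply: eq_bigr => j _.
by rewrite scalerDr !scalerA mulrC.
Qed.

Lemma exchange_tlift U V U' V' (W : lmodType k)
    (f : U -> V -> U' -> V' -> W) s t :
  \tsum_(u, v <- s) \tsum_(u', v' <- t) f u v u' v'
  = \tsum_(u', v' <- t) \tsum_(u, v <- s) f u v u' v'.
Proof.
rewrite /tlift.
transitivity (\sum_(i < dim U) \sum_(j < dim V) \sum_(i' < dim U')
  \sum_(j' < dim V') ((t : 'M[k]_(dim U', dim V')) i' j'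
     * (s : 'M[k]_(dim U, dim V)) i j)
   *: f (r2v (delta_mx 0 i)) (r2v (delta_mx 0 j))
        (r2v (delta_mx 0 i')) (r2v (delta_mx 0 j'))).
  apply: eq_bigr => i _; apply: eq_bigr => j _; rewrite scaler_sumr.
  apply: eq_bigr => i' _; rewrite scaler_sumr; apply: eq_bigr => j' _.
  by rewrite scalerA mulrC.
rewrite pair_big exchange_big; apply: eq_bigr => i' _ /=.
rewrite exchange_big; apply: eq_bigr => j' _ /=.
rewrite scaler_sumr; under [RHS]eq_bigr => i _ do rewrite scaler_sumr.
by rewrite [RHS]pair_big; apply: eq_bigr => -[i j] _ /=; rewrite scalerA.
Qed.

(* Linear maps out of a tensor product are determined on pure tensors. *)
Lemma tens_ext U V (W : lmodType k) (f g : tens U V -> W) :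
  linear f -> linear g -> (forall u v, f (u ⊗ v) = g (u ⊗ v)) -> f =1 g.
Proof.
move=> lf lg e t; rewrite -(tlift_id t).
rewrite -[f]/(lin_of lf : _ -> _) -[g]/(lin_of lg : _ -> _) !linear_tlift.
by apply: eq_tlift => u v; exact: e.
Qed.

Lemma linfunE (U W : vectType k) (f : U -> W) : linear f -> linfun f =1 f.
Proof. by move=> lf u; rewrite -[f]/(lin_of lf : _ -> _) lfunE. Qed.

Lemma hom_linear (U W : vectType k) (f : 'Hom(U, W)) : linear f.
Proof. by move=> a u v; rewrite linearP. Qed.

Lemma comp_linear (U W W' : lmodType k) (g : W -> W') (f : U -> W) :
  linear g -> linear f -> linear (fun x => g (f x)).
Proof. by move=> lg lf a u v; rewrite lf lg. Qed.

Lemma lin_id (U : lmodType k) : linear (fun x : U => x).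
Proof. by []. Qed.

Lemma lin_hom (U : lmodType k) (V W : vectType k) (f : 'Hom(V, W)) (g : U -> V) :
  linear g -> linear (fun x => f (g x)).
Proof. by move=> lg a u v; rewrite lg linearP. Qed.

Lemma lin_homl (U : lmodType k) (V W : vectType k) (f : U -> 'Hom(V, W)) v :
  linear f -> linear (fun x => f x v).
Proof. by move=> lf a u w; rewrite lf add_lfunE scale_lfunE. Qed.

Lemma lin_purel (U : lmodType k) V W (f : U -> V) (w : W) :
  linear f -> linear (fun x => f x ⊗ w).
Proof. by move=> lf a u v; rewrite lf tpureDl tpureZl. Qed.

Lemma lin_purer (U : lmodType k) V W (v : V) (f : U -> W) :
  linear f -> linear (fun x => v ⊗ f x).
Proof. by move=> lf a u w; rewrite lf linearP. Qed.

Lemma lin_tliftr (U : lmodType k) V W (X : lmodType k) (F : V -> W -> X)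
    (f : U -> tens V W) : linear f -> linear (fun x => tlift F (f x)).
Proof. by move=> lf a u v; rewrite lf linearP. Qed.

Lemma lin_tliftl (U : lmodType k) V W (X : lmodType k) (F : U -> V -> W -> X) t :
  (forall v w, linear (fun x => F x v w)) -> linear (fun x => tlift (F x) t).
Proof.
move=> lF a x y; rewrite -tlift_linP; apply: eq_tlift => u v; exact: lF.
Qed.

Lemma lin_scalel (U W : lmodType k) (f : U -> k^o) (w : W) :
  linear f -> linear (fun x => (f x : k) *: w).
Proof. by move=> lf a u v; rewrite lf scalerDl scalerA. Qed.

Lemma lin_scaler (U W : lmodType k) c (f : U -> W) :
  linear f -> linear (fun x => c *: f x).
Proof. by move=> lf a u v; rewrite lf scalerDr !scalerA mulrC. Qed.

Lemma lin_mull (U : lmodType k) (A : falgType k) (f : U -> A) b :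
  linear f -> linear (fun x => f x * b).
Proof. by move=> lf a u v; rewrite lf mulrDl scalerAl. Qed.

Lemma lin_mulr (U : lmodType k) (A : falgType k) b (f : U -> A) :
  linear f -> linear (fun x => b * f x).
Proof. by move=> lf a u v; rewrite lf mulrDr scalerAr. Qed.

(* f (x) g *)
Definition tmap U V U' V' (f : 'Hom(U, U')) (g : 'Hom(V, V')) :
    'Hom(tens U V, tens U' V') :=
  linfun (tlift (fun u v => f u ⊗ g v)).

Lemma tmapE U V U' V' (f : 'Hom(U, U')) (g : 'Hom(V, V')) t :
  tmap f g t = \tsum_(u, v <- t) (f u ⊗ g v).
Proof. by rewrite lfunE. Qed.

Lemma lin_tmapl (X : lmodType k) U V U' V' (f : X -> 'Hom(U, U')) (g : 'Hom(V, V')) :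
  linear f -> linear (fun x => tmap (f x) g).
Proof.
move=> lf a x y; apply/lfunP => t.
rewrite add_lfunE scale_lfunE !tmapE; move: a x y; apply: lin_tliftl => u v.
by apply: lin_purel; apply: lin_homl.
Qed.

Lemma lin_tmapr (X : lmodType k) U V U' V' (f : 'Hom(U, U')) (g : X -> 'Hom(V, V')) :
  linear g -> linear (fun x => tmap f (g x)).
Proof.
move=> lf a x y; apply/lfunP => t.
rewrite add_lfunE scale_lfunE !tmapE; move: a x y; apply: lin_tliftl => u v.
by apply: lin_purer; apply: lin_homl.
Qed.

End TensorTheory.

Ltac lin := intros; cbv beta;
  first
  [ exact: lin_id
  | apply: lin_purel; lin | apply: lin_purer; lin
  | apply: lin_scalel; lin | apply: lin_scaler; lin
  | apply: lin_mull; lin | apply: lin_mulr; lin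
  | apply: lin_tliftr; lin | apply: lin_tliftl; lin
  | apply: lin_tmapl; lin | apply: lin_tmapr; lin
  | apply: lin_homl; lin | apply: lin_hom; lin ].
Ltac bilin := split; lin.

Section TensorMaps.
Variable k : fieldType.
Implicit Types U V W : vectType k.

Lemma tmap_bilin U V U' V' (f : 'Hom(U, U')) (g : 'Hom(V, V')) :
  bilin (fun u v => f u ⊗ g v).
Proof.
by split=> w a u v; rewrite linearP ?tpureDl ?tpureZl // linearP.
Qed.

Lemma tmap_pure U V U' V' (f : 'Hom(U, U')) (g : 'Hom(V, V')) u v :
  tmap f g (u ⊗ v) = f u ⊗ g v.
Proof. by rewrite tmapE (tlift_pure _ _ (tmap_bilin f g)). Qed.

Lemma tlift_tmap U V U' V' (W : lmodType k) (F : U' -> V' -> W)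
    (f : 'Hom(U, U')) (g : 'Hom(V, V')) t :
  bilin F -> tlift F (tmap f g t) = \tsum_(u, v <- t) F (f u) (g v).
Proof.
move=> bF; rewrite tmapE linear_tlift; apply: eq_tlift => u v /=.
exact: tlift_pure.
Qed.

Lemma tlift_tlift U V U' V' (W : lmodType k) (F : U' -> V' -> W)
    (f : U -> V -> U') (g : U -> V -> V') t :
  bilin F ->
  tlift F (\tsum_(u, v <- t) (f u v ⊗ g u v)) = \tsum_(u, v <- t) F (f u v) (g u v).
Proof.
move=> bF; rewrite linear_tlift; apply: eq_tlift => u v /=.
exact: tlift_pure.
Qed.

Definition tassoc U V W : 'Hom(tens (tens U V) W, tens U (tens V W)) :=
  linfun (tlift (fun t w => \tsum_(u, v <- t) (u ⊗ (v ⊗ w)))).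

Lemma tassoc_pure U V W (u : U) (v : V) (w : W) :
  tassoc U V W (u ⊗ v ⊗ w) = u ⊗ (v ⊗ w).
Proof.
rewrite lfunE /= tlift_pure; last first.
  split=> x a s t; first exact: linearP.
  rewrite -tlift_linP; apply: eq_tlift => ? ?.
  by rewrite !linearP.
rewrite tlift_pure //; split=> x a s t.
  by rewrite tpureDl tpureZl.
by rewrite tpureDl tpureZl linearP.
Qed.

Lemma id_lfunK U : cancel (\1%VF : 'End(U)) (\1%VF : 'End(U)).
Proof. by move=> u; rewrite !id_lfunE. Qed.

Lemma tmap1 U V t : tmap (\1%VF : 'End(U)) (\1%VF : 'End(V)) t = t.
Proof.
by rewrite tmapE -[RHS]tlift_id; apply: eq_tlift => u v; rewrite !id_lfunE.
Qed.

Lemma tlift_lfunE U V (W W' : vectType k) (F : U -> V -> 'Hom(W, W')) t w :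
  tlift F t w = \tsum_(u, v <- t) F u v w.
Proof.
have l : linear (fun f : 'Hom(W, W') => f w) by lin.
exact: (linear_tlift (lin_of l)).
Qed.

Lemma tmapK U V U' V' (f : 'Hom(U, U')) (g : 'Hom(V, V'))
    (f' : 'Hom(U', U)) (g' : 'Hom(V', V)) :
  cancel f f' -> cancel g g' -> cancel (tmap f g) (tmap f' g').
Proof.
move=> fK gK; apply: (@tens_ext _ _ _ _ (fun r => tmap f' g' (tmap f g r)) id) => //.
  by move=> a u v; rewrite !linearP.
by move=> u v; rewrite !tmap_pure fK gK.
Qed.

Lemma tensv_ext U V W (U' : {vspace U}) (V' : {vspace V})
    (f g : 'Hom(tens U V, W)) t :
  (forall u v, u \in U' -> v \in V' -> f (u ⊗ v) = g (u ⊗ v)) ->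
  t \in tensv U' V' -> f t = g t.
Proof.
move=> e tUV; apply/eqP; rewrite -subr_eq0 -opp_lfunE -add_lfunE -memv_ker.
apply: subvP tUV; apply/span_subvP => _ /allpairsP[[u v] /= [uU vV ->]].
by rewrite memv_ker add_lfunE opp_lfunE e ?subrr // vbasis_mem.
Qed.

End TensorMaps.

Section Structures.
Variable k : fieldType.

Record hopfAlg := HopfAlg {
  hopf_sort :> falgType k;
  comul : 'Hom(hopf_sort, tens hopf_sort hopf_sort);
  counit : 'Hom(hopf_sort, k^o);
  antipode : 'End(hopf_sort);
  comulA : forall h, \tsum_(h', h3 <- comul h) \tsum_(h1, h2 <- comul h')
                       (h1 ⊗ (h2 ⊗ h3))
                     = \tsum_(h1, h' <- comul h) (h1 ⊗ comul h');
  comul_counitl : forall h, \tsum_(h1, h2 <- comul h) ((counit h1 : k) *: h2) = h;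
  comul_counitr : forall h, \tsum_(h1, h2 <- comul h) ((counit h2 : k) *: h1) = h;
  comul1 : comul 1 = 1 ⊗ 1;
  comulM : forall g h, comul (g * h) =
    \tsum_(g1, g2 <- comul g) \tsum_(h1, h2 <- comul h) ((g1 * h1) ⊗ (g2 * h2));
  counit1 : counit 1 = 1;
  counitM : forall g h, counit (g * h) = counit g * counit h;
  antipodel : forall h,
    \tsum_(h1, h2 <- comul h) (antipode h1 * h2) = (counit h : k) *: 1;
  antipoder : forall h,
    \tsum_(h1, h2 <- comul h) (h1 * antipode h2) = (counit h : k) *: 1
}.

Definition is_coaction (H : hopfAlg) (V : vectType k) (d : 'Hom(V, tens H V)) :=
  (forall v, \tsum_(h, w <- d v) \tsum_(h1, h2 <- comul H h) (h1 ⊗ (h2 ⊗ w))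
             = \tsum_(h, w <- d v) (h ⊗ d w))
  /\ (forall v, \tsum_(h, w <- d v) ((counit H h : k) *: w) = v).

Definition is_action (A : falgType k) (M : vectType k)
    (act : 'Hom(A, 'Hom(M, M))) :=
  (forall m, act 1 m = m) /\ (forall a b m, act (a * b) m = act a (act b m)).

Record comodAlg (H : hopfAlg) := ComodAlg {
  ca_sort :> falgType k;
  coact : 'Hom(ca_sort, tens H ca_sort);
  coactP : is_coaction coact;
  coact1 : coact 1 = 1 ⊗ 1;
  coactM : forall a b, coact (a * b) =
    \tsum_(g, a0 <- coact a) \tsum_(h, b0 <- coact b) ((g * h) ⊗ (a0 * b0))
}.

Definition left_ideal (A : falgType k) (J : {vspace A}) :=
  forall a x, x \in J -> a * x \in J.

Definition right_ideal (A : falgType k) (J : {vspace A}) :=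
  forall a x, x \in J -> x * a \in J.

(* The left regular module is completely reducible. *)
Definition semisimple (A : falgType k) :=
  forall I : {vspace A}, left_ideal I ->
  exists J : {vspace A},
    [/\ left_ideal J, (I :&: J = 0)%VS & (I + J = fullv)%VS].

Definition coinvariants (H : hopfAlg) (A : comodAlg H) : {vspace A} :=
  lker (coact A - linfun (tpure (1 : H))).

Definition right_simple (H : hopfAlg) (A : comodAlg H) :=
  forall J : {vspace A}, right_ideal J ->
    (coact A @: J <= tensv (fullv : {vspace H}) J)%VS ->
    J = 0%VS \/ J = fullv.

Definition AM_exact (H : hopfAlg) (A : comodAlg H) :=
  right_simple A /\ \dim (coinvariants A) = 1%N.

Lemma comul_coaction (H : hopfAlg) : is_coaction (comul H).
Proof. by split; [exact: comulA | exact: comul_counitl]. Qed.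

Definition regular_comodAlg (H : hopfAlg) : comodAlg H :=
  @ComodAlg H H (comul H) (comul_coaction H) (comul1 H) (@comulM H).

(* An [{aspace H}] may have an identity element other than 1. *)
Record lcoidealSubalg (H : hopfAlg) := LCoidealSubalg {
  lcs_space :> {aspace H};
  lcs1 : 1 \in lcs_space;
  lcs_coideal : (comul H @: lcs_space <= tensv (fullv : {vspace H}) lcs_space)%VS
}.

Section CoidealComodule.
Variables (H : hopfAlg) (L : lcoidealSubalg H).

Let LA : falgType k := subvs_of L.
Let inc : 'Hom(LA, H) := linfun (vsval : subvs_of L -> H).
Let prj : 'Hom(H, LA) := linfun (vsproj L).

(* The corestriction to H (x) L of comul restricted to L. *)
Definition lcs_coact : 'Hom(LA, tens H LA) :=
  linfun (fun x : subvs_of L => tmap \1%VF prj (comul H (vsval x))).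

Lemma lcs_coactE x : lcs_coact x = tmap \1%VF prj (comul H (vsval x)).
Proof. by rewrite linfunE // => a u v; rewrite !linearP. Qed.

Lemma lcs_coactK x :
  \tsum_(h, y <- lcs_coact x) (h ⊗ (vsval y : H)) = comul H (vsval x).
Proof.
have -> : \tsum_(h, y <- lcs_coact x) (h ⊗ (vsval y : H))
          = tmap \1%VF inc (lcs_coact x).
  by rewrite tmapE; apply: eq_tlift => u v; rewrite id_lfunE lfunE.
have sL : comul H (vsval x) \in tensv fullv L.
  by apply: (subvP (lcs_coideal L)); apply/memv_img/subvsP.
rewrite lcs_coactE -comp_lfunE -[RHS]id_lfunE; apply: (tensv_ext _ sL) => u v _ vL.
by rewrite comp_lfunE !tmap_pure !id_lfunE !lfunE /= vsprojK.
Qed.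

Let incK : cancel inc prj.
Proof. by move=> x; rewrite !lfunE /= vsvalK. Qed.

Lemma lcs_coact_inc x : tmap \1%VF inc (lcs_coact x) = comul H (inc x).
Proof.
rewrite [inc x]lfunE -lcs_coactK tmapE; apply: eq_tlift => u v.
by rewrite id_lfunE lfunE.
Qed.

Lemma lcs_coactP : is_coaction lcs_coact.
Proof.
split=> v.
  pose J := tmap (\1%VF : 'End(H)) (tmap (\1%VF : 'End(H)) inc).
  have Jinj : injective J.
    exact: can_inj (tmapK (@id_lfunK _ _) (tmapK (@id_lfunK _ _) incK)).
  apply: Jinj; rewrite !linear_tlift.
  transitivity (\tsum_(h, x <- tmap \1%VF inc (lcs_coact v))
                 \tsum_(h1, h2 <- comul H h) (h1 ⊗ (h2 ⊗ x))).
    rewrite tlift_tmap; last by bilin.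
    apply: eq_tlift => h w; rewrite id_lfunE linear_tlift.
    by apply: eq_tlift => h1 h2; rewrite /J /= !tmap_pure !id_lfunE.
  rewrite lcs_coact_inc comulA -lcs_coact_inc tlift_tmap; last by bilin.
  by apply: eq_tlift => h w; rewrite /J /= tmap_pure id_lfunE lcs_coact_inc.
apply: (can_inj incK); rewrite linear_tlift -[RHS]comul_counitl -lcs_coact_inc.
rewrite tlift_tmap; last by bilin.
by apply: eq_tlift => h w; rewrite id_lfunE linearZ.
Qed.

Let inc1 : inc 1 = 1.
Proof. by rewrite lfunE /=; apply/eqP; rewrite algid_eq1 lcs1. Qed.

Let incM : {morph inc : x y / x * y}.
Proof. by move=> x y; rewrite !lfunE. Qed.

Lemma lcs_coact1 : lcs_coact 1 = 1 ⊗ 1.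
Proof.
apply: (can_inj (tmapK (@id_lfunK _ H) incK)).
by rewrite lcs_coact_inc tmap_pure id_lfunE inc1 comul1.
Qed.

Lemma lcs_coactM x y : lcs_coact (x * y) =
  \tsum_(g, a <- lcs_coact x) \tsum_(h, b <- lcs_coact y) ((g * h) ⊗ (a * b)).
Proof.
apply: (can_inj (tmapK (@id_lfunK _ H) incK)).
rewrite lcs_coact_inc incM comulM -!lcs_coact_inc linear_tlift.
rewrite tlift_tmap; last by bilin.
apply: eq_tlift => g a; rewrite linear_tlift tlift_tmap; last by bilin.
by apply: eq_tlift => h b; rewrite /= tmap_pure !id_lfunE incM.
Qed.

Definition lcs_comodAlg : comodAlg H :=
  ComodAlg lcs_coactP lcs_coact1 lcs_coactM.

End CoidealComodule.

Record lmodule (A : falgType k) := LModule {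
  lmod_sort :> vectType k;
  lact : 'Hom(A, 'Hom(lmod_sort, lmod_sort));
  lactP : is_action lact
}.

Record modHom (A : falgType k) (M N : lmodule A) := ModHom {
  mh_fun :> 'Hom(M, N);
  mhP : forall a m, mh_fun (lact M a m) = lact N a (mh_fun m)
}.

Lemma mh_idP (A : falgType k) (M : lmodule A) a (m : M) :
  (\1%VF : 'End(M)) (lact M a m) = lact M a ((\1%VF : 'End(M)) m).
Proof. by rewrite !id_lfunE. Qed.

Definition mh_id (A : falgType k) (M : lmodule A) : modHom M M :=
  ModHom (@mh_idP A M).

Section HomOperations.
Variables (A : falgType k) (M N P : lmodule A).

Lemma mh_compP (g : modHom N P) (f : modHom M N) a m :
  (g \o f)%VF (lact M a m) = lact P a ((g \o f)%VF m).
Proof. by rewrite !comp_lfunE !mhP. Qed.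

Definition mh_comp (g : modHom N P) (f : modHom M N) : modHom M P :=
  ModHom (mh_compP g f).

Lemma mh_linP c (f g : modHom M N) a m :
  (c *: (f : 'Hom(M, N)) + g) (lact M a m)
  = lact N a ((c *: (f : 'Hom(M, N)) + g) m).
Proof. by rewrite !add_lfunE !scale_lfunE !mhP linearP. Qed.

(* c f + g *)
Definition mh_lin c (f g : modHom M N) : modHom M N := ModHom (mh_linP c f g).

Definition mh_iso (f : modHom M N) :=
  exists g : modHom N M, cancel f g /\ cancel g f.

End HomOperations.

(* k-linear functors between categories of finite-dimensional modules;
   morphisms are compared by their underlying functions. *)
Record linFunctor (A B : falgType k) := LinFunctor {
  fobj :> lmodule A -> lmodule B;
  fmap : forall M N : lmodule A, modHom M N -> modHom (fobj M) (fobj N);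
  fmap_ext : forall (M N : lmodule A) (f g : modHom M N),
    f =1 g -> fmap f =1 fmap g;
  fmap_id : forall M : lmodule A, fmap (mh_id M) =1 mh_id (fobj M);
  fmap_comp : forall (M N P : lmodule A) (g : modHom N P) (f : modHom M N),
    fmap (mh_comp g f) =1 mh_comp (fmap g) (fmap f);
  fmap_lin : forall (M N : lmodule A) c (f g : modHom M N),
    fmap (mh_lin c f g) =1 mh_lin c (fmap f) (fmap g)
}.

Definition functor_id (A : falgType k) : linFunctor A A :=
  @LinFunctor A A (fun M => M) (fun _ _ f => f) (fun _ _ _ _ e => e)
    (fun _ _ => erefl) (fun _ _ _ _ _ _ => erefl) (fun _ _ _ _ _ _ => erefl).

Arguments fmap_id {A B} l M.
Arguments fmap_comp {A B} l {M N P} g f.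
Arguments fmap_lin {A B} l {M N} c f g.

Section FunctorComp.
Variables (A B C : falgType k) (G : linFunctor B C) (F : linFunctor A B).

Let mapGF (M N : lmodule A) (f : modHom M N) : modHom (G (F M)) (G (F N)) :=
  fmap G (fmap F f).

Lemma functor_comp_ext (M N : lmodule A) (f g : modHom M N) :
  f =1 g -> mapGF f =1 mapGF g.
Proof. by move=> e; apply/fmap_ext/fmap_ext. Qed.

Lemma functor_comp_id (M : lmodule A) : mapGF (mh_id M) =1 mh_id (G (F M)).
Proof. by move=> x; rewrite (fmap_ext (fmap_id F M)) fmap_id. Qed.

Lemma functor_comp_comp (M N P : lmodule A) (g : modHom N P) (f : modHom M N) :
  mapGF (mh_comp g f) =1 mh_comp (mapGF g) (mapGF f).
Proof. by move=> x; rewrite (fmap_ext (fmap_comp F g f)) fmap_comp. Qed.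

Lemma functor_comp_lin (M N : lmodule A) c (f g : modHom M N) :
  mapGF (mh_lin c f g) =1 mh_lin c (mapGF f) (mapGF g).
Proof. by move=> x; rewrite (fmap_ext (fmap_lin F c f g)) fmap_lin. Qed.

Definition functor_comp : linFunctor A C :=
  LinFunctor functor_comp_ext functor_comp_id functor_comp_comp functor_comp_lin.

End FunctorComp.

Definition nat_iso (A B : falgType k) (F G : linFunctor A B) :=
  exists eta : forall M : lmodule A, modHom (F M) (G M),
    (forall (M N : lmodule A) (f : modHom M N) x,
       eta N (fmap F f x) = fmap G f (eta M x))
    /\ (forall M, mh_iso (eta M)).

Definition is_equivalence (A B : falgType k) (F : linFunctor A B) :=
  exists G : linFunctor B A,
    nat_iso (functor_comp G F) (functor_id A)
    /\ nat_iso (functor_comp F G) (functor_id B).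

Section TensorAction.
Variables (H : hopfAlg) (A : comodAlg H).
Implicit Types (X Y : lmodule H) (M N : lmodule A).

Definition tens_lact X M : 'Hom(A, 'Hom(tens X M, tens X M)) :=
  linfun (fun a => \tsum_(h, a0 <- coact A a) tmap (lact X h) (lact M a0)).

Lemma tens_lactE X M a t : tens_lact X M a t =
  \tsum_(h, a0 <- coact A a) tmap (lact X h) (lact M a0) t.
Proof. by rewrite linfunE ?tlift_lfunE //; lin. Qed.

Lemma tens_lact_pure X M a x m : tens_lact X M a (x ⊗ m) =
  \tsum_(h, a0 <- coact A a) (lact X h x ⊗ lact M a0 m).
Proof. by rewrite tens_lactE; apply: eq_tlift => h a0; rewrite tmap_pure. Qed.

Lemma tens_lactP X M : is_action (tens_lact X M).
Proof.
have [[X1 XM] [M1 MM]] := (lactP X, lactP M).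
split=> [t|a b].
  rewrite tens_lactE coact1 tlift_pure; last by bilin.
  have -> : lact X 1 = \1%VF by apply/lfunP => x; rewrite X1 id_lfunE.
  have -> : lact M 1 = \1%VF by apply/lfunP => m; rewrite M1 id_lfunE.
  exact: tmap1.
apply: tens_ext; [by lin | by lin |] => x m.
rewrite !tens_lact_pure coactM linear_tlift /= [RHS]linear_tlift.
transitivity (\tsum_(h, b0 <- coact A b) \tsum_(g, a0 <- coact A a)
  (lact X g (lact X h x) ⊗ lact M a0 (lact M b0 m))).
  rewrite exchange_tlift; apply: eq_tlift => g a0.
  rewrite tlift_tlift; last by bilin.
  by apply: eq_tlift => h b0; rewrite XM MM.
by apply: eq_tlift => h b0; rewrite /= tens_lact_pure.
Qed.

Definition tens_act X M : lmodule A := LModule (tens_lactP X M).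

Lemma tens_homP X Y M N (f : modHom X Y) (g : modHom M N) a t :
  tmap f g (lact (tens_act X M) a t) = lact (tens_act Y N) a (tmap f g t).
Proof.
move: t; apply: tens_ext; [by lin | by lin |] => x m /=.
rewrite tmap_pure !tens_lact_pure linear_tlift; apply: eq_tlift => h a0.
by rewrite /= tmap_pure !mhP.
Qed.

Definition tens_hom X Y M N (f : modHom X Y) (g : modHom M N) :
  modHom (tens_act X M) (tens_act Y N) := 
  @ModHom A (tens_act X M) (tens_act Y N) (tmap f g) (tens_homP f g).

End TensorAction.

Definition tens_mod (H : hopfAlg) (X Y : lmodule H) : lmodule H :=
  tens_act (A := regular_comodAlg H) X Y.

Section UnitObject.
Variable H : hopfAlg.

Definition unit_lact : 'Hom(H, 'Hom(k^o, k^o)) :=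
  linfun (fun h => (counit H h : k) *: \1%VF).

Lemma unit_lactE h c : unit_lact h c = (counit H h : k) *: c.
Proof. by rewrite linfunE ?scale_lfunE ?id_lfunE //; lin. Qed.

Lemma unit_lactP : is_action unit_lact.
Proof.
split=> [c|a b c]; rewrite !unit_lactE; first by rewrite counit1 scale1r.
by rewrite counitM scalerA.
Qed.

Definition unit_mod : lmodule H := LModule unit_lactP.

End UnitObject.

Section Constraints.
Variables (H : hopfAlg) (A : comodAlg H).
Implicit Types (X Y : lmodule H) (M : lmodule A).

Lemma assoc_homP X Y M a t :
  tassoc X Y M (lact (tens_act (tens_mod X Y) M) a t)
  = lact (tens_act X (tens_act Y M)) a (tassoc X Y M t).
Proof.
move: t; apply: tens_ext; [by lin | by lin |] => t m; move: t.
apply: tens_ext; [by lin | by lin |] => x y.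
transitivity (tassoc X Y M
    (\tsum_(h, a0 <- coact A a) (lact (tens_mod X Y) h (x ⊗ y) ⊗ lact M a0 m))).
  have := @tens_lact_pure H A (tens_mod X Y) M a (x ⊗ y) m.
  by move=> E; exact (f_equal (tassoc X Y M) E).
rewrite tassoc_pure /= (@tens_lact_pure H A X (tens_act Y M)) linear_tlift /=.
pose Phi : tens H (tens H A) -> tens X (tens Y M) :=
  tlift (fun h t => lact X h x ⊗ \tsum_(h', b <- t) (lact Y h' y ⊗ lact M b m)).
have lPhi : linear Phi by rewrite /Phi; lin.
have := congr1 (lin_of lPhi) ((coactP A).1 a); rewrite !linear_tlift /= => E.
transitivity (\tsum_(h, w <- coact A a)
    lin_of lPhi (\tsum_(h1, h2 <- comul H h) (h1 ⊗ (h2 ⊗ w)))).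
  apply: eq_tlift => h w; rewrite (tens_lact_pure (A := regular_comodAlg H)) /=.
  have lT : linear (fun t : tens X Y => tassoc X Y M (t ⊗ lact M w m)) by lin.
  rewrite -[LHS]/(lin_of lT _) linear_tlift [RHS]linear_tlift /=.
  apply: eq_tlift => h1 h2; rewrite /= tassoc_pure /Phi tlift_pure; last by bilin.
  by rewrite tlift_pure //; bilin.
rewrite E; apply: eq_tlift => h a0 /=.
by rewrite /Phi tlift_pure ?tens_lact_pure //; bilin.
Qed.

Definition assoc_hom X Y M :
    modHom (tens_act (tens_mod X Y) M) (tens_act X (tens_act Y M)) :=
  @ModHom A (tens_act (tens_mod X Y) M) (tens_act X (tens_act Y M))
    (tassoc X Y M) (@assoc_homP X Y M).

Definition tunit M : 'Hom(tens k^o M, M) :=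
  linfun (tlift (fun (c : k^o) (m : M) => (c : k) *: m)).

Lemma unit_homP M a t :
  tunit M (lact (tens_act (unit_mod H) M) a t) = lact M a (tunit M t).
Proof.
move: t; apply: tens_ext; [by lin | by lin |] => c m.
transitivity (tunit M
    (\tsum_(h, a0 <- coact A a) (unit_lact H h c ⊗ lact M a0 m))).
  have := @tens_lact_pure H A (unit_mod H) M a c m.
  by move=> E; exact (f_equal (tunit M) E).
rewrite linear_tlift [tunit M (c ⊗ m)]lfunE /=.
rewrite tlift_pure; last by bilin.
have lE : linear (fun b => lact M b (c *: m)) by lin.
have := congr1 (lin_of lE) ((coactP A).2 a); rewrite linear_tlift /= => <-.
apply: eq_tlift => h a0; rewrite /= lfunE /= tlift_pure; last by bilin.
by rewrite unit_lactE !linearZ /= scale_lfunE scalerA mulrC.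
Qed.

Definition unit_hom M : modHom (tens_act (unit_mod H) M) M :=
  @ModHom A (tens_act (unit_mod H) M) M (tunit M) (@unit_homP M).

End Constraints.
Record moduleFunctor (H : hopfAlg) (A B : comodAlg H) := ModuleFunctor {
  mf_functor :> linFunctor A B;
  mf_c : forall (X : lmodule H) (M : lmodule A),
    modHom (mf_functor (tens_act X M)) (tens_act X (mf_functor M));
  mf_c_iso : forall X M, mh_iso (mf_c X M);
  mf_c_nat : forall (X Y : lmodule H) (M N : lmodule A)
      (f : modHom X Y) (g : modHom M N) t,
    mf_c Y N (fmap mf_functor (tens_hom f g) t)
    = tens_hom f (fmap mf_functor g) (mf_c X M t);
  mf_c_assoc : forall (X Y : lmodule H) (M : lmodule A) t,
    assoc_hom X Y (mf_functor M) (mf_c (tens_mod X Y) M t)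
    = tens_hom (mh_id X) (mf_c Y M)
        (mf_c X (tens_act Y M) (fmap mf_functor (assoc_hom X Y M) t));
  mf_c_unit : forall (M : lmodule A) t,
    unit_hom (mf_functor M) (mf_c (unit_mod H) M t)
    = fmap mf_functor (unit_hom M) t
}.

Definition morita_equiv (H : hopfAlg) (A B : comodAlg H) :=
  exists F : moduleFunctor A B, is_equivalence F.

Record ydStruct (H : hopfAlg) (V : vectType k) := YDStruct {
  yd_act : 'Hom(H, 'Hom(V, V));
  yd_coact : 'Hom(V, tens H V);
  yd_actP : is_action yd_act;
  yd_coactP : is_coaction yd_coact;
  yd_compat : forall h v, yd_coact (yd_act h v) =
    \tsum_(h1, h' <- comul H h) \tsum_(h2, h3 <- comul H h')
      \tsum_(g, w <- yd_coact v) ((h1 * g * antipode H h3) ⊗ yd_act h2 w)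
}.

(* Hopf algebras in the braided category of Yetter-Drinfeld modules over H,
   with braiding r (x) s |-> r_(-1) . s (x) r_(0). *)
Record braidedHopf (H : hopfAlg) := BraidedHopf {
  bh_sort :> falgType k;
  bh_yd : ydStruct H bh_sort;
  bh_comul : 'Hom(bh_sort, tens bh_sort bh_sort);
  bh_counit : 'Hom(bh_sort, k^o);
  bh_antipode : 'End(bh_sort);
  bh_comulA : forall r,
    \tsum_(r', r3 <- bh_comul r) \tsum_(r1, r2 <- bh_comul r')
      (r1 ⊗ (r2 ⊗ r3))
    = \tsum_(r1, r' <- bh_comul r) (r1 ⊗ bh_comul r');
  bh_counitl : forall r,
    \tsum_(r1, r2 <- bh_comul r) ((bh_counit r1 : k) *: r2) = r;
  bh_counitr : forall r,
    \tsum_(r1, r2 <- bh_comul r) ((bh_counit r2 : k) *: r1) = r;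
  (* multiplication and unit are morphisms of Yetter-Drinfeld modules *)
  bh_act1 : forall h, yd_act bh_yd h 1 = (counit H h : k) *: 1;
  bh_actM : forall h r s, yd_act bh_yd h (r * s) =
    \tsum_(h1, h2 <- comul H h) (yd_act bh_yd h1 r * yd_act bh_yd h2 s);
  bh_coact1 : yd_coact bh_yd 1 = 1 ⊗ 1;
  bh_coactM : forall r s, yd_coact bh_yd (r * s) =
    \tsum_(g, r0 <- yd_coact bh_yd r) \tsum_(h, s0 <- yd_coact bh_yd s)
      ((g * h) ⊗ (r0 * s0));
  (* comultiplication and counit are morphisms of Yetter-Drinfeld modules *)
  bh_act_comul : forall h r, bh_comul (yd_act bh_yd h r) =
    \tsum_(h1, h2 <- comul H h) \tsum_(r1, r2 <- bh_comul r)
      (yd_act bh_yd h1 r1 ⊗ yd_act bh_yd h2 r2);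
  bh_act_counit : forall h r,
    bh_counit (yd_act bh_yd h r) = counit H h * bh_counit r;
  bh_coact_comul : forall r,
    \tsum_(r1, r2 <- bh_comul r)
      \tsum_(g, s1 <- yd_coact bh_yd r1) \tsum_(h, s2 <- yd_coact bh_yd r2)
        ((g * h) ⊗ (s1 ⊗ s2))
    = \tsum_(h, s <- yd_coact bh_yd r) (h ⊗ bh_comul s);
  bh_coact_counit : forall r,
    \tsum_(h, s <- yd_coact bh_yd r) ((bh_counit s : k) *: h)
    = (bh_counit r : k) *: 1;
  (* comultiplication and counit are algebra morphisms, for the braided
     multiplication of the tensor square *)
  bh_comul1 : bh_comul 1 = 1 ⊗ 1;
  bh_comulM : forall r s, bh_comul (r * s) =
    \tsum_(r1, r2 <- bh_comul r) \tsum_(s1, s2 <- bh_comul s)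
      \tsum_(h, r0 <- yd_coact bh_yd r2)
        ((r1 * yd_act bh_yd h s1) ⊗ (r0 * s2));
  bh_counit1 : bh_counit 1 = 1;
  bh_counitM : forall r s, bh_counit (r * s) = bh_counit r * bh_counit s;
  bh_antipodel : forall r,
    \tsum_(r1, r2 <- bh_comul r) (bh_antipode r1 * r2)
    = (bh_counit r : k) *: 1;
  bh_antipoder : forall r,
    \tsum_(r1, r2 <- bh_comul r) (r1 * bh_antipode r2)
    = (bh_counit r : k) *: 1
}.

(* V is the direct sum of the V_n. *)
Definition is_grading (V : vectType k) (gr : nat -> {vspace V}) :=
  (forall n, directv (\sum_(i < n) gr i))
  /\ (exists n, (\sum_(i < n) gr i)%VS = fullv).

Definition is_alg_grading (A : falgType k) (gr : nat -> {vspace A}) :=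
  [/\ is_grading gr, 1 \in gr 0%N
    & forall i j, (gr i * gr j <= gr (i + j)%N)%VS].

(* B = \bigoplus_n B^n is the Nichols algebra of V: a graded Hopf algebra in the
   category of Yetter-Drinfeld modules such that B^0 = k, B^1 is isomorphic to V,
   generated in degree one, and whose primitive elements are those of B^1. *)
Record is_nichols (H : hopfAlg) (V : vectType k) (yV : ydStruct H V)
    (B : braidedHopf H) (gr : nat -> {vspace B}) : Prop := IsNichols {
  nichols_grading : is_alg_grading gr;
  nichols_act : forall n h r, r \in gr n -> yd_act (bh_yd B) h r \in gr n;
  nichols_coact : forall n,
    (yd_coact (bh_yd B) @: gr n <= tensv (fullv : {vspace H}) (gr n))%VS;
  nichols_comul : forall n,
    (bh_comul B @: gr n <= \sum_(i < n.+1) tensv (gr i) (gr (n - i)%N))%VS;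
  nichols_counit : forall n r, (0 < n)%N -> r \in gr n -> bh_counit B r = 0;
  nichols0 : gr 0%N = 1%VS;
  nichols1 : exists f : 'Hom(V, B),
    [/\ lker f = 0%VS, limg f = gr 1%N,
        forall h v, f (yd_act yV h v) = yd_act (bh_yd B) h (f v)
      & forall v, yd_coact (bh_yd B) (f v)
                  = \tsum_(h, w <- yd_coact yV v) (h ⊗ f w)];
  nichols_generated : agenv (gr 1%N) = fullv;
  nichols_primitive : forall r,
    bh_comul B r = r ⊗ 1 + 1 ⊗ r <-> r \in gr 1%N
}.

(* The linear isomorphism phi : B (x) H0 -> H, r (x) g |-> r # g, identifies the
   Hopf algebra H with the Radford biproduct B # H0. *)
Record is_bosonization (H0 : hopfAlg) (B : braidedHopf H0) (H : hopfAlg)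
    (phi : 'Hom(tens B H0, H)) : Prop := IsBosonization {
  bos_inj : lker phi = 0%VS;
  bos_surj : limg phi = fullv;
  bos_one : phi (1 ⊗ 1) = 1;
  bos_mul : forall (r s : B) (g h : H0), phi (r ⊗ g) * phi (s ⊗ h) =
    \tsum_(g1, g2 <- comul H0 g)
      phi ((r * yd_act (bh_yd B) g1 s) ⊗ (g2 * h));
  bos_counit : forall (r : B) (g : H0),
    counit H (phi (r ⊗ g)) = bh_counit B r * counit H0 g;
  bos_comul : forall (r : B) (g : H0), comul H (phi (r ⊗ g)) =
    \tsum_(r1, r2 <- bh_comul B r) \tsum_(h, r0 <- yd_coact (bh_yd B) r2)
      \tsum_(g1, g2 <- comul H0 g) (phi (r1 ⊗ (h * g1)) ⊗ phi (r0 ⊗ g2))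
}.

(* H(n) = B^n # H0 *)
Definition bos_grading (H0 : hopfAlg) (B : braidedHopf H0) (H : hopfAlg)
    (phi : 'Hom(tens B H0, H)) (gr : nat -> {vspace B}) (n : nat) :
    {vspace H} :=
  (phi @: tensv (gr n) (fullv : {vspace H0}))%VS.

(* [gH] is meant to be a coradical grading of H, such as [bos_grading] when H0 is
   semisimple in characteristic zero: the n-th term H_n of the coradical
   filtration is then the sum of the H(i), i <= n. *)
Record loewy_graded (H : hopfAlg) (gH : nat -> {vspace H}) (A : comodAlg H)
    (gA : nat -> {vspace A}) : Prop := LoewyGraded {
  loewy_grading : is_alg_grading gA;
  loewy_filtration : forall n,
    (coact A @^-1: tensv (\sum_(i < n.+1) gH i) (fullv : {vspace A})
     = \sum_(i < n.+1) gA i)%VS;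
  loewy_coact : forall n,
    (coact A @: gA n <= \sum_(i < n.+1) tensv (gH i) (gA (n - i)%N))%VS
}.

End Structures.

(* Main.v *)
From HB Require Import structures.
Require Import Defs.
From mathcomp Require Import all_boot all_order all_algebra all_field.

(* Put A0 := A(0), an AM-exact H0-comodule algebra onto which A projects as an
   algebra, and let F be an equivalence from A0-modules to L0-modules, with L0 a
   left coideal subalgebra of H0. Choose an A0-module M sent by F to the
   one-dimensional L0-module given by the counit, and Q0 sent to L0. Then F and
   its module constraint identify A0-maps N -> H0 (x) M with L0-maps F N -> H0;
   this turns F A0 and Q0 into H0-stable spaces of rows P0 and columns Q0 with
   entries in H0, with 1 in P0 Q0, while Q0 P0 lies in the image of A0 in
   H0 (x) End M. Inflating M to A along the projection, A acts by matrices over H,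
   and L := P0 A Q0 is a left coideal subalgebra of H. Since A is right H-simple,
   this representation is faithful and A Q0 P0 A = A, so P0 A and A Q0 form a
   Morita context between L and A. The functor N |-> Hom_A(A Q0, N) is then an
   equivalence of module categories. *)

Set Implicit Arguments.
Unset Strict Implicit.
Unset Printing Implicit Defensive.

Import GRing.Theory VectorInternalTheory.
Local Open Scope ring_scope.

(** * Subspaces of tensor products and module maps *)

Section TensorSubspaces.
Variable k : fieldType.
Implicit Types U V W : vectType k.

(** The equivalence provided by the hypothesis lives over H0 and says nothing about modules over H,
    so it is not lifted as a functor. Its matrix form is what extends: H0 embeds in H as 1 # H0, so
    rows and columns over H0 are also rows and columns over H, and A can be inserted between them. M
    must go to a one-dimensional module because the constraint then reads F (H0 (x) M) = H0 (x) k =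
    H0, with L0 acting by left multiplication; this is where entries in H0 come from. That 1 lies in
    P0 Q0 reflects that A0 generates its modules; that Q0 P0 lies in the image of A0 reflects that F
    is fully faithful. A, L, P0 A and A Q0 all sit inside one comodule algebra, H tensored with
    matrices of size 1 + dim M. Products are taken there, so associativity of the context and its
    compatibility with the coactions are inherited instead of being checked piece by piece. In this
    algebra a in A becomes a_(-1) (x) a_(0), the second factor acting on M through the projection to
    A0. *)

Lemma tpure_in_tensv U V (U' : {vspace U}) (V' : {vspace V}) u v :
  u \in U' -> v \in V' -> u ⊗ v \in tensv U' V'.
Proof.
move=> uU vV; rewrite (coord_vbasis uU) (coord_vbasis vV).
have -> (w : V) : (\sum_i coord (vbasis U') i u *: (vbasis U')`_i) ⊗ w =
    \sum_i coord (vbasis U') i u *: ((vbasis U')`_i ⊗ w).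
  by rewrite (linear_sumZ _ _ (tpure_linearl w)).
apply: rpred_sum => i _; apply: rpredZ; rewrite linear_sum.
apply: rpred_sum => j _; rewrite linearZ; apply: rpredZ; apply: memv_span.
by apply/allpairsP; exists ((vbasis U')`_i, (vbasis V')`_j); split=> //;
  apply: mem_nth; rewrite size_tuple.
Qed.

Lemma tlift_memv U V W (W' : {vspace W}) (f : U -> V -> W) t :
  (forall u v, f u v \in W') -> tlift f t \in W'.
Proof.
by move=> fW; apply: rpred_sum => i _; apply: rpred_sum => j _; apply: rpredZ.
Qed.

Lemma tensv_sub U V (U' : {vspace U}) (V' : {vspace V}) (T : {vspace tens U V}) :
  (forall u v, u \in U' -> v \in V' -> u ⊗ v \in T) -> (tensv U' V' <= T)%VS.
Proof.
move=> h; apply/span_subvP => _ /allpairsP[[u v] /= [uU vV ->]].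
by apply: h; apply: vbasis_mem.
Qed.

Lemma tensv_tlift_memv U V W (U' : {vspace U}) (V' : {vspace V}) (W' : {vspace W})
    (f : U -> V -> W) t :
  bilin f -> t \in tensv U' V' ->
  (forall u v, u \in U' -> v \in V' -> f u v \in W') -> tlift f t \in W'.
Proof.
move=> bf tT fW.
have lf : linear (tlift f : tens U V -> W) by move=> a u v; rewrite linearP.
rewrite -(linfunE lf) memv_preim; apply: subvP tT; apply: tensv_sub => u v uU vV.
by rewrite -memv_preim linfunE // tlift_pure // fW.
Qed.

Lemma tmap_sub U V U2 V2 (f : 'Hom(U, U2)) (g : 'Hom(V, V2))
    (U' : {vspace U}) (V' : {vspace V}) (U2' : {vspace U2}) (V2' : {vspace V2}) t :
  (f @: U' <= U2')%VS -> (g @: V' <= V2')%VS ->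
  t \in tensv U' V' -> tmap f g t \in tensv U2' V2'.
Proof.
move=> /subvP fU /subvP gV tT; rewrite tmapE; apply: tensv_tlift_memv tT _.
  exact: tmap_bilin.
by move=> u v uU vV; apply: tpure_in_tensv; [apply: fU | apply: gV]; apply: memv_img.
Qed.

Lemma tensvf U V (t : tens U V) : t \in tensv fullv fullv.
Proof.
by rewrite -(tlift_id t); apply: tlift_memv => u v; apply: tpure_in_tensv; apply: memvf.
Qed.

Lemma tmap_comp U V U2 V2 U3 V3 (f : 'Hom(U, U2)) (g : 'Hom(V, V2))
    (f' : 'Hom(U2, U3)) (g' : 'Hom(V2, V3)) t :
  tmap f' g' (tmap f g t) = tmap (f' \o f)%VF (g' \o g)%VF t.
Proof.
move: t; apply: tens_ext; [by lin | by lin |] => u v.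
by rewrite !tmap_pure !comp_lfunE.
Qed.

End TensorSubspaces.

Section Modules.
Variable k : fieldType.
Implicit Types A B : falgType k.

Lemma mh_inv_subproof A (M N : lmodule A) (f : modHom M N) :
  mh_iso f -> forall a m, (f^-1)%VF (lact N a m) = lact M a ((f^-1)%VF m).
Proof.
case=> g [fK gK] a m; have f0 : lker f == 0%VS by apply/lker0P/(can_inj fK).
by rewrite -(gK m) -mhP !lker0_lfunK.
Qed.

Definition mh_inv A (M N : lmodule A) (f : modHom M N) (i : mh_iso f) : modHom N M :=
  ModHom (mh_inv_subproof i).

Lemma mh_invK A (M N : lmodule A) (f : modHom M N) (i : mh_iso f) :
  cancel f (mh_inv i).
Proof.
have f0 : lker f == 0%VS by case: i => g [fK _]; apply/lker0P/(can_inj fK).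
exact: lker0_lfunK f0.
Qed.

Lemma mh_invVK A (M N : lmodule A) (f : modHom M N) (i : mh_iso f) :
  cancel (mh_inv i) f.
Proof.
move=> x; suff [y <-] : exists y, f y = x by rewrite mh_invK.
by case: i => g [_ gK]; exists (g x).
Qed.

Lemma mh_inv_iso A (M N : lmodule A) (f : modHom M N) (i : mh_iso f) :
  mh_iso (mh_inv i).
Proof. by exists f; split; [apply: mh_invVK | apply: mh_invK]. Qed.

(** The inverse [g] may be any function: a bijective module map has a linear inverse, which is
    automatically a module map. *)
Lemma mh_iso_can A (M N : lmodule A) (f : modHom M N) (g : N -> M) :
  cancel f g -> cancel g f -> mh_iso f.
Proof.
move=> fK gK; have f0 : lker f == 0%VS by apply/lker0P/(can_inj fK).
have gP a n : (f^-1)%VF (lact N a n) = lact M a ((f^-1)%VF n).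
  by rewrite -(gK n) -mhP !lker0_lfunK.
exists (ModHom gP); split=> x /=; first by rewrite lker0_lfunK.
by rewrite -{1}(gK x) lker0_lfunK.
Qed.

Lemma nat_iso_sym A B (F G : linFunctor A B) : nat_iso F G -> nat_iso G F.
Proof.
case=> eta [etan etai]; exists (fun M => mh_inv (etai M)); split=> [M N f x|M].
  by rewrite -{1}(mh_invVK (etai M) x) -etan mh_invK.
exact: mh_inv_iso.
Qed.

Section Equivalence.
Variables (A B : falgType k) (F : linFunctor A B) (eF : is_equivalence F).

Lemma equivalence_faithful (M N : lmodule A) (f g : modHom M N) :
  fmap F f =1 fmap F g -> f =1 g.
Proof.
case: eF => G [[eta [etan etai]] _] e m.
rewrite -(mh_invVK (etai M) m).
have := etan _ _ f (mh_inv (etai M) m); rewrite /= => <-.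
have := etan _ _ g (mh_inv (etai M) m); rewrite /= => <-.
by rewrite (fmap_ext e).
Qed.

Lemma equivalence_ess_surj (N : lmodule B) :
  exists M : lmodule A, exists f : modHom (F M) N, mh_iso f.
Proof. by case: eF => G [_ [eta [_ etai]]]; exists (G N); exists (eta N); exact: etai. Qed.

(** [f] is chosen so that [G F f] equals [G h]; conjugation by the isomorphisms F G = id then gives
    [F f = h]. *)
Lemma equivalence_full (M N : lmodule A) (h : modHom (F M) (F N)) :
  exists f : modHom M N, fmap F f =1 h.
Proof.
case: eF => G [[eta [etan etai]] [th [thn thi]]].
pose f := mh_comp (eta N) (mh_comp (fmap G h) (mh_inv (etai M))).
exists f.
have e : fmap G (fmap F f) =1 fmap G h.
  move=> x; refine (can_inj (mh_invK (etai N)) _).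
  have := etan _ _ f x => /= ->.
  by rewrite /f /= !comp_lfunE /= (mh_invK (etai M)).
move=> x; rewrite -(mh_invVK (thi (F M)) x).
have := thn _ _ (fmap F f) (mh_inv (thi (F M)) x); rewrite /= => <-.
have := thn _ _ h (mh_inv (thi (F M)) x); rewrite /= => <-.
by rewrite (fmap_ext e).
Qed.

End Equivalence.

End Modules.

(** * Equivariant Morita contexts *)

Section Morita.
Variable k : fieldType.

(* The maps jA and jB need not send 1 to 1: A and B will be complementary corners
   of C. *)
Record bimod (C A B : falgType k) (jA : 'Hom(A, C)) (jB : 'Hom(B, C)) := Bimod {
  bm_sort :> vectType k;
  bm_in : 'Hom(bm_sort, C);
  bm_inj : lker bm_in == 0%VS;
  bm_left : forall a q, jA a * bm_in q \in limg bm_in;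
  bm_right : forall q b, bm_in q * jB b \in limg bm_in;
  bm_left1 : forall q, jA 1 * bm_in q = bm_in q;
  bm_right1 : forall q, bm_in q * jB 1 = bm_in q
}.

Section HomFunctor.
Variables (C A B : falgType k) (jA : 'Hom(A, C)) (jB : 'Hom(B, C)).
Hypothesis jBM : forall x y : B, jB (x * y) = jB x * jB y.
Variable Q : bimod jA jB.
Local Notation j := (bm_in Q).

Definition bm_actl (a : A) (q : Q) : Q := (j^-1)%VF (jA a * j q).
Definition bm_actr (q : Q) (b : B) : Q := (j^-1)%VF (j q * jB b).

Lemma bm_actlE a q : j (bm_actl a q) = jA a * j q.
Proof. by rewrite limg_lfunVK // bm_left. Qed.

Lemma bm_actrE q b : j (bm_actr q b) = j q * jB b.
Proof. by rewrite limg_lfunVK // bm_right. Qed.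

Lemma bm_actl_linearl q : linear (bm_actl^~ q).
Proof. by rewrite /bm_actl; lin. Qed.

Lemma bm_actl_linearr a : linear (bm_actl a).
Proof. by rewrite /bm_actl; lin. Qed.

Lemma bm_actr_linear q : linear (bm_actr q).
Proof. by rewrite /bm_actr; lin. Qed.

Lemma bm_in_inj : injective j.
Proof. exact/lker0P/bm_inj. Qed.

Lemma bm_actlr a q b : bm_actl a (bm_actr q b) = bm_actr (bm_actl a q) b.
Proof. by apply: bm_in_inj; rewrite !(bm_actlE, bm_actrE) mulrA. Qed.

Lemma bm_actrM q b b' : bm_actr q (b * b') = bm_actr (bm_actr q b) b'.
Proof. by apply: bm_in_inj; rewrite !bm_actrE jBM mulrA. Qed.

Lemma bm_actr1 q : bm_actr q 1 = q.
Proof. by apply: bm_in_inj; rewrite bm_actrE bm_right1. Qed.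

Definition bm_actrh (b : B) : 'End(Q) := linfun (bm_actr^~ b).

Lemma bm_actrhE b q : bm_actrh b q = bm_actr q b.
Proof. by rewrite linfunE // /bm_actr; lin. Qed.

Section Homs.
Variable N : lmodule A.

(** The failure of [f] to be A-linear. It is linear in [f], so the A-linear maps form a kernel,
    hence a subspace that can carry a module structure. *)
Definition hom_defect (f : 'Hom(Q, N)) : 'Hom(tens A Q, N) :=
  linfun (tlift (fun a q => f (bm_actl a q) - lact N a (f q))).

Lemma hom_defect_linear : linear hom_defect.
Proof.
move=> c f g; apply/lfunP => t; rewrite add_lfunE scale_lfunE !lfunE /=.
rewrite -tlift_linP; apply: eq_tlift => a q.
rewrite !add_lfunE !scale_lfunE linearP scalerBr opprD.
by rewrite -!addrA; congr (_ + _); rewrite addrCA.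
Qed.

Definition homs : {vspace 'Hom(Q, N)} := lker (linfun hom_defect).

Lemma homsP (f : 'Hom(Q, N)) : reflect (forall a q, f (bm_actl a q) = lact N a (f q)) (f \in homs).
Proof.
rewrite memv_ker linfunE; last exact: hom_defect_linear.
have bd : bilin (fun a q => f (bm_actl a q) - lact N a (f q)).
  split=> [q c a a'|a c q q'].
    have -> : bm_actl (c *: a + a') q = c *: bm_actl a q + bm_actl a' q.
      exact: bm_actl_linearl.
    by rewrite !linearP add_lfunE scale_lfunE /= scalerBr opprD addrACA.
  have -> : bm_actl a (c *: q + q') = c *: bm_actl a q + bm_actl a q'.
    exact: bm_actl_linearr.
  by rewrite !linearP /= scalerDr addrACA.
apply: (iffP eqP) => [f0 a q|fP]; last first.
  apply/lfunP => t; rewrite lfunE /= zero_lfunE.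
  by apply: big1 => i _; apply: big1 => j' _; rewrite fP subrr scaler0.
apply/eqP; rewrite -subr_eq0; have /lfunP/(_ (a ⊗ q)) := f0.
by rewrite lfunE /= tlift_pure // zero_lfunE => ->.
Qed.

Lemma comp_actr_homs (f : 'Hom(Q, N)) b : f \in homs -> (f \o bm_actrh b)%VF \in homs.
Proof.
move=> /homsP fP; apply/homsP => a q.
by rewrite !comp_lfunE !bm_actrhE -bm_actlr fP.
Qed.

Definition hom_act (b : B) (f : subvs_of homs) : subvs_of homs :=
  vsproj homs (vsval f \o bm_actrh b)%VF.

Lemma hom_actE b f q : vsval (hom_act b f) q = vsval f (bm_actr q b).
Proof.
by rewrite vsprojK ?comp_lfunE ?bm_actrhE //; apply/comp_actr_homs/subvsP.
Qed.

Lemma homs_ext (f g : subvs_of homs) : vsval f =1 vsval g -> f = g.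
Proof. by move=> e; apply/val_inj/lfunP. Qed.

Lemma subvs_linear (f g : subvs_of homs) c q :
  vsval (c *: f + g) q = c *: vsval f q + vsval g q.
Proof. by rewrite linearP add_lfunE scale_lfunE. Qed.

Definition hom_lact : 'Hom(B, 'End(subvs_of homs)) :=
  linfun (fun b => linfun (hom_act b)).

Lemma hom_lactE b f q : vsval (hom_lact b f) q = vsval f (bm_actr q b).
Proof.
have l1 b' : linear (hom_act b').
  move=> c g h; apply: homs_ext => q'.
  by rewrite subvs_linear !hom_actE subvs_linear.
rewrite linfunE ?linfunE // ?hom_actE // => c b1 b2.
apply/lfunP => g; rewrite add_lfunE scale_lfunE !linfunE //.
apply: homs_ext => q'; rewrite subvs_linear !hom_actE -linearP.
by congr (vsval g _); apply: bm_actr_linear.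
Qed.

Lemma hom_lactP : is_action hom_lact.
Proof.
split=> [f|b b' f]; apply: homs_ext => q; rewrite !hom_lactE ?bm_actr1 //.
by rewrite bm_actrM.
Qed.

Definition hom_mod : lmodule B := LModule hom_lactP.

Definition hom_eval (f : hom_mod) (q : Q) : N := vsval (f : subvs_of homs) q.

(** Total by convention: the value is meaningful when [f] is linear and commutes with A, which is
    what [hom_makeE] asks. *)
Definition hom_make (f : Q -> N) : hom_mod := vsproj homs (linfun f).

Lemma hom_eval_ext (f g : hom_mod) : hom_eval f =1 hom_eval g -> f = g.
Proof. exact: homs_ext. Qed.

Lemma hom_evalP c (f g : hom_mod) q :
  hom_eval (c *: f + g) q = c *: hom_eval f q + hom_eval g q.
Proof. exact: subvs_linear. Qed.

Lemma hom_eval_linear (f : hom_mod) : linear (hom_eval f).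
Proof. by rewrite /hom_eval; lin. Qed.

Lemma hom_eval_linearl q : linear (fun f : hom_mod => hom_eval f q).
Proof. by move=> c f g; apply: hom_evalP. Qed.

Lemma hom_eval_lact b (f : hom_mod) q :
  hom_eval (lact hom_mod b f) q = hom_eval f (bm_actr q b).
Proof. exact: hom_lactE. Qed.

Lemma hom_eval_actl a (f : hom_mod) q :
  hom_eval f (bm_actl a q) = lact N a (hom_eval f q).
Proof. exact: (elimT (homsP _) (subvsP f)). Qed.

Lemma hom_makeE (f : Q -> N) q : linear f ->
  (forall a q, f (bm_actl a q) = lact N a (f q)) ->
  hom_eval (hom_make f) q = f q.
Proof.
move=> lf fA; rewrite /hom_eval vsprojK ?linfunE //; apply/homsP => a q'.
by rewrite !(linfunE lf).
Qed.

End Homs.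

Section HomMap.
Variables (M N : lmodule A).

Definition hom_map (f : modHom M N) : 'Hom(hom_mod M, hom_mod N) :=
  linfun (fun g => hom_make (fun q => f (hom_eval g q))).

Lemma hom_mapE (f : modHom M N) g q :
  hom_eval (hom_map f g) q = f (hom_eval g q).
Proof.
have mE g' q' :
    hom_eval (hom_make (fun q => f (hom_eval g' q))) q' = f (hom_eval g' q').
  apply: (@hom_makeE N (fun q => f (hom_eval g' q))) => [|a q2].
    by move=> c x y; rewrite hom_eval_linear linearP.
  by rewrite hom_eval_actl mhP.
rewrite linfunE ?mE // => c h h'.
by apply: hom_eval_ext => q'; rewrite hom_evalP !mE hom_evalP linearP.
Qed.

Lemma hom_mapP (f : modHom M N) b (g : hom_mod M) :
  hom_map f (lact (hom_mod M) b g) = lact (hom_mod N) b (hom_map f g).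
Proof.
by apply: hom_eval_ext => q; rewrite hom_mapE !hom_eval_lact hom_mapE.
Qed.

Definition hom_hom (f : modHom M N) : modHom (hom_mod M) (hom_mod N) :=
  ModHom (hom_mapP f).

Lemma hom_hom_ext (f g : modHom M N) : f =1 g -> hom_hom f =1 hom_hom g.
Proof. by move=> e h; apply: hom_eval_ext => q; rewrite !hom_mapE e. Qed.

Lemma hom_hom_lin c (f g : modHom M N) :
  hom_hom (mh_lin c f g) =1 mh_lin c (hom_hom f) (hom_hom g).
Proof.
move=> h; apply: hom_eval_ext => q.
transitivity (hom_eval (c *: hom_map f h + hom_map g h) q); last first.
  by congr (hom_eval _ q); rewrite /= add_lfunE scale_lfunE.
by rewrite hom_evalP !hom_mapE /= add_lfunE scale_lfunE.
Qed.

End HomMap.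

Lemma hom_hom_id (M : lmodule A) : hom_hom (mh_id M) =1 mh_id (hom_mod M).
Proof.
move=> h; apply: hom_eval_ext => q.
by rewrite hom_mapE /= (id_lfunE h) (id_lfunE (hom_eval h q)).
Qed.

Lemma hom_hom_comp (M N K : lmodule A) (g : modHom N K) (f : modHom M N) :
  hom_hom (mh_comp g f) =1 mh_comp (hom_hom g) (hom_hom f).
Proof.
move=> h; apply: hom_eval_ext => q.
transitivity (hom_eval (hom_map g (hom_map f h)) q); last first.
  by congr (hom_eval _ q); rewrite /= comp_lfunE.
by rewrite !hom_mapE /= comp_lfunE.
Qed.

Definition hom_functor : linFunctor A B :=
  LinFunctor hom_hom_ext hom_hom_id hom_hom_comp hom_hom_lin.

End HomFunctor.

Section MoritaContext.
Variables (C A B : falgType k) (jA : 'Hom(A, C)) (jB : 'Hom(B, C)).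
Hypothesis jAM : forall x y : A, jA (x * y) = jA x * jA y.
Hypothesis jBM : forall x y : B, jB (x * y) = jB x * jB y.
Hypotheses (jA_inj : lker jA == 0%VS) (jB_inj : lker jB == 0%VS).
Variables (Q : bimod jA jB) (P : bimod jB jA).
Hypothesis QPA : forall q p, bm_in Q q * bm_in P p \in limg jA.
Hypothesis PQB : forall p q, bm_in P p * bm_in Q q \in limg jB.

Definition pairA (q : Q) (p : P) : A := (jA^-1)%VF (bm_in Q q * bm_in P p).
Definition pairB (p : P) (q : Q) : B := (jB^-1)%VF (bm_in P p * bm_in Q q).

Lemma pairAE q p : jA (pairA q p) = bm_in Q q * bm_in P p.
Proof. by rewrite limg_lfunVK ?QPA. Qed.

Lemma pairBE p q : jB (pairB p q) = bm_in P p * bm_in Q q.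
Proof. by rewrite limg_lfunVK ?PQB. Qed.

Lemma jA_injective : injective jA. Proof. exact/lker0P. Qed.
Lemma pairA_linearl p : linear (pairA^~ p).
Proof. by rewrite /pairA; lin. Qed.

Lemma pairA_linearr q : linear (pairA q).
Proof. by rewrite /pairA; lin. Qed.

Lemma pairAZl a q p : pairA (bm_actl a q) p = a * pairA q p.
Proof. by apply: jA_injective; rewrite jAM !pairAE bm_actlE mulrA. Qed.

Lemma pairAZr a q p : pairA q (bm_actr p a) = pairA q p * a.
Proof. by apply: jA_injective; rewrite jAM !pairAE bm_actrE mulrA. Qed.

Lemma pairA_mid b q p : pairA (bm_actr q b) p = pairA q (bm_actl b p).
Proof. by apply: jA_injective; rewrite !pairAE bm_actrE bm_actlE mulrA. Qed.

Lemma pair_assoc q p q' : bm_actl (pairA q p) q' = bm_actr q (pairB p q').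
Proof. by apply: bm_in_inj; rewrite bm_actlE bm_actrE pairAE pairBE mulrA. Qed.

Lemma pair_assoc' p q p' : bm_actl (pairB p q) p' = bm_actr p (pairA q p').
Proof. by apply: bm_in_inj; rewrite bm_actlE bm_actrE pairAE pairBE mulrA. Qed.

Section PairModule.
Variable N : lmodule A.

(** On one pair (p, n), the classical Morita map from P (x)_A N to Hom_A(Q, N). *)
Definition pair_hom (p : P) (n : N) : hom_mod jBM Q N :=
  hom_make jBM (fun q : Q => lact N (pairA q p) n).

Lemma pair_homE p n q : hom_eval (pair_hom p n) q = lact N (pairA q p) n.
Proof.
have l : linear (fun q => lact N (pairA q p) n).
  by apply: lin_homl; apply: lin_hom; apply: pairA_linearl.
by rewrite hom_makeE // => a q'; rewrite pairAZl (lactP N).2.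
Qed.

Lemma pair_hom_linearl n : linear (pair_hom^~ n).
Proof.
move=> c p p'; apply: hom_eval_ext => q.
rewrite hom_evalP !pair_homE -scale_lfunE -add_lfunE -linearP.
by congr (lact N _ _); apply: pairA_linearr.
Qed.

Lemma pair_hom_linearr p : linear (pair_hom p).
Proof. by move=> c m n; apply: hom_eval_ext => q; rewrite hom_evalP !pair_homE linearP. Qed.

End PairModule.

Variable t : tens Q P.
Hypothesis ht : \tsum_(q, p <- t) (bm_in Q q * bm_in P p) = jA 1.

Lemma pairA_t : \tsum_(q, p <- t) pairA q p = 1.
Proof.
apply: jA_injective; rewrite linear_tlift -ht; apply: eq_tlift => q p /=.
exact: pairAE.
Qed.

Section UnitIso.
Variable N : lmodule A.
Let GF := hom_mod jAM P (hom_mod jBM Q N).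

Definition morita_unit_fun (n : N) : GF := hom_make jAM ((@pair_hom N)^~ n).

Lemma morita_unit_funE n p q :
  hom_eval (hom_eval (morita_unit_fun n) p) q = lact N (pairA q p) n.
Proof.
rewrite hom_makeE ?pair_homE //; first exact: pair_hom_linearl.
move=> b p'; apply: hom_eval_ext => q'.
by rewrite hom_eval_lact !pair_homE pairA_mid.
Qed.

Lemma morita_unit_ext (f g : GF) :
  (forall p q, hom_eval (hom_eval f p) q = hom_eval (hom_eval g p) q) -> f = g.
Proof. by move=> e; apply: hom_eval_ext => p; apply: hom_eval_ext. Qed.

Lemma morita_unit_linear : linear morita_unit_fun.
Proof.
move=> c m n; apply: hom_eval_ext => p; apply: hom_eval_ext => q.
by rewrite !hom_evalP !morita_unit_funE linearP.
Qed.

Definition morita_unit_lfun : 'Hom(N, GF) := linfun morita_unit_fun.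

Lemma morita_unit_lfunE : morita_unit_lfun =1 morita_unit_fun.
Proof. exact/linfunE/morita_unit_linear. Qed.

Lemma morita_unitP a n :
  morita_unit_lfun (lact N a n) = lact GF a (morita_unit_lfun n).
Proof.
rewrite !morita_unit_lfunE; apply: hom_eval_ext => p; apply: hom_eval_ext => q.
by rewrite hom_eval_lact !morita_unit_funE pairAZr (lactP N).2.
Qed.

Definition morita_unit : modHom N GF := ModHom morita_unitP.

Definition morita_unit_inv (f : GF) : N :=
  \tsum_(q, p <- t) hom_eval (hom_eval f p) q.

(** Insert 1 = sum of q' p' to the right of p: f(p)(q) = sum of f((p q') p')(q) = sum of f(p')((q p)
    q') = (q p) applied to the sum of the f(p')(q'), which is [morita_unit_inv f]. *)
Lemma morita_unit_iso : mh_iso morita_unit.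
Proof.
apply: (@mh_iso_can _ _ _ _ _ morita_unit_inv) => [n|f].
  rewrite /morita_unit_inv /= morita_unit_lfunE.
  have l : linear (fun a => lact N a n) by lin.
  rewrite -[RHS](lactP N).1 -pairA_t -[RHS]/(lin_of l _) linear_tlift.
  by apply: eq_tlift => q p; rewrite morita_unit_funE.
apply: (etrans (morita_unit_lfunE _)); apply: morita_unit_ext => p q.
rewrite morita_unit_funE /morita_unit_inv linear_tlift.
have l : linear (fun a => hom_eval (hom_eval f (bm_actr p a)) q).
  move=> c a b; rewrite -hom_evalP -hom_eval_linear.
  by congr (hom_eval (hom_eval _ _) _); apply: bm_actr_linear.
rewrite -{2}(bm_actr1 p) -pairA_t -[RHS]/(lin_of l _) linear_tlift.
apply: eq_tlift => q' p' /=; rewrite -pair_assoc' hom_eval_actl hom_eval_lact.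
by rewrite -pair_assoc hom_eval_actl.
Qed.

End UnitIso.

(** The context is symmetric, so exchanging (A, Q) with (B, P) gives the other composite; one unit
    isomorphism serves for both. *)
Lemma morita_nat_iso :
  nat_iso (functor_comp (hom_functor jAM P) (hom_functor jBM Q)) (functor_id A).
Proof.
apply: nat_iso_sym; exists morita_unit; split=> [M N f n|M]; last first.
  exact: morita_unit_iso.
rewrite /= !morita_unit_lfunE.
transitivity (hom_map jAM P (hom_hom jBM Q f) (morita_unit_fun n)); last by [].
apply: morita_unit_ext => p q.
by rewrite morita_unit_funE !hom_mapE morita_unit_funE mhP.
Qed.

End MoritaContext.

(** * Coactions inherited from an ambient comodule algebra *)

Section Subcomodules.
Variables (H : hopfAlg k) (C : comodAlg H).

Lemma tmap1_inj (U V W : vectType k) (g : 'Hom(V, W)) :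
  lker g == 0%VS -> injective (tmap (\1%VF : 'End(U)) g).
Proof. by move=> g0; apply/can_inj/(tmapK (@id_lfunK _ _))/lker0_lfunK. Qed.

(** All compatibilities of coactions with actions and pairings are instances: each operation is a
    product in C, and an identity in H (x) W may be tested after the injection into H (x) C, where
    it is [coactM]. *)
Lemma coact_mul_in (U V W : vectType k) (u : 'Hom(U, C)) (v : 'Hom(V, C))
    (w : 'Hom(W, C)) (dU : 'Hom(U, tens H U)) (dV : 'Hom(V, tens H V))
    (dW : 'Hom(W, tens H W)) (op : U -> V -> W) :
  lker w == 0%VS ->
  (forall x, tmap \1%VF u (dU x) = coact C (u x)) ->
  (forall x, tmap \1%VF v (dV x) = coact C (v x)) ->
  (forall x, tmap \1%VF w (dW x) = coact C (w x)) ->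
  (forall x y, w (op x y) = u x * v y) ->
  forall x y, dW (op x y) =
    \tsum_(g, x0 <- dU x) \tsum_(h, y0 <- dV y) ((g * h) ⊗ op x0 y0).
Proof.
move=> w0 cu cv cw wop x y; apply: (tmap1_inj w0).
rewrite cw wop coactM -cu -cv linear_tlift tlift_tmap; last by bilin.
apply: eq_tlift => g x0; rewrite linear_tlift tlift_tmap; last by bilin.
by apply: eq_tlift => h y0; rewrite /= tmap_pure !id_lfunE wop.
Qed.

Lemma coaction_in (W : vectType k) (w : 'Hom(W, C)) (dW : 'Hom(W, tens H W)) :
  lker w == 0%VS -> (forall x, tmap \1%VF w (dW x) = coact C (w x)) ->
  is_coaction dW.
Proof.
move=> w0 cw; have [C1 C2] := coactP C; split=> x; last first.
  apply: (lker0P w0); rewrite linear_tlift -[RHS]C2 -cw tlift_tmap; last by bilin.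
  by apply: eq_tlift => h y; rewrite id_lfunE linearZ.
have J0 : lker (tmap (\1%VF : 'End(H)) w) == 0%VS by apply/lker0P/tmap1_inj.
apply: (tmap1_inj J0); rewrite !linear_tlift.
transitivity (\tsum_(h, y <- coact C (w x)) \tsum_(h1, h2 <- comul H h) (h1 ⊗ (h2 ⊗ y))).
  rewrite -cw tlift_tmap; last by bilin.
  apply: eq_tlift => h y; rewrite id_lfunE linear_tlift.
  by apply: eq_tlift => h1 h2; rewrite /= !tmap_pure !id_lfunE.
rewrite C1 -cw tlift_tmap; last by bilin.
by apply: eq_tlift => h y; rewrite /= tmap_pure !id_lfunE cw.
Qed.

End Subcomodules.

(** * The Hom functor of an equivariant context as a module functor *)

Section ModuleFunctor.
Variables (H : hopfAlg k) (C A B : comodAlg H).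
Variables (jA : 'Hom(A, C)) (jB : 'Hom(B, C)).
Hypothesis jAM : forall x y : A, jA (x * y) = jA x * jA y.
Hypothesis jBM : forall x y : B, jB (x * y) = jB x * jB y.
Hypotheses (jA_inj : lker jA == 0%VS) (jB_inj : lker jB == 0%VS).
Hypothesis jAc : forall x, tmap \1%VF jA (coact A x) = coact C (jA x).
Hypothesis jBc : forall x, tmap \1%VF jB (coact B x) = coact C (jB x).
Variables (Q : bimod jA jB) (P : bimod jB jA).
Hypothesis QPA : forall q p, bm_in Q q * bm_in P p \in limg jA.
Hypothesis PQB : forall p q, bm_in P p * bm_in Q q \in limg jB.
Variables (dQ : 'Hom(Q, tens H Q)) (dP : 'Hom(P, tens H P)).
Hypothesis dQc : forall x, tmap \1%VF (bm_in Q) (dQ x) = coact C (bm_in Q x).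
Hypothesis dPc : forall x, tmap \1%VF (bm_in P) (dP x) = coact C (bm_in P x).
Variables (t : tens Q P) (s : tens P Q).
Hypothesis ht : \tsum_(q, p <- t) (bm_in Q q * bm_in P p) = jA 1.
Hypothesis hs : \tsum_(p, q <- s) (bm_in P p * bm_in Q q) = jB 1.

Lemma dQ_actl a q : dQ (bm_actl a q) =
  \tsum_(g, a0 <- coact A a) \tsum_(h, q0 <- dQ q) ((g * h) ⊗ bm_actl a0 q0).
Proof. exact: (coact_mul_in (bm_inj Q) jAc dQc dQc (@bm_actlE _ _ _ _ _ Q)). Qed.

Lemma dQ_actr q b : dQ (bm_actr q b) =
  \tsum_(g, q0 <- dQ q) \tsum_(h, b0 <- coact B b) ((g * h) ⊗ bm_actr q0 b0).
Proof. exact: (coact_mul_in (bm_inj Q) dQc jBc dQc (@bm_actrE _ _ _ _ _ Q)). Qed.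

Lemma coact_pairA q p : coact A (pairA q p) =
  \tsum_(g, q0 <- dQ q) \tsum_(h, p0 <- dP p) ((g * h) ⊗ pairA q0 p0).
Proof. exact: (coact_mul_in jA_inj dQc dPc jAc (pairAE QPA)). Qed.

Lemma coact_pairB p q : coact B (pairB p q) =
  \tsum_(g, p0 <- dP p) \tsum_(h, q0 <- dQ q) ((g * h) ⊗ pairB p0 q0).
Proof. exact: (coact_mul_in jB_inj dPc dQc jBc (pairBE PQB)). Qed.

Section Constraint.
Variables (X : lmodule H) (N : lmodule A).
Local Notation F := (hom_mod jBM Q).

(* The module constraint F (X (x) N) -> X (x) F N will be the inverse of the
   natural map x (x) f |-> (q |-> q_(-1) x (x) f q_(0)). *)
Definition tens_hom_fun (x : X) (f : F N) : F (tens_act X N) :=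
  @hom_make _ _ _ _ _ jBM Q (tens_act X N)
    (fun q => \tsum_(h, q0 <- dQ q) (lact X h x ⊗ hom_eval f q0)).

Lemma tens_hom_funE x f q : hom_eval (tens_hom_fun x f) q =
  \tsum_(h, q0 <- dQ q) (lact X h x ⊗ hom_eval f q0).
Proof.
rewrite /tens_hom_fun hom_makeE //; first by lin.
move=> a q'.
have bF : bilin (fun (h : H) (q0 : Q) => lact X h x ⊗ hom_eval f q0).
  split=> y; first by lin.
  by apply: lin_purer; exact: hom_eval_linear.
rewrite dQ_actl linear_tlift.
transitivity (\tsum_(g, a0 <- coact A a) \tsum_(h, q0 <- dQ q')
    (lact X g (lact X h x) ⊗ lact N a0 (hom_eval f q0))).
  apply: eq_tlift => g a0; rewrite /= tlift_tlift //.
  by apply: eq_tlift => h q0; rewrite (lactP X).2 hom_eval_actl.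
rewrite exchange_tlift linear_tlift; apply: eq_tlift => h q0.
by rewrite /= tens_lact_pure.
Qed.

Lemma tens_hom_fun_bilin : bilin tens_hom_fun.
Proof.
split=> y c u v; apply: hom_eval_ext => q; rewrite hom_evalP !tens_hom_funE.
  by rewrite -tlift_linP; apply: eq_tlift => h q0; rewrite linearP tpureDl tpureZl.
by rewrite -tlift_linP; apply: eq_tlift => h q0; rewrite hom_evalP linearP.
Qed.

Definition tens_homs : 'Hom(tens X (F N), F (tens_act X N)) :=
  linfun (tlift tens_hom_fun).

Lemma tens_homs_pure x f q : hom_eval (tens_homs (x ⊗ f)) q =
  \tsum_(h, q0 <- dQ q) (lact X h x ⊗ hom_eval f q0).
Proof.
rewrite /tens_homs lfunE /= tlift_pure; last exact: tens_hom_fun_bilin.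
exact: tens_hom_funE.
Qed.

Lemma tens_homsP b u : tens_homs (lact (tens_act X (F N)) b u)
  = lact (F (tens_act X N)) b (tens_homs u).
Proof.
move: u; apply: tens_ext; [by lin | by lin |] => x f.
apply: hom_eval_ext => q; rewrite hom_eval_lact tens_homs_pure.
transitivity (\tsum_(h, b0 <- coact B b) hom_eval (tens_homs (lact X h x ⊗ lact (F N) b0 f)) q).
  have l : linear (fun w => hom_eval (tens_homs w) q).
    by move=> c v w; rewrite linearP hom_evalP.
  have := tens_lact_pure (M := F N) b x f => /= ->.
  by rewrite -[LHS]/(lin_of l _) linear_tlift.
rewrite dQ_actr linear_tlift /=.
transitivity (\tsum_(g, b0 <- coact B b) \tsum_(h, q0 <- dQ q)
    (lact X h (lact X g x) ⊗ hom_eval f (bm_actr q0 b0))).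
  apply: eq_tlift => g b0; rewrite tens_homs_pure; apply: eq_tlift => h q0.
  by rewrite hom_eval_lact.
have bF : bilin (fun (h : H) (q0 : Q) => lact X h x ⊗ hom_eval f q0).
  split=> y; first by lin.
  by apply: lin_purer; exact: hom_eval_linear.
rewrite exchange_tlift; apply: eq_tlift => h q0; rewrite tlift_tlift //.
by apply: eq_tlift => g b0; rewrite (lactP X).2.
Qed.

Definition tens_homs_hom : modHom (tens_act X (F N)) (F (tens_act X N)) :=
  @ModHom k B (tens_act X (F N)) (F (tens_act X N)) tens_homs tens_homsP.

(** Inverse of [tens_homs]. By [pairB_s], f is the sum of the (p q) f, and (p q) f is q' |-> (q' p)
    f(q); letting p_(-1) act on the X-component of f(q) splits this off as an element of X (x) F N.
    The coaction of P does the work of an antipode. *)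
Definition homs_tens (f : F (tens_act X N)) : tens X (F N) :=
  \tsum_(p, q <- s) \tsum_(h, p0 <- dP p) \tsum_(x, n <- hom_eval f q)
    (lact X h x ⊗ pair_hom jBM Q p0 n).

Lemma pair_hom_eval (p : P) (f : F N) (q : Q) :
  pair_hom jBM Q p (hom_eval f q) = lact (F N) (pairB p q) f.
Proof.
apply: hom_eval_ext => q'.
by rewrite pair_homE // hom_eval_lact -(pair_assoc QPA PQB) hom_eval_actl.
Qed.

Lemma pairB_s : \tsum_(p, q <- s) pairB p q = 1.
Proof. exact: (pairA_t jB_inj PQB hs). Qed.

Lemma homs_tens_linear : linear homs_tens.
Proof.
apply: lin_tliftl => p q; apply: lin_tliftl => h p0; apply: lin_tliftr.
exact: hom_eval_linearl.
Qed.

Lemma tens_homsK : cancel tens_homs homs_tens.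
Proof.
apply: (@tens_ext _ _ _ _ (fun w => homs_tens (tens_homs w)) id) => [| |x f].
- by move=> c u v; rewrite linearP homs_tens_linear.
- by [].
have l : linear (fun b => tens_lact X (F N) b (x ⊗ f)) by lin.
have [t1 _] := tens_lactP X (F N).
rewrite -[RHS]t1 -pairB_s -[RHS]/(lin_of l _) linear_tlift.
apply: eq_tlift => p q; rewrite /= (tens_lact_pure (M := F N)) coact_pairB linear_tlift.
apply: eq_tlift => g p0.
have -> : hom_eval (tens_homs (x ⊗ f)) q =
  \tsum_(h, q0 <- dQ q) (lact X h x ⊗ hom_eval f q0) by exact: tens_homs_pure.
rewrite /= tlift_tlift; last first.
  by split=> z; [lin | apply: lin_purer; apply: pair_hom_linearr].
rewrite tlift_tlift; last by bilin.
by apply: eq_tlift => h q0; rewrite (lactP X).2 pair_hom_eval.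
Qed.


Lemma homs_tensK : cancel homs_tens tens_homs.
Proof.
move=> f; apply: hom_eval_ext => q.
have l : linear (fun w => hom_eval (tens_homs w) q).
  by move=> c v w; rewrite linearP hom_evalP.
have l2 : linear (fun b => hom_eval f (bm_actr q b)).
  by move=> c b b'; rewrite -hom_eval_linear bm_actr_linear.
rewrite -{2}(bm_actr1 q) -pairB_s -[RHS]/(lin_of l2 _) -[LHS]/(lin_of l _).
rewrite !linear_tlift; apply: eq_tlift => p q1.
rewrite /= -(pair_assoc QPA PQB) hom_eval_actl tens_lactE coact_pairA.
transitivity (\tsum_(g, q0 <- dQ q) \tsum_(h, p0 <- dP p) \tsum_(x, n <- hom_eval f q1)
    (lact X (g * h) x ⊗ lact N (pairA q0 p0) n)); last first.
  rewrite linear_tlift; apply: eq_tlift => g q0 /=.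
  rewrite tlift_tlift; last by bilin.
  by apply: eq_tlift => h p0; rewrite tmapE.
rewrite exchange_tlift -[LHS]/(lin_of l _) linear_tlift; apply: eq_tlift => h p0.
rewrite exchange_tlift linear_tlift; apply: eq_tlift => x n.
rewrite /= tens_homs_pure; apply: eq_tlift => g q0.
by rewrite (lactP X).2 pair_homE.
Qed.

Lemma tens_homs_iso : mh_iso tens_homs_hom.
Proof. exact: (@mh_iso_can _ _ _ _ tens_homs_hom homs_tens tens_homsK homs_tensK). Qed.

Definition hom_c : modHom (F (tens_act X N)) (tens_act X (F N)) :=
  mh_inv tens_homs_iso.

Lemma hom_cK : cancel hom_c tens_homs.
Proof. exact: mh_invVK tens_homs_iso. Qed.

Lemma tens_homs_cK : cancel tens_homs hom_c.
Proof. exact: mh_invK tens_homs_iso. Qed.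



End Constraint.
Local Notation F := (hom_mod jBM Q).
Local Notation mapF := (hom_hom jBM Q).

Lemma hom_c_nat (X Y : lmodule H) (M N : lmodule A) (f : modHom X Y)
    (g : modHom M N) u :
  hom_c Y N (mapF (tens_hom f g) u) = tens_hom f (mapF g) (hom_c X M u).
Proof.
rewrite -{1}(hom_cK u); move: (hom_c X M u) => v.
apply: (can_inj (@tens_homs_cK Y N)); rewrite hom_cK; move: v.
apply: tens_ext; [by lin | by lin |] => x h; apply: hom_eval_ext => q.
rewrite hom_mapE !tens_homs_pure /= tmap_pure tens_homs_pure linear_tlift.
by apply: eq_tlift => b q0; rewrite /= tmap_pure mhP hom_mapE.
Qed.

Lemma dQ_coaction : is_coaction dQ.
Proof. exact: coaction_in (bm_inj Q) dQc. Qed.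

(** The coherence axiom is first proved for the inverse of the constraint, the direction with an
    explicit formula on pure tensors; there it is coassociativity of [dQ]. *)
Lemma tens_homs_assoc (X Y : lmodule H) (M : lmodule A) v :
  mapF (assoc_hom X Y M) (tens_homs (tens_mod X Y) M v)
  = tens_homs X (tens_act Y M) (tmap \1%VF (tens_homs Y M) (tassoc X Y (F M) v)).
Proof.
move: v; apply: tens_ext; [by lin | by lin |] => w f; move: w.
apply: tens_ext; [by lin | by lin |] => x y; apply: hom_eval_ext => q.
rewrite hom_mapE tassoc_pure tmap_pure id_lfunE !tens_homs_pure linear_tlift /=.
(* Applying [Phi] to the coassociativity equation of [dQ] at q yields the two sides of the goal. *)
pose Phi : tens H (tens H Q) -> tens X (tens Y M) :=
  tlift (fun h t => lact X h x ⊗ \tsum_(h', q' <- t) (lact Y h' y ⊗ hom_eval f q')).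
have lPhi : linear Phi by rewrite /Phi; lin.
have be : bilin (fun h' q' => lact Y h' y ⊗ hom_eval f q').
  by split=> z; [lin | apply: lin_purer; apply: hom_eval_linear].
have := congr1 (lin_of lPhi) (dQ_coaction.1 q); rewrite !linear_tlift /= => E.
transitivity (\tsum_(h, q' <- dQ q)
    lin_of lPhi (\tsum_(h1, h2 <- comul H h) (h1 ⊗ (h2 ⊗ q')))).
  apply: eq_tlift => h q0; rewrite (tens_lact_pure (A := regular_comodAlg H)) /=.
  have lT : linear (fun t : tens X Y => tassoc X Y M (t ⊗ hom_eval f q0)) by lin.
  rewrite -[LHS]/(lin_of lT _) linear_tlift [RHS]linear_tlift /=.
  apply: eq_tlift => h1 h2; rewrite /= tassoc_pure /Phi tlift_pure; last by bilin.
  by rewrite tlift_pure.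
rewrite E; apply: eq_tlift => h q0 /=.
by rewrite /Phi tlift_pure ?tens_homs_pure //; bilin.
Qed.

Lemma hom_c_assoc (X Y : lmodule H) (M : lmodule A) u :
  assoc_hom X Y (F M) (hom_c (tens_mod X Y) M u)
  = tens_hom (mh_id X) (hom_c Y M)
      (hom_c X (tens_act Y M) (mapF (assoc_hom X Y M) u)).
Proof.
rewrite -{2}(hom_cK u); move: (hom_c _ _ u) => v.
rewrite tens_homs_assoc tens_homs_cK /= tmap_comp.
have -> : (hom_c Y M \o tens_homs Y M)%VF = \1%VF.
  by apply/lfunP => w; rewrite comp_lfunE tens_homs_cK id_lfunE.
by rewrite comp_lfun1l tmap1.
Qed.

Lemma hom_c_unit (M : lmodule A) u :
  unit_hom (F M) (hom_c (unit_mod H) M u) = mapF (unit_hom M) u.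
Proof.
rewrite -{2}(hom_cK u); move: (hom_c _ _ u); apply: tens_ext; [by lin | by lin |].
move=> c f; apply: hom_eval_ext => q; rewrite hom_mapE tens_homs_pure.
have uE (D : comodAlg H) (N : lmodule D) (x : k^o) (y : N) :
    tunit N (x ⊗ y) = (x : k) *: y.
  by rewrite lfunE /= tlift_pure //; bilin.
have eK : hom_eval ((c : k) *: f) q = (c : k) *: hom_eval f q.
  have z0 : hom_eval 0 q = 0 :> M := linear0 (lin_of (@hom_eval_linearl _ _ _ _ _ jBM Q M q)).
  by have := hom_evalP c f 0 q; rewrite z0 !addr0.
have -> : unit_hom (F M) (c ⊗ f) = (c : k) *: f by exact: (uE B (F M)).
rewrite eK /= linear_tlift -{1}(dQ_coaction.2 q).
rewrite -[hom_eval f _]/(lin_of (hom_eval_linear f) _) !linear_tlift.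
apply: eq_tlift => h q0 /=; rewrite uE unit_lactE.
rewrite -[hom_eval f (_ *: _)]/(lin_of (hom_eval_linear f) _) linearZ /=.
by rewrite scalerA mulrC.
Qed.


Definition hom_module_functor : moduleFunctor A B :=
  @ModuleFunctor k H A B (hom_functor jBM Q) hom_c
    (fun X M => mh_inv_iso (tens_homs_iso X M)) hom_c_nat hom_c_assoc hom_c_unit.

Lemma morita_context_equiv : morita_equiv A B.
Proof.
exists hom_module_functor, (hom_functor jAM P); split.
  exact: (morita_nat_iso jAM jBM jA_inj QPA PQB ht).
exact: (morita_nat_iso jBM jAM jB_inj PQB QPA hs).
Qed.

End ModuleFunctor.
End Morita.

(** * Rows and columns from an equivalence of module categories *)

Section RegularModule.
Variables (k : fieldType) (A : falgType k).

Definition reg_lact : 'Hom(A, 'Hom(A, A)) :=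
  linfun (fun a : A => linfun (fun b : A => a * b)).

Lemma reg_lactE a b : reg_lact a b = a * b.
Proof.
have l a' : linear (fun b : A => a' * b) by lin.
rewrite linfunE ?linfunE // => c x y; apply/lfunP => z.
by rewrite add_lfunE scale_lfunE !linfunE // mulrDl scalerAl.
Qed.

Lemma reg_lactP : is_action reg_lact.
Proof. by split=> [a|a b c]; rewrite !reg_lactE ?mul1r ?mulrA. Qed.

Definition reg_mod : lmodule A := LModule reg_lactP.

Section Orbit.
Variable N : lmodule A.

Definition orbit_fun (n : N) : 'Hom(reg_mod, N) := linfun (fun a : A => lact N a n).

Lemma orbit_funE n a : orbit_fun n a = lact N a n.
Proof. by rewrite linfunE //; lin. Qed.

Lemma orbit_funP n a m : orbit_fun n (lact reg_mod a m) = lact N a (orbit_fun n m).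
Proof. by rewrite !orbit_funE reg_lactE (lactP N).2. Qed.

Definition orbit_hom (n : N) : modHom reg_mod N := ModHom (@orbit_funP n).

Lemma orbit_hom1 n : orbit_hom n 1 = n.
Proof. by rewrite /= orbit_funE (lactP N).1. Qed.

Lemma reg_mod_ext (f g : modHom reg_mod N) : f 1 = g 1 -> f =1 g.
Proof.
move=> e a; have -> : a = lact reg_mod a 1 by rewrite /= reg_lactE mulr1.
by rewrite !mhP e.
Qed.

End Orbit.

Section Quotient.
Variables (N : lmodule A) (U : {vspace N}).
Hypothesis UA : forall a n, n \in U -> lact N a n \in U.

(* The quotient of N by U is realised on the image of a projection with kernel U. *)
Let om : 'End(N) := \1%VF - projv U.

Let omE n : om n = n - projv U n.
Proof. by rewrite add_lfunE opp_lfunE id_lfunE. Qed.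

Let omU n : (om n == 0) = (n \in U).
Proof.
rewrite omE subr_eq0; apply/eqP/idP => [->|nU]; first exact: memv_proj.
by rewrite projv_id.
Qed.

Let omlact a n : om (lact N a (om n)) = om (lact N a n).
Proof.
rewrite [om n]omE linearB /= linearB /= -[RHS]subr0; congr (_ - _).
by apply/eqP; rewrite omU; apply/UA/memv_proj.
Qed.

Let Z := subvs_of (limg om).
Let quo (n : N) : Z := vsproj (limg om) (om n).

Let quoE n : vsval (quo n) = om n.
Proof. by rewrite vsprojK // memv_img ?memvf. Qed.

Let quo_linear : linear quo.
Proof. by move=> c m n; apply: val_inj; rewrite -[RHS]/(vsval _) linearP /= !quoE linearP. Qed.

Let quo_lact : 'Hom(A, 'End(Z)) :=
  linfun (fun a => linfun (fun z : Z => quo (lact N a (vsval z)))).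

Let quo_lactE a z : quo_lact a z = quo (lact N a (vsval z)).
Proof.
have l a' : linear (fun z : Z => quo (lact N a' (vsval z))).
  by move=> c x y; rewrite !linearP quo_linear.
rewrite linfunE ?linfunE // => c x y; apply/lfunP => w.
by rewrite add_lfunE scale_lfunE !linfunE // linearP add_lfunE scale_lfunE quo_linear.
Qed.

Let omK (z : Z) : om (vsval z) = vsval z.
Proof.
have /memv_imgP[n _ ->] := subvsP z.
by have := omlact 1 n; rewrite !(lactP N).1.
Qed.

Let quo_lactP : is_action quo_lact.
Proof.
split=> [z|a b z]; rewrite !quo_lactE; apply: val_inj.
  by rewrite /= quoE (lactP N).1 omK.
by rewrite /= !quoE omlact (lactP N).2.
Qed.

Lemma quotient_mod : exists (Y : lmodule A) (f : modHom N Y),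
  forall n, (f n == 0) = (n \in U).
Proof.
have fP a n : linfun quo (lact N a n) = lact (LModule quo_lactP) a (linfun quo n).
  rewrite /= !(linfunE quo_linear) quo_lactE quoE; apply: val_inj.
  by rewrite /= !quoE omlact.
exists (LModule quo_lactP), (@ModHom _ A N (LModule quo_lactP) (linfun quo) fP) => n.
rewrite /= (linfunE quo_linear) -omU -quoE; apply/eqP/eqP => [->|e].
  exact: linear0.
by apply: val_inj; rewrite -[LHS]/(vsval _) e -[RHS]/(vsval 0) linear0.
Qed.

End Quotient.

End RegularModule.

(** * Module maps into H (x) M transported along the equivalence *)

Section RowsAndColumns.
Variables (k : fieldType) (H : hopfAlg k) (A B : comodAlg H).
Variables (chi : 'Hom(B, k^o)) (chi1 : chi 1 = 1 :> k).
Hypothesis chiM : forall a b : B, chi (a * b) = (chi a : k) * (chi b : k) :> k.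
Variables (F : moduleFunctor A B) (eF : is_equivalence F).

Definition char_lact : 'Hom(B, 'Hom(k^o, k^o)) :=
  linfun (fun b => (chi b : k) *: \1%VF).

Lemma char_lactE b c : char_lact b c = (chi b : k) *: c.
Proof. by rewrite linfunE ?scale_lfunE ?id_lfunE //; lin. Qed.

Lemma char_lactP : is_action char_lact.
Proof.
split=> [c|a b c]; rewrite !char_lactE; first by rewrite chi1 scale1r.
by rewrite chiM scalerA.
Qed.

Definition char_mod : lmodule B := LModule char_lactP.

(* The inclusion of B in H when B is a left coideal subalgebra and chi its counit. *)
Definition char_map : 'Hom(B, H) :=
  linfun (fun b => \tsum_(h, b0 <- coact B b) ((chi b0 : k) *: h)).

Lemma char_mapE b : char_map b = \tsum_(h, b0 <- coact B b) ((chi b0 : k) *: h).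
Proof. by rewrite linfunE //; lin. Qed.

Lemma char_map1 : char_map 1 = 1.
Proof. by rewrite char_mapE coact1 tlift_pure ?chi1 ?scale1r //; bilin. Qed.

Lemma char_mapM a b : char_map (a * b) = char_map a * char_map b.
Proof.
rewrite !char_mapE coactM linear_tlift.
have l c : linear (fun x : H => x * c) by lin.
rewrite -[RHS]/(lin_of (l _) _) linear_tlift; apply: eq_tlift => g a0 /=.
rewrite tlift_tlift; last by bilin.
have l' c : linear (fun x : H => c * x) by lin.
rewrite -[RHS]/(lin_of (l' _) _) linear_tlift; apply: eq_tlift => h b0 /=.
by rewrite chiM -scalerAl -scalerAr scalerA.
Qed.

Lemma comul_char_map b : comul H (char_map b) = tmap \1%VF char_map (coact B b).
Proof.
have l : linear (tlift (fun (h : H) (s : tens H B) =>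
    h ⊗ \tsum_(h', b0 <- s) ((chi b0 : k) *: h')) : tens H (tens H B) -> tens H H) by lin.
have := congr1 (lin_of l) ((coactP B).1 b); rewrite !linear_tlift /= => E.
rewrite char_mapE tmapE linear_tlift.
transitivity (\tsum_(h, b0 <- coact B b)
    lin_of l (\tsum_(h1, h2 <- comul H h) (h1 ⊗ (h2 ⊗ b0)))).
  apply: eq_tlift => h b0; rewrite linear_tlift.
  rewrite linearZ /= -{1}(tlift_id (comul H h)) linear_tlift; apply: eq_tlift => h1 h2 /=.
  rewrite tlift_pure; last by bilin.
  by rewrite tlift_pure ?linearZ //; bilin.
rewrite E; apply: eq_tlift => h b0; rewrite /= tlift_pure; last by bilin.
by rewrite id_lfunE char_mapE.
Qed.

Variables (M : lmodule A) (u : modHom (F M) char_mod) (u_iso : mh_iso u).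
Local Notation "'H⊗' N" := (tens_act (reg_mod H) N) (at level 35).

Definition fiber_map : tens H (F M) -> H :=
  tlift (fun (h : H) (y : F M) => (u y : k) *: h).

Lemma fiber_map_bilin : bilin (fun (h : H) (y : F M) => (u y : k) *: h).
Proof. by bilin. Qed.

(** As [u] makes the action on F M scalar, b_(-1) h (x) b_(0) y goes to chi(b_(0)) u(y) b_(-1) h,
    and the scalars chi(b_(0)) gather with b_(-1) into [char_map b]. *)
Lemma fiber_map_lact b t :
  fiber_map (lact (H⊗ (F M)) b t) = char_map b * fiber_map t.
Proof.
have l : linear (fun x : H => char_map b * x) by lin.
move: t; apply: tens_ext.
- by rewrite /fiber_map; lin.
- by rewrite /fiber_map; lin.
move=> h y; rewrite {2}/fiber_map tlift_pure; last exact: fiber_map_bilin.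
have := tens_lact_pure (X := reg_mod H) (M := F M) b h y => /= ->.
rewrite /fiber_map tlift_tlift; last exact: fiber_map_bilin.
rewrite char_mapE.
have l' c : linear (fun x : H => x * c) by lin.
rewrite -[RHS]/(lin_of (l' _) _) linear_tlift; apply: eq_tlift => g b0 /=.
have -> : u (lact (F M) b0 y) = (chi b0 : k) * (u y : k) :> k.
  by rewrite mhP [LHS]char_lactE.
by rewrite reg_lactE -scalerAl -scalerAr scalerA.
Qed.

Definition fiber_inv (h : H) : tens H (F M) := h ⊗ mh_inv u_iso 1.

Lemma fiber_invK : cancel fiber_inv fiber_map.
Proof.
move=> h; rewrite /fiber_map tlift_pure; last exact: fiber_map_bilin.
by rewrite mh_invVK scale1r.
Qed.

Lemma fiber_mapK : cancel fiber_map fiber_inv.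
Proof.
apply: (@tens_ext _ _ _ _ (fun t => fiber_inv (fiber_map t)) id).
- by rewrite /fiber_inv /fiber_map; lin.
- by [].
move=> h y; rewrite /fiber_map tlift_pure; last exact: fiber_map_bilin.
rewrite /fiber_inv tpureZl -linearZ /=; congr (_ ⊗ _).
rewrite -[RHS](mh_invK u_iso) -linearZ /=; congr (_ _).
by rewrite -[LHS]/((u y : k) * 1) mulr1.
Qed.

Lemma fiber_map_linear : linear fiber_map.
Proof. by rewrite /fiber_map; lin. Qed.

Section Transport.
Variable N : lmodule A.
Implicit Types g : modHom N (H⊗ M).

(* Since F M = k, the constraint identifies F (H (x) M) with H, and g |-> transport g
   identifies Hom_A(N, H (x) M) with Hom_B(F N, H). *)
Definition transport g (y : F N) : H :=
  fiber_map (mf_c F (reg_mod H) M (fmap F g y)).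

Lemma transport_ext g g' : g =1 g' -> transport g =1 transport g'.
Proof. by move=> e y; rewrite /transport (fmap_ext e). Qed.

Lemma transport_lact g b y :
  transport g (lact (F N) b y) = char_map b * transport g y.
Proof. by rewrite /transport !mhP fiber_map_lact. Qed.

Lemma transport_linear g : linear (transport g).
Proof. by move=> c x y; rewrite /transport !linearP fiber_map_linear. Qed.

Lemma transport_lin c g g' y :
  transport (mh_lin c g g') y = c *: transport g y + transport g' y.
Proof.
rewrite /transport (fmap_lin c g g') /= add_lfunE scale_lfunE linearP.
exact: fiber_map_linear.
Qed.

Lemma transport_inj g g' : transport g =1 transport g' -> g =1 g'.
Proof.
move=> e; apply: (equivalence_faithful eF) => y.
apply: (can_inj (mh_invK (mf_c_iso F (reg_mod H) M))).
exact: (can_inj fiber_mapK) (e y).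
Qed.

Lemma transport_surj (f : 'Hom(F N, H)) :
  (forall b y, f (lact (F N) b y) = char_map b * f y) ->
  exists g, transport g =1 f.
Proof.
move=> fB; pose f1 : 'Hom(F N, F (H⊗ M)) :=
  linfun (fun y => mh_inv (mf_c_iso F (reg_mod H) M) (fiber_inv (f y))).
have f1E y : f1 y = mh_inv (mf_c_iso F (reg_mod H) M) (fiber_inv (f y)).
  by rewrite /f1 linfunE // /fiber_inv; lin.
have f1P b y : f1 (lact (F N) b y) = lact (F (H⊗ M)) b (f1 y).
  rewrite !f1E -mhP; congr (_ _); apply: (can_inj fiber_mapK).
  by rewrite fiber_invK fB fiber_map_lact fiber_invK.
have [g gE] := equivalence_full eF (ModHom f1P).
by exists g => y; rewrite /transport (etrans (gE y) (f1E y)) mh_invVK fiber_invK.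
Qed.

End Transport.

Lemma transport_comp (N N' : lmodule A) (g : modHom N (H⊗ M)) (f : modHom N' N) y :
  transport (mh_comp g f) y = transport g (fmap F f y).
Proof. by rewrite /transport (fmap_comp g f) /= comp_lfunE. Qed.

Definition regr_mul (h : H) : 'Hom(reg_mod H, reg_mod H) := linfun (fun x : H => x * h).

Lemma regr_mulE h x : regr_mul h x = x * h.
Proof. by rewrite linfunE //; lin. Qed.

Lemma regr_mulP h a x : regr_mul h (lact (reg_mod H) a x) = lact (reg_mod H) a (regr_mul h x).
Proof. by rewrite !regr_mulE /= !reg_lactE mulrA. Qed.

Definition regr (h : H) : modHom (reg_mod H) (reg_mod H) := ModHom (@regr_mulP h).

(** Naturality of the constraint in its H-module argument: right multiplication is an endomorphism
    of the left regular module. *)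
Lemma transport_regr (N : lmodule A) (g : modHom N (H⊗ M)) h y :
  transport (mh_comp (tens_hom (regr h) (mh_id M)) g) y = transport g y * h.
Proof.
rewrite {1}/transport (fmap_comp _ g) /= comp_lfunE /= mf_c_nat /transport.
move: (mf_c _ _ _ _).
apply: tens_ext; [|by rewrite /fiber_map; lin|].
  by apply: comp_linear; [exact: fiber_map_linear | lin].
move=> x z.
have -> : tens_hom (regr h) (fmap F (mh_id M)) (x ⊗ z) = (x * h) ⊗ z.
  by rewrite /= tmap_pure regr_mulE fmap_id /= id_lfunE.
rewrite /fiber_map !tlift_pure; [|exact: fiber_map_bilin..].
by rewrite scalerAl.
Qed.

Lemma comul_regP a (h : reg_mod H) :
  comul H (lact (reg_mod H) a h) = lact (tens_mod (reg_mod H) (reg_mod H)) a (comul H h).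
Proof.
have := @tens_lactE _ H (regular_comodAlg H) (reg_mod H) (reg_mod H) a (comul H h).
rewrite /= reg_lactE => ->; rewrite comulM; apply: eq_tlift => g1 g2.
by rewrite tmapE; apply: eq_tlift => h1 h2; rewrite !reg_lactE.
Qed.

Definition comul_reg : modHom (reg_mod H) (tens_mod (reg_mod H) (reg_mod H)) :=
  @ModHom _ H (reg_mod H) (tens_mod (reg_mod H) (reg_mod H)) (comul H) comul_regP.

Local Notation Hr := (reg_mod H).

Definition transport_lfun (N : lmodule A) (g : modHom N (H⊗ M)) : 'Hom(F N, H) :=
  linfun (transport g).

Lemma transport_lfunE (N : lmodule A) (g : modHom N (H⊗ M)) :
  transport_lfun g =1 transport g.
Proof. exact/linfunE/transport_linear. Qed.

Definition fiber_lfun : 'Hom(F (H⊗ M), H) :=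
  linfun (fun z => fiber_map (mf_c F Hr M z)).

Lemma fiber_lfunE z : fiber_lfun z = fiber_map (mf_c F Hr M z).
Proof. by rewrite linfunE //; apply: comp_linear; [exact: fiber_map_linear | lin]. Qed.

Section Transport2.
Variable N : lmodule A.
Implicit Types G : modHom N (H⊗ (H⊗ M)).

(** The same transport with two factors H, so that coactions of rows and columns can be compared
    with the comultiplication of their entries. *)
Definition transport2 G (y : F N) : tens H H :=
  tmap \1%VF fiber_lfun (mf_c F Hr (H⊗ M) (fmap F G y)).

Lemma transport2_inj G G' : transport2 G =1 transport2 G' -> G =1 G'.
Proof.
move=> e; apply: (equivalence_faithful eF) => y.
apply: (can_inj (mh_invK (mf_c_iso F Hr (H⊗ M)))).
have fK : cancel fiber_lfun (linfun (fun h => mh_inv (mf_c_iso F Hr M) (fiber_inv h))).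
  move=> z; rewrite fiber_lfunE linfunE; last by rewrite /fiber_inv; lin.
  by rewrite fiber_mapK mh_invK.
exact: can_inj (tmapK (@id_lfunK _ _) fK) _ _ (e y).
Qed.

Definition transport_coact (N' : lmodule A) (d : modHom N (H⊗ N')) (y : F N) :
  tens H (F N') := mf_c F Hr N' (fmap F d y).

Lemma transport2_comp (N' : lmodule A) (g : modHom N' (H⊗ M)) (d : modHom N (H⊗ N')) y :
  transport2 (mh_comp (tens_hom (mh_id Hr) g) d) y
  = tmap \1%VF (transport_lfun g) (transport_coact d y).
Proof.
rewrite /transport2 (fmap_comp _ d) /= comp_lfunE /= mf_c_nat.
rewrite [LHS]tmap_comp /= comp_lfun1l; congr (tmap _ _ _).
by apply/lfunP => z; rewrite comp_lfunE transport_lfunE fiber_lfunE.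
Qed.

(** The comultiplication is a module map from H to H (x) H, so the constraint is natural along it,
    and the coherence axiom [mf_c_assoc] splits the constraint at H (x) H into two constraints at H.
    This is where associativity of the module functor enters. *)
Lemma transport2_comul (g : modHom N (H⊗ M)) y :
  transport2 (mh_comp (assoc_hom Hr Hr M)
               (mh_comp (tens_hom comul_reg (mh_id M)) g)) y
  = comul H (transport g y).
Proof.
rewrite /transport2 (fmap_comp _ (mh_comp _ g)) /= comp_lfunE (fmap_comp _ g) /= comp_lfunE /=.
set z := fmap F (tens_hom comul_reg (mh_id M)) _.
have -> : fiber_lfun = (linfun fiber_map \o mf_c F Hr M)%VF.
  by apply/lfunP => w; rewrite comp_lfunE fiber_lfunE (linfunE fiber_map_linear).
transitivity (tmap \1%VF (linfun fiber_map) (tens_hom (mh_id Hr) (mf_c F Hr M)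
    (mf_c F Hr (H⊗ M) (fmap F (assoc_hom Hr Hr M) z)))).
  by rewrite [RHS]tmap_comp /= comp_lfun1l.
rewrite -mf_c_assoc /z mf_c_nat /transport.
move: (mf_c F Hr M _); apply: tens_ext => [||h x].
- by apply: comp_linear; lin.
- by apply: comp_linear; [lin | exact: fiber_map_linear].
have -> : tens_hom comul_reg (fmap F (mh_id M)) (h ⊗ x) = comul H h ⊗ x.
  by rewrite /= tmap_pure fmap_id /= id_lfunE.
rewrite [in RHS]/fiber_map tlift_pure; last exact: fiber_map_bilin.
rewrite linearZ /= -{1 2}(tlift_id (comul H h)).
have l : linear (fun t : tens H H => tmap \1%VF (linfun fiber_map) (tassoc Hr Hr (F M) (t ⊗ x))).
  by lin.
rewrite -[LHS]/(lin_of l _) !linear_tlift; apply: eq_tlift => h1 h2 /=.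
rewrite tassoc_pure tmap_pure id_lfunE (linfunE fiber_map_linear).
by rewrite /fiber_map tlift_pure ?linearZ //; exact: fiber_map_bilin.
Qed.

End Transport2.

Lemma transport2_ext (N : lmodule A) (G G' : modHom N (H⊗ (H⊗ M))) :
  G =1 G' -> transport2 G =1 transport2 G'.
Proof. by move=> e y; rewrite /transport2 (fmap_ext e). Qed.

Lemma transport_coact_surj (N N' : lmodule A) (f : modHom (F N) (H⊗ (F N'))) :
  exists d : modHom N (H⊗ N'), transport_coact d =1 f.
Proof.
have [d dE] := equivalence_full eF (mh_comp (mh_inv (mf_c_iso F Hr N')) f).
exists d => y; rewrite /transport_coact (etrans (dE y) (comp_lfunE _ _ _)).
exact: (mh_invVK (mf_c_iso F Hr N')).
Qed.

Local Notation Ar := (reg_mod A).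

Definition fiber_orbit (m : M) : modHom Ar (H⊗ M) := @orbit_hom _ A (H⊗ M) ((1 : H) ⊗ m).

Lemma fiber_orbit1 m : fiber_orbit m 1 = (1 : H) ⊗ m.
Proof. exact: orbit_hom1. Qed.

Definition row_fun (p : F Ar) (m : M) : H := transport (fiber_orbit m) p.

Lemma pm_fun_bilin : bilin row_fun.
Proof.
split=> [m|p]; first exact: transport_linear.
move=> c m m'; rewrite /row_fun -transport_lin; apply: transport_ext.
apply: reg_mod_ext; rewrite fiber_orbit1 [RHS]add_lfunE scale_lfunE !fiber_orbit1.
by rewrite linearP.
Qed.

Definition row_map : 'Hom(F Ar, 'Hom(M, H)) := linfun (fun p => linfun (row_fun p)).

Lemma row_mapE p m : row_map p m = transport (fiber_orbit m) p.
Proof.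
have [l1 l2] := pm_fun_bilin.
rewrite linfunE ?linfunE // => c x y; apply/lfunP => z.
by rewrite add_lfunE scale_lfunE !linfunE // l1.
Qed.

(** The orbit map of 1 (x) 1 is the coaction of A viewed as an A-module map from A to H (x) A; F and
    the constraint carry it to F A. *)
Definition row_coact : 'Hom(F Ar, tens H (F Ar)) :=
  (mf_c F Hr Ar \o fmap F (@orbit_hom _ A (H⊗ Ar) ((1 : H) ⊗ (1 : A))))%VF.

(** Both sides come from A-maps from A to H (x) (H (x) M), and both of these send 1 to 1 (x) (1 (x)
    m). *)
Lemma row_map_comul p m : comul H (row_map p m) = \tsum_(h, p0 <- row_coact p) (h ⊗ row_map p0 m).
Proof.
rewrite row_mapE -transport2_comul.
pose d := @orbit_hom _ A (H⊗ Ar) ((1 : H) ⊗ (1 : A)).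
rewrite (@transport2_ext _ _ (mh_comp (tens_hom (mh_id Hr) (fiber_orbit m)) d)).
  rewrite transport2_comp tmapE.
  have -> : transport_coact d p = row_coact p by rewrite /row_coact comp_lfunE.
  by apply: eq_tlift => h p0; rewrite id_lfunE transport_lfunE row_mapE.
apply: reg_mod_ext; rewrite /= !comp_lfunE.
have /= e1 := fiber_orbit1 m; have /= e2 := @orbit_hom1 _ A (H⊗ Ar) ((1 : H) ⊗ (1 : A)).
by rewrite e1 e2 !tmap_pure !id_lfunE e1 comul1 tassoc_pure.
Qed.

Variables (Q0 : lmodule A) (w : modHom (F Q0) (reg_mod B)) (w_iso : mh_iso w).

(** Under F Q0 = B the columns are the A-map whose transport is [char_map], the tautological B-map
    from B to H. *)
Lemma column_exists : exists col : modHom Q0 (H⊗ M), forall y, transport col y = char_map (w y).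
Proof.
have [|col colE] := @transport_surj Q0 (char_map \o w)%VF.
  move=> b y; rewrite !comp_lfunE -char_mapM; congr (char_map _).
  by apply: (etrans (mhP w b y)); rewrite /= reg_lactE.
by exists col => y; rewrite colE comp_lfunE.
Qed.

Variables (col : modHom Q0 (H⊗ M)).
Hypothesis colE : forall y, transport col y = char_map (w y).

(** The coaction of B is itself a B-module map from B to H (x) B. Moved to F Q0 through [w], it
    lifts to a map on Q0 because F is full, and the required identity can be tested after
    transport. *)
Lemma column_coact : exists dQ : 'Hom(Q0, tens H Q0), forall q,
  \tsum_(h, m <- col q) \tsum_(h1, h2 <- comul H h) (h1 ⊗ (h2 ⊗ m))
  = \tsum_(h, q0 <- dQ q) (h ⊗ col q0).
Proof.
pose f := mh_comp (tens_hom (mh_id Hr) (mh_inv w_iso))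
  (mh_comp (@orbit_hom _ B (H⊗ (reg_mod B)) ((1 : H) ⊗ (1 : B))) w).
have [d dE] := transport_coact_surj f; exists d => q.
have coactE b : @orbit_hom _ B (H⊗ (reg_mod B)) ((1 : H) ⊗ (1 : B)) b = coact B b.
  apply: (etrans (orbit_funE _ _)).
  apply: (etrans (@tens_lact_pure _ H B (reg_mod H) (reg_mod B) b (1 : H) (1 : B))).
  rewrite -[RHS]tlift_id; apply: eq_tlift => h b0.
  by rewrite /= !reg_lactE !mulr1.
have e : mh_comp (assoc_hom Hr Hr M) (mh_comp (tens_hom comul_reg (mh_id M)) col)
    =1 mh_comp (tens_hom (mh_id Hr) col) d.
  apply: transport2_inj => y; rewrite transport2_comul transport2_comp dE colE.
  rewrite comul_char_map /f /= !comp_lfunE coactE tmap_comp comp_lfun1l.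
  congr (tmap _ _ _); apply/lfunP => b.
  by rewrite comp_lfunE transport_lfunE colE [w _]mh_invVK.
have := e q; rewrite /= !comp_lfunE /= tmapE => E.
rewrite -[RHS]/(\tsum_(h, q0 <- d q) (h ⊗ col q0)).
transitivity (tmap (\1%VF : 'End(H)) col (d q)); last first.
  by rewrite tmapE; apply: eq_tlift => h q0; rewrite id_lfunE.
rewrite -E linear_tlift; apply: eq_tlift => h m; rewrite id_lfunE.
have l : linear (fun t : tens H H => tassoc Hr Hr M (t ⊗ m)) by lin.
rewrite -{2}(tlift_id (comul H h)) -[RHS]/(lin_of l _) linear_tlift.
by apply: eq_tlift => h1 h2; rewrite /= tassoc_pure.
Qed.

Lemma column_row_map p q : exists a : A, forall m,
  \tsum_(h, a0 <- coact A a) (h ⊗ lact M a0 m)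
  = \tsum_(h, m' <- col q) ((h * row_map p m) ⊗ m').
Proof.
(* [T] is the A-map from Q0 to A that becomes b |-> b p under F Q0 = B; the witness is its value at
   q. The two maps compared below both transport to y |-> [char_map (w y) * row_map p m]. *)
have [T TE] := equivalence_full eF (mh_comp (@orbit_hom _ B (F Ar) p) w).
exists (T q) => m.
have e : mh_comp (fiber_orbit m) T =1 mh_comp (tens_hom (regr (row_map p m)) (mh_id M)) col.
  apply: transport_inj => y; rewrite transport_comp transport_regr colE.
  rewrite (etrans (TE y) (etrans (comp_lfunE _ _ _) (orbit_funE _ _))).
  by rewrite transport_lact row_mapE.
have := etrans (esym (orbit_funE _ _)) (etrans (esym (comp_lfunE _ _ _)) (e q)).
rewrite [X in _ = X -> _]comp_lfunE [X in _ = X -> _]tmapE => E.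
transitivity (tens_lact Hr M (T q) ((1 : H) ⊗ m)).
  rewrite tens_lact_pure; apply: eq_tlift => h a0.
  by rewrite /= reg_lactE mulr1.
rewrite E; apply: eq_tlift => h m'; by rewrite id_lfunE regr_mulE.
Qed.

Lemma transport_orbit t p :
  transport (@orbit_hom _ A (H⊗ M) t) p = \tsum_(h, m <- t) (row_map p m * h).
Proof.
move: t; apply: tens_ext => [c s t||h m].
- rewrite -transport_lin; apply: transport_ext; apply: reg_mod_ext.
  by rewrite orbit_hom1 [RHS]add_lfunE scale_lfunE !orbit_hom1.
- by lin.
rewrite tlift_pure; last by bilin.
rewrite row_mapE -transport_regr; apply: transport_ext; apply: reg_mod_ext.
rewrite orbit_hom1 [RHS]comp_lfunE fiber_orbit1 [RHS]tmap_pure id_lfunE.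
by rewrite regr_mulE mul1r.
Qed.

Lemma char_map_pairing p q :
  char_map (w (fmap F (@orbit_hom _ A Q0 q) p)) = \tsum_(h, m <- col q) (row_map p m * h).
Proof.
rewrite -colE -transport_comp -transport_orbit; apply: transport_ext.
by apply: reg_mod_ext; rewrite [LHS]comp_lfunE !orbit_hom1.
Qed.

(* A proper image would give a nonzero quotient of B = F Q0, hence a nonzero map
   out of Q0, which some orbit map A -> Q0 detects. *)
Lemma pairing_surj : exists t : tens (F Ar) Q0,
  \tsum_(p, q <- t) w (fmap F (@orbit_hom _ A Q0 q) p) = 1.
Proof.
pose f (p : F Ar) (q : Q0) : B := w (fmap F (@orbit_hom _ A Q0 q) p).
have bf : bilin f.
  split=> [q|p]; first by rewrite /f; lin.
  move=> c q q'; rewrite /f -linearP; congr (w _).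
  transitivity (fmap F (mh_lin c (@orbit_hom _ A Q0 q) (@orbit_hom _ A Q0 q')) p).
    apply: fmap_ext; apply: reg_mod_ext.
    by rewrite orbit_hom1 [RHS]add_lfunE scale_lfunE !orbit_hom1.
  by rewrite fmap_lin /= add_lfunE scale_lfunE.
have lf : linear (tlift f : tens (F Ar) Q0 -> B) by move=> a x y; rewrite linearP.
pose U := limg (linfun (tlift f : tens (F Ar) Q0 -> B)).
have fU p q : f p q \in U.
  by rewrite -(tlift_pure p q bf) -(linfunE lf) memv_img ?memvf.
have UB (a : B) (b : reg_mod B) : b \in U -> lact (reg_mod B) a b \in U.
  move=> /memv_imgP[t _ ->]; rewrite (linfunE lf) linear_tlift.
  apply: tlift_memv => p q.
  have fE : f (lact (F Ar) a p) q = lact (reg_mod B) a (f p q) by rewrite /f !mhP.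
  by have := fU (lact (F Ar) a p) q; rewrite fE.
have [Z [pr prE]] := quotient_mod UB.
have [Z' [e e_iso]] := equivalence_ess_surj eF Z.
have [g gE] := equivalence_full eF (mh_comp (mh_inv e_iso) (mh_comp pr w)).
have g0 q : g q = 0.
  (* The zero morphism is written -f + f; F preserves this combination, so [fmap F] vanishing forces
     the map to vanish by faithfulness. On p the image is the class of [f p q], which is 0 modulo
     [U]. *)
  have gq0 : mh_comp g (@orbit_hom _ A Q0 q)
      =1 mh_lin (-1) (mh_comp g (@orbit_hom _ A Q0 q)) (mh_comp g (@orbit_hom _ A Q0 q)).
    apply: (equivalence_faithful eF) => p.
    rewrite fmap_lin /= add_lfunE scale_lfunE scaleN1r addNr fmap_comp /= comp_lfunE.
    rewrite (etrans (gE _) (etrans (comp_lfunE _ _ _) (congr1 _ (comp_lfunE _ _ _)))).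
    have /eqP -> : pr (f p q) == 0 by rewrite prE fU.
    by rewrite linear0.
  have := gq0 1; rewrite /= add_lfunE scale_lfunE scaleN1r addNr !comp_lfunE.
  by have /= -> := orbit_hom1 q.
have U1 : (1 : B) \in U.
  rewrite -[_ \in U]prE.
  have -> : (1 : B) = w (mh_inv w_iso (1 : B)) by rewrite mh_invVK.
  set y := mh_inv w_iso _.
  have : fmap F g y = 0.
    have gg : g =1 mh_lin (-1) g g.
      by move=> q; rewrite /= add_lfunE scale_lfunE scaleN1r addNr g0.
    by rewrite (fmap_ext gg) fmap_lin /= add_lfunE scale_lfunE scaleN1r addNr.
  rewrite (etrans (gE _) (etrans (comp_lfunE _ _ _) (congr1 _ (comp_lfunE _ _ _)))).
  by move/(congr1 e); rewrite mh_invVK linear0 => ->.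
by have /memv_imgP[t _ tE] := U1; exists t; rewrite tE (linfunE lf).
Qed.

Lemma matrix_context_unit : exists t : tens (F Ar) Q0,
  \tsum_(p, q <- t) \tsum_(h, m <- col q) (row_map p m * h) = 1.
Proof.
have [t tE] := pairing_surj; exists t.
rewrite -char_map1 -tE linear_tlift; apply: eq_tlift => p q /=.
by rewrite char_map_pairing.
Qed.

End RowsAndColumns.

(** All that is kept of F: linear data over H and four identities, in the form that survives a
    change of Hopf algebra. *)
Lemma character_matrix_context (k : fieldType) (H : hopfAlg k) (A B : comodAlg H)
    (chi : 'Hom(B, k^o)) (F : moduleFunctor A B) :
  is_equivalence F -> chi 1 = 1 :> k ->
  (forall a b : B, chi (a * b) = (chi a : k) * (chi b : k) :> k) ->
  exists (M : lmodule A) (P Q : vectType k) (f : 'Hom(P, 'Hom(M, H)))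
    (g : 'Hom(Q, tens H M)) (row_coact : 'Hom(P, tens H P)) (dQ : 'Hom(Q, tens H Q)),
  [/\ forall p m, comul H (f p m) = \tsum_(h, p0 <- row_coact p) (h ⊗ f p0 m),
      forall q, \tsum_(h, m <- g q) \tsum_(h1, h2 <- comul H h) (h1 ⊗ (h2 ⊗ m))
                = \tsum_(h, q0 <- dQ q) (h ⊗ g q0),
      forall p q, exists a : A, forall m,
        \tsum_(h, a0 <- coact A a) (h ⊗ lact M a0 m)
        = \tsum_(h, m' <- g q) ((h * f p m) ⊗ m')
    & exists t : tens P Q,
        \tsum_(p, q <- t) \tsum_(h, m <- g q) (f p m * h) = 1].
Proof.
move=> eF chi1 chiM.
have [M [u u_iso]] := equivalence_ess_surj eF (char_mod chi1 chiM).
have [Q0 [w w_iso]] := equivalence_ess_surj eF (reg_mod B).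
have [col colE] := column_exists eF u_iso w.
have [dQ dQE] := column_coact eF u_iso w_iso colE.
exists M, (F (reg_mod A)), Q0, (row_map u), col, (row_coact F), dQ; split=> //.
- exact: row_map_comul.
- exact: column_row_map.
exact: (matrix_context_unit eF w_iso colE).
Qed.

(** * The comodule algebra of matrices over a Hopf algebra *)

Section TensorAlgebra.
Variables (k : fieldType) (H S : falgType k).

(** A separate name, so that the ring structure of a tensor product of algebras is not declared on
    the matrix type underlying [tens]. *)
Definition talg : Type := tens H S.
HB.instance Definition _ := Vector.on talg.

Implicit Types r s t : talg.

Definition talg_one : talg := 1 ⊗ 1.
Definition talg_mul s t : talg :=
  \tsum_(g, x <- s) \tsum_(h, y <- t) ((g * h) ⊗ (x * y)).

Lemma talg_mul_linearl t : linear (talg_mul^~ t).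
Proof. by rewrite /talg_mul; lin. Qed.

Lemma talg_mul_linearr s : linear (talg_mul s).
Proof. by rewrite /talg_mul; lin. Qed.

Lemma talg_mul_pure g x h y : talg_mul (g ⊗ x) (h ⊗ y) = (g * h) ⊗ (x * y).
Proof. by rewrite /talg_mul !tlift_pure //; bilin. Qed.

Lemma talg_mulA : associative talg_mul.
Proof.
move=> r s t; move: r; apply: tens_ext => [||g x].
- exact: talg_mul_linearl.
- by apply: comp_linear; apply: talg_mul_linearl.
move: s; apply: tens_ext => [||h y].
- by apply: comp_linear; [exact: talg_mul_linearr | exact: talg_mul_linearl].
- by apply: comp_linear; [exact: talg_mul_linearl | exact: talg_mul_linearr].
move: t; apply: tens_ext => [||h' y'].
- by apply: comp_linear; apply: talg_mul_linearr.
- exact: talg_mul_linearr.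
by rewrite !talg_mul_pure !mulrA.
Qed.

Lemma talg_mul1l : left_id talg_one talg_mul.
Proof.
apply: tens_ext => [||g x]; [exact: talg_mul_linearr | by lin |].
by rewrite talg_mul_pure !mul1r.
Qed.

Lemma talg_mul1r : right_id talg_one talg_mul.
Proof.
apply: tens_ext => [||g x]; [exact: talg_mul_linearl | by lin |].
by rewrite talg_mul_pure !mulr1.
Qed.

Lemma talg_mulDl : left_distributive talg_mul +%R.
Proof.
by move=> r s t; have := talg_mul_linearl t 1 r s; rewrite !scale1r.
Qed.

Lemma talg_mulDr : right_distributive talg_mul +%R.
Proof.
by move=> r s t; have := talg_mul_linearr r 1 s t; rewrite !scale1r.
Qed.

Lemma tpure_eq0 (U V : vectType k) (u : U) (v : V) :
  u != 0 -> v != 0 -> u ⊗ v != 0.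
Proof.
move=> u0 v0; apply: contraNneq u0 => uv0; have := v0.
rewrite -(can_eq (@v2rK _ V)) linear0 => /rV0Pn[j vj].
rewrite -(can_eq (@v2rK _ U)) linear0; apply/eqP/rowP => i; rewrite mxE.
have /matrixP/(_ i j) := uv0; rewrite !mxE big_ord1 !mxE => /eqP.
by rewrite mulf_eq0 (negPf vj) orbF => /eqP.
Qed.

Lemma talg_one_neq0 : talg_one != 0.
Proof. by apply: tpure_eq0; apply: oner_neq0. Qed.

HB.instance Definition _ := GRing.Zmodule_isNzRing.Build talg
  talg_mulA talg_mul1l talg_mul1r talg_mulDl talg_mulDr talg_one_neq0.

Lemma talg_scaleAl c s t : c *: (s * t) = (c *: s) * t.
Proof.
have := talg_mul_linearl t c s 0; rewrite -[0]/(0 : talg).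
by rewrite -![talg_mul _ _]/(_ * _ : talg) mul0r !addr0.
Qed.

HB.instance Definition _ := GRing.Lmodule_isLalgebra.Build k talg talg_scaleAl.

Lemma talg_scaleAr c s t : c *: (s * t) = s * (c *: t).
Proof.
have := talg_mul_linearr s c t 0.
by rewrite -![talg_mul _ _]/(_ * _ : talg) mulr0 !addr0.
Qed.

HB.instance Definition _ := GRing.Lalgebra_isAlgebra.Build k talg talg_scaleAr.
HB.instance Definition _ := Algebra_isFalgebra.Build k talg.

End TensorAlgebra.

Section TensorComodule.
Variables (k : fieldType) (H : hopfAlg k) (S : falgType k).
Local Notation C := (talg H S : falgType k).

Lemma talg_pureM (g h : H) (x y : S) :
  (g ⊗ x : talg H S) * (h ⊗ y : talg H S) = (g * h) ⊗ (x * y).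
Proof. exact: talg_mul_pure. Qed.

Definition talg_coact : 'Hom(C, tens H C) :=
  (tassoc H H S \o tmap (comul H) (\1%VF : 'End(S)))%VF.

Lemma talg_coact_pure (h : H) (x : S) : talg_coact (h ⊗ x) =
  \tsum_(h1, h2 <- comul H h) (h1 ⊗ ((h2 ⊗ x) : C)).
Proof.
rewrite comp_lfunE tmap_pure id_lfunE.
have l : linear (fun t : tens H H => tassoc H H S (t ⊗ x)) by lin.
rewrite -{1}(tlift_id (comul H h)) -[LHS]/(lin_of l _) linear_tlift.
by apply: eq_tlift => h1 h2; rewrite /= tassoc_pure.
Qed.

Lemma tlift_talg_coact (W : lmodType k) (F : H -> C -> W) (h : H) (x : S) :
  bilin F -> tlift F (talg_coact (h ⊗ x)) = \tsum_(h1, h2 <- comul H h) F h1 (h2 ⊗ x).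
Proof. by move=> bF; rewrite talg_coact_pure (@tlift_tlift k H H H C). Qed.

Lemma talg_coactP : is_coaction talg_coact.
Proof.
split.
  apply: tens_ext => [||h x]; [by lin | by lin |].
  rewrite !tlift_talg_coact; [|by bilin..].
  have lx : linear (tlift (fun (h' : H) (t : tens H H) =>
      h' ⊗ \tsum_(h2, h3 <- t) (h2 ⊗ ((h3 ⊗ x) : C)))
    : tens H (tens H H) -> tens H (tens H C)) by lin.
  have := congr1 (lin_of lx) (comulA h); rewrite !linear_tlift /= => E.
  transitivity (\tsum_(h', h3 <- comul H h)
      lin_of lx (\tsum_(h1, h2 <- comul H h') (h1 ⊗ (h2 ⊗ h3)))).
    apply: eq_tlift => h' h3; rewrite linear_tlift; apply: eq_tlift => h1 h2 /=.
    rewrite tlift_pure; last by bilin.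
    by rewrite tlift_pure //; bilin.
  rewrite E; apply: eq_tlift => h1 h' /=; rewrite tlift_pure; last by bilin.
  by rewrite talg_coact_pure.
apply: tens_ext => [||h x]; [by lin | by lin |].
rewrite tlift_talg_coact; last by bilin.
have l : linear (fun h : H => (h ⊗ x : C)) by lin.
rewrite -{2}(comul_counitl h) -[RHS]/(lin_of l _) linear_tlift.
by apply: eq_tlift => h1 h2; rewrite /= tpureZl.
Qed.

Lemma talg_coact1 : talg_coact 1 = 1 ⊗ 1.
Proof. by rewrite talg_coact_pure comul1 tlift_pure //; bilin. Qed.

Lemma talg_coactM (a b : C) : talg_coact (a * b) =
  \tsum_(g, a0 <- talg_coact a) \tsum_(h, b0 <- talg_coact b) ((g * h) ⊗ (a0 * b0)).
Proof.
move: a; apply: tens_ext => [||g x]; [by lin | by lin |].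
move: b; apply: tens_ext => [||h y]; [by lin | by lin |].
rewrite talg_pureM [LHS]talg_coact_pure comulM linear_tlift.
rewrite tlift_talg_coact; last by bilin.
apply: eq_tlift => g1 g2; rewrite /= tlift_talg_coact; last by bilin.
rewrite linear_tlift; apply: eq_tlift => h1 h2 /=.
rewrite tlift_pure; last by bilin.
by rewrite talg_pureM.
Qed.

Definition talg_comodAlg : comodAlg H :=
  @ComodAlg k H C talg_coact talg_coactP talg_coact1 talg_coactM.

End TensorComodule.

(** * The coideal subalgebra of a corner *)

Section CostableSubspaces.
Variables (k : fieldType) (H : hopfAlg k) (C : comodAlg H).
Implicit Types W X Y : {vspace C}.

Definition costable W := (coact C @: W <= tensv (fullv : {vspace H}) W)%VS.

Lemma costableP W x : costable W -> x \in W -> coact C x \in tensv fullv W.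
Proof. by move=> /subvP cW xW; apply/cW/memv_img. Qed.

Lemma prodv_ext (W : vectType k) (f g : 'Hom(C, W)) X Y x :
  (forall u v, u \in X -> v \in Y -> f (u * v) = g (u * v)) ->
  x \in (X * Y)%VS -> f x = g x.
Proof.
move=> e xXY; apply/eqP; rewrite -subr_eq0 -opp_lfunE -add_lfunE -memv_ker.
apply: subvP xXY; apply/prodvP => u v uX vY.
by rewrite memv_ker add_lfunE opp_lfunE e ?subrr.
Qed.

Lemma costable_prod X Y : costable X -> costable Y -> costable (X * Y)%VS.
Proof.
move=> cX cY; apply/subvP => _ /memv_imgP[x xXY ->].
rewrite memv_preim; apply: subvP xXY; apply/prodvP => u v uX vY.
rewrite -memv_preim coactM.
apply: (tensv_tlift_memv _ (costableP cX uX)) => [|g u0 _ u0X]; first by bilin.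
apply: (tensv_tlift_memv _ (costableP cY vY)) => [|h v0 _ v0Y]; first by bilin.
by apply: tpure_in_tensv; rewrite ?memvf ?memv_mul.
Qed.

(** Turns membership in a product of subspaces into the tensors that a Morita context takes as
    data. *)
Lemma prodv_pairs X Y x : x \in (X * Y)%VS ->
  exists t : tens (subvs_of X) (subvs_of Y), \tsum_(u, v <- t) (vsval u * vsval v) = x.
Proof.
pose f (t : tens (subvs_of X) (subvs_of Y)) : C := \tsum_(u, v <- t) (vsval u * vsval v).
have lf : linear f by rewrite /f; move=> a u v; rewrite linearP.
suff /subvP s : (X * Y <= limg (linfun f))%VS.
  by move=> /s /memv_imgP[t _]; rewrite linfunE // => ->; exists t.
apply/prodvP => u v uX vY.
have -> : u * v = linfun f (vsproj X u ⊗ vsproj Y v); last by rewrite memv_img ?memvf.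
rewrite linfunE // /f tlift_pure ?vsprojK //.
split=> z a x' y'; first by rewrite linearP mulrDl scalerAl.
by rewrite linearP mulrDr scalerAr.
Qed.

Lemma tmap_ker (U V : vectType k) (f : 'Hom(U, V)) (t : tens H U) :
  tmap (\1%VF : 'End(H)) f t = 0 -> t \in tensv fullv (lker f).
Proof.
(* [e] projects U onto the kernel of [f], and tensoring it with the identity fixes t because t is
   killed by [f]. *)
move=> ft0; pose e : 'End(U) := \1%VF - (f^-1 \o f)%VF.
have <- : tmap (\1%VF : 'End(H)) e t = t.
  transitivity (t - tmap \1%VF (f^-1)%VF (tmap (\1%VF : 'End(H)) f t)); last first.
    by rewrite ft0 linear0 subr0.
  move: {ft0} t; apply: tens_ext => [|c x y|h x]; first by lin.
    by rewrite !linearP /= scalerDr addrACA.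
  rewrite !tmap_pure !id_lfunE /e add_lfunE opp_lfunE id_lfunE comp_lfunE.
  by rewrite linearB.
apply: tmap_sub (tensvf t); rewrite ?subvf //.
apply/subvP => _ /memv_imgP[x _ ->].
rewrite memv_ker /e add_lfunE opp_lfunE id_lfunE comp_lfunE linearB /=.
by rewrite limg_lfunVK ?subrr // memv_img ?memvf.
Qed.

Section Preimage.
Variables (U : vectType k) (j : 'Hom(U, C)) (d : 'Hom(U, tens H U)).
Hypothesis jc : forall x, tmap \1%VF j (d x) = coact C (j x).

Lemma limg_costable : costable (limg j).
Proof.
apply/subvP => _ /memv_imgP[_ /memv_imgP[x _ ->] ->]; rewrite -jc.
by apply: tmap_sub (tensvf _); rewrite ?subvf ?subvv.
Qed.

Lemma lker_costable : (d @: lker j <= tensv (fullv : {vspace H}) (lker j))%VS.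
Proof.
apply/subvP => _ /memv_imgP[x xk ->]; apply: tmap_ker; rewrite jc.
by move: xk; rewrite memv_ker => /eqP ->; rewrite linear0.
Qed.

Lemma preim_costable W : lker j == 0%VS -> (W <= limg j)%VS -> costable W ->
  (d @: (j @^-1: W) <= tensv (fullv : {vspace H}) (j @^-1: W))%VS.
Proof.
move=> j0 Wj cW; apply/subvP => _ /memv_imgP[x xW ->].
have <- : tmap \1%VF (j^-1)%VF (tmap (\1%VF : 'End(H)) j (d x)) = d x.
  exact: (tmapK (@id_lfunK _ _) (lker0_lfunK j0)).
rewrite jc; apply: (tmap_sub _ _ (costableP cW _)); rewrite ?subvf //; last first.
  by rewrite memv_preim.
apply/subvP => _ /memv_imgP[y yW ->].
by rewrite -memv_preim limg_lfunVK // (subvP Wj).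
Qed.

End Preimage.

Section Restriction.
Variable W : {vspace C}.
Hypothesis cW : costable W.

Definition subvs_incl : 'Hom(subvs_of W, C) := linfun vsval.
Definition subvs_coact : 'Hom(subvs_of W, tens H (subvs_of W)) :=
  linfun (fun x => tmap \1%VF (linfun (vsproj W)) (coact C (vsval x))).

Lemma subvs_inclE x : subvs_incl x = vsval x.
Proof. by rewrite lfunE. Qed.

Lemma lker_subvs_incl : lker subvs_incl == 0%VS.
Proof. by apply/lker0P => x y; rewrite !subvs_inclE => /val_inj. Qed.

Lemma limg_subvs_incl : limg subvs_incl = W.
Proof.
apply/vspaceP => x; apply/memv_imgP/idP => [[y _ ->]|xW].
  by rewrite subvs_inclE subvsP.
by exists (vsproj W x); rewrite ?memvf // subvs_inclE vsprojK.
Qed.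

Lemma subvs_coactE x : tmap \1%VF subvs_incl (subvs_coact x) = coact C (subvs_incl x).
Proof.
have l : linear (fun x : subvs_of W =>
    tmap (\1%VF : 'End(H)) (linfun (vsproj W)) (coact C (vsval x))).
  by move=> a u v; rewrite !linearP.
rewrite /subvs_coact (linfunE l) tmap_comp comp_lfun1l subvs_inclE.
transitivity (tmap (\1%VF : 'End(H)) (\1%VF : 'End(C)) (coact C (vsval x))); last exact: tmap1.
apply: tensv_ext (costableP cW (subvsP x)) => h y _ yW.
by rewrite !tmap_pure comp_lfunE !id_lfunE subvs_inclE lfunE /= vsprojK.
Qed.

End Restriction.

End CostableSubspaces.

Section Corner.
Variables (k : fieldType) (H : hopfAlg k) (C A : comodAlg H).
Variables (jA : 'Hom(A, C)) (jH : 'Hom(H, C)).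
Hypothesis simpleA : right_simple A.
Hypothesis jAM : forall x y : A, jA (x * y) = jA x * jA y.
Hypothesis jAc : forall x, tmap \1%VF jA (coact A x) = coact C (jA x).
Hypothesis jHM : forall x y : H, jH (x * y) = jH x * jH y.
Hypothesis jHc : forall x, tmap \1%VF jH (comul H x) = coact C (jH x).
Hypothesis jH_inj : lker jH == 0%VS.
Hypothesis jH_corner : forall x, jH 1 * x * jH 1 \in limg jH.
Variables (P0 Q0 : {vspace C}).
Hypotheses (cP0 : costable P0) (cQ0 : costable Q0).
Hypothesis QPA0 : (Q0 * P0 <= limg jA)%VS.
Hypothesis PQ1 : jH 1 \in (P0 * Q0)%VS.
Hypothesis P0l : forall x, x \in P0 -> jH 1 * x = x.
Hypothesis P0r : forall x, x \in P0 -> x * jA 1 = x.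
Hypothesis Q0l : forall x, x \in Q0 -> jA 1 * x = x.
Hypothesis Q0r : forall x, x \in Q0 -> x * jH 1 = x.

Let J : {vspace C} := limg jA.
Let P := (P0 * J)%VS.
Let Q := (J * Q0)%VS.
(** This is P0 J Q0. The product P Q = P0 J J Q0 lies in it as well, since J is closed under
    multiplication. *)
Let L := (P * Q0)%VS.

Let JJ : (J * J <= J)%VS.
Proof.
apply/prodvP => _ _ /memv_imgP[x _ ->] /memv_imgP[y _ ->].
by rewrite -jAM memv_img ?memvf.
Qed.

Let cJ : costable J. Proof. exact: limg_costable jAc. Qed.
Let cP : costable P. Proof. exact: costable_prod. Qed.
Let cQ : costable Q. Proof. exact: costable_prod. Qed.
Let cL : costable L. Proof. exact: costable_prod. Qed.

Let P0P : (P0 <= P)%VS.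
Proof.
by apply/subvP => x xP; rewrite -(P0r xP) memv_mul ?memv_img ?memvf.
Qed.

Let PJ : (P * J <= P)%VS. Proof. by rewrite -prodvA prodvSr. Qed.
Let JQ : (J * Q <= Q)%VS. Proof. by rewrite prodvA prodvSl. Qed.

Let QP : (Q * P <= J)%VS.
Proof.
rewrite /Q /P -prodvA (prodvA Q0).
apply: subv_trans JJ; apply: prodvSr; apply: subv_trans JJ; exact: prodvSl.
Qed.

Let PQ : (P * Q <= L)%VS. Proof. by rewrite /Q prodvA prodvSl. Qed.

Let LP : (L * P <= P)%VS.
Proof.
rewrite /L -prodvA; apply: subv_trans PJ; apply: prodvSr.
apply: subv_trans QP; apply: prodvSl.
by apply/subvP => x xQ; rewrite -(Q0l xQ) memv_mul ?memv_img ?memvf.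
Qed.

Let QL : (Q * L <= Q)%VS.
Proof. by rewrite /L prodvA prodvSl. Qed.

Let LL : (L * L <= L)%VS.
Proof. by rewrite {2}/L prodvA; apply: prodvSl. Qed.

Let Pl x : x \in P -> jH 1 * x = x.
Proof.
move=> xP; transitivity (amull (jH 1) x); first by rewrite lfunE.
rewrite -[RHS]id_lfunE; apply: prodv_ext xP => u v uP vJ.
by rewrite lfunE id_lfunE /= mulrA P0l.
Qed.

Let Pr x : x \in P -> x * jA 1 = x.
Proof.
move=> xP; transitivity (amulr (jA 1) x); first by rewrite lfunE.
rewrite -[RHS]id_lfunE; apply: prodv_ext xP => u _ uP /memv_imgP[v _ ->].
by rewrite lfunE id_lfunE /= -mulrA -jAM mulr1.
Qed.

Let Ql x : x \in Q -> jA 1 * x = x.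
Proof.
move=> xQ; transitivity (amull (jA 1) x); first by rewrite lfunE.
rewrite -[RHS]id_lfunE; apply: prodv_ext xQ => _ v /memv_imgP[u _ ->] vQ.
by rewrite lfunE id_lfunE /= mulrA -jAM mul1r.
Qed.

Let Qr x : x \in Q -> x * jH 1 = x.
Proof.
move=> xQ; transitivity (amulr (jH 1) x); first by rewrite lfunE.
rewrite -[RHS]id_lfunE; apply: prodv_ext xQ => u v _ vQ.
by rewrite lfunE id_lfunE /= -mulrA Q0r.
Qed.

(** Left and right multiplication by the idempotent [jH 1] fix P and Q0, so L lies in the corner cut
    out by it, which is contained in the copy of H. *)
Let LH : (L <= limg jH)%VS.
Proof.
apply/prodvP => u v uP vQ.
by have := jH_corner (u * v); rewrite mulrA -mulrA Pl // Q0r.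
Qed.

Let jH_eq0 x : (jH x == 0) = (x == 0).
Proof. by rewrite -(inj_eq (lker0P jH_inj)) linear0. Qed.

Let jH1_neq0 : jH 1 != 0.
Proof. by rewrite jH_eq0 oner_neq0. Qed.

(** The kernel is a right ideal and a subcomodule, so it is 0 or A. In the second case [jA 1 = 0],
    which kills Q0 and contradicts that the nonzero [jH 1] lies in P0 Q0. *)
Let jA_inj : lker jA == 0%VS.
Proof.
have ri : right_ideal (lker jA).
  by move=> a x; rewrite !memv_ker jAM => /eqP ->; rewrite mul0r.
case: (simpleA ri (lker_costable jAc)) => [-> //|ker_full].
case/negP: jH1_neq0; have /eqP jA1 : jA 1 == 0 by rewrite -memv_ker ker_full memvf.
have Q00 x : x \in Q0 -> x = 0 by move/Q0l => <-; rewrite jA1 mul0r.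
move: PQ1; suff -> : Q0 = 0%VS by rewrite prodv0 memv0.
by apply/eqP; rewrite -subv0; apply/subvP => x /Q00 ->; rewrite mem0v.
Qed.

(** The preimage of Q P is a right ideal and a subcomodule of A. Were it 0, then Q0 P0 = 0, while
    [jH 1], being idempotent, lies in P0 (Q0 P0) Q0 and is nonzero. *)
Let jA1_QP : jA 1 \in (Q * P)%VS.
Proof.
have ri : right_ideal (jA @^-1: (Q * P)).
  move=> a x; rewrite -!memv_preim jAM => xQP.
  have /subvP := prodvSr Q PJ; apply; rewrite prodvA.
  by rewrite memv_mul ?memv_img ?memvf.
have cQP := costable_prod cQ cP.
case: (simpleA ri (preim_costable jAc jA_inj QP cQP)) => [pre0|pre_full]; last first.
  by rewrite memv_preim pre_full memvf.
case/negP: jH1_neq0.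
have QP0 : (Q0 * P0 = 0)%VS.
  apply/eqP; rewrite -subv0 -(limg0 jA) -pre0 lpreimK //.
  apply: prodvS => //; apply/subvP => x xQ.
  by rewrite -(Q0l xQ) memv_mul ?memv_img ?memvf.
have := memv_mul PQ1 PQ1; rewrite -jHM mulr1 prodvA -(prodvA P0) QP0.
by rewrite prodv0 prod0v memv0.
Qed.

Let LH' : {vspace H} := (jH @^-1: L)%VS.

Let LH1 : 1 \in LH'.
Proof. by rewrite -memv_preim (subvP (prodvSl Q0 P0P)). Qed.

Let LH_aspace : is_aspace LH'.
Proof.
rewrite /is_aspace has_algid1 //=; apply/prodvP => x y xL yL.
by rewrite -memv_preim jHM (subvP LL) // memv_mul // memv_preim.
Qed.

Let LH_coideal : (comul H @: ASpace LH_aspace <= tensv (fullv : {vspace H}) (ASpace LH_aspace))%VS.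
Proof. exact: preim_costable jHc _ jH_inj LH cL. Qed.

Definition corner_subalg : lcoidealSubalg H :=
  @LCoidealSubalg k H (ASpace LH_aspace) LH1 LH_coideal.

Let B : comodAlg H := lcs_comodAlg corner_subalg.
Let inc : 'Hom(B, H) := linfun (vsval : subvs_of corner_subalg -> H).
Let jL : 'Hom(B, C) := (jH \o inc)%VF.

Let incE x : inc x = vsval (x : subvs_of corner_subalg).
Proof. by rewrite lfunE. Qed.

Let jLE x : jL x = jH (inc x).
Proof. by rewrite comp_lfunE. Qed.

Let inc1 : inc 1 = 1.
Proof.
have e : algid corner_subalg = 1 by apply/eqP; rewrite algid_eq1 (lcs1 corner_subalg).
by rewrite incE -[RHS]e.
Qed.

Let jLM (x y : B) : jL (x * y) = jL x * jL y.
Proof. by rewrite !jLE -jHM; congr (jH _); rewrite !incE. Qed.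

Let jL_inj : lker jL == 0%VS.
Proof.
apply/lker0P => x y; rewrite !jLE => /(lker0P jH_inj).
by rewrite !incE => /val_inj.
Qed.

Let jLc x : tmap \1%VF jL (coact B x) = coact C (jL x).
Proof.
rewrite jLE -jHc incE.
have := lcs_coactK (x : subvs_of corner_subalg) => /= <-.
rewrite linear_tlift tmapE; apply: eq_tlift => h y.
by rewrite /= tmap_pure id_lfunE jLE incE.
Qed.

Let limg_jL : limg jL = L.
Proof.
apply/vspaceP => x; apply/memv_imgP/idP => [[y _ ->]|xL].
  by rewrite jLE incE memv_preim (subvsP (y : subvs_of corner_subalg)).
have /memv_imgP[h _ xE] := subvP LH x xL.
exists (vsproj corner_subalg h); rewrite ?memvf // jLE incE vsprojK -?xE //.
by rewrite -memv_preim -xE.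
Qed.

Let jL1 : jL 1 = jH 1. Proof. by rewrite jLE inc1. Qed.

Let bimQ : bimod jA jL.
Proof.
apply: (@Bimod _ _ _ _ _ _ (subvs_of Q) (subvs_incl Q)) => [|a q|q b|q|q].
- exact: lker_subvs_incl.
- rewrite limg_subvs_incl subvs_inclE (subvP JQ) // memv_mul ?subvsP //.
  by rewrite memv_img ?memvf.
- rewrite limg_subvs_incl subvs_inclE (subvP QL) // memv_mul ?subvsP //.
  by rewrite -limg_jL memv_img ?memvf.
- by rewrite subvs_inclE Ql ?subvsP.
- by rewrite subvs_inclE jL1 Qr ?subvsP.
Defined.

Let bimP : bimod jL jA.
Proof.
apply: (@Bimod _ _ _ _ _ _ (subvs_of P) (subvs_incl P)) => [|b p|p a|p|p].
- exact: lker_subvs_incl.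
- rewrite limg_subvs_incl subvs_inclE (subvP LP) // memv_mul ?subvsP //.
  by rewrite -limg_jL memv_img ?memvf.
- rewrite limg_subvs_incl subvs_inclE (subvP PJ) // memv_mul ?subvsP //.
  by rewrite memv_img ?memvf.
- by rewrite subvs_inclE jL1 Pl ?subvsP.
- by rewrite subvs_inclE Pr ?subvsP.
Defined.

Lemma corner_morita : morita_equiv A B.
Proof.
have [t tE] := prodv_pairs jA1_QP.
have [s sE] : exists s : tens (subvs_of P) (subvs_of Q),
    \tsum_(p, q <- s) (vsval p * vsval q) = jH 1.
  apply: prodv_pairs; suff /subvP le : (P0 * Q0 <= P * Q)%VS by exact: le PQ1.
  apply: prodvS => //; apply/subvP => x xQ; by rewrite -(Q0l xQ) memv_mul ?memv_img ?memvf.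
apply: (@morita_context_equiv k H C A B jA jL jAM jLM jA_inj jL_inj jAc jLc bimQ bimP _ _
  (subvs_coact Q) (subvs_coact P) _ _ t s) => [q p|p q|x|x||].
- by rewrite !subvs_inclE (subvP QP) // memv_mul ?subvsP.
- by rewrite !subvs_inclE limg_jL (subvP PQ) // memv_mul ?subvsP.
- exact: subvs_coactE.
- exact: subvs_coactE.
- by rewrite -tE; apply: eq_tlift => q p; rewrite !subvs_inclE.
- by rewrite jL1 -sE; apply: eq_tlift => q p; rewrite !subvs_inclE.
Qed.

End Corner.

(** * Matrix contexts *)

Section MatrixContext.
Variables (k : fieldType) (H0 H : hopfAlg k) (iota : 'Hom(H0, H)).
Hypothesis iotaM : forall x y : H0, iota (x * y) = iota x * iota y.
Hypothesis iota1 : iota 1 = 1.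
Hypothesis iotac : forall x, comul H (iota x) = tmap iota iota (comul H0 x).
Variables (A : comodAlg H) (A0 : comodAlg H0) (i : 'Hom(A0, A)) (pr : 'Hom(A, A0)).
Hypothesis ic : forall a, coact A (i a) = tmap iota i (coact A0 a).
Hypothesis prM : forall x y : A, pr (x * y) = pr x * pr y.
Hypothesis pr1 : pr 1 = 1.
Hypothesis prK : cancel i pr.
Hypothesis simpleA : right_simple A.

Variables (M : lmodule A0) (P Q : vectType k) (f : 'Hom(P, 'Hom(M, H0)))
  (g : 'Hom(Q, tens H0 M)) (dP : 'Hom(P, tens H0 P)) (dQ : 'Hom(Q, tens H0 Q)).
Hypothesis fc : forall p m, comul H0 (f p m) = \tsum_(h, p0 <- dP p) (h ⊗ f p0 m).
Hypothesis gc : forall q,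
  \tsum_(h, m <- g q) \tsum_(h1, h2 <- comul H0 h) (h1 ⊗ (h2 ⊗ m))
  = \tsum_(h, q0 <- dQ q) (h ⊗ g q0).
Hypothesis gf : forall p q, exists a : A0, forall m,
  \tsum_(h, a0 <- coact A0 a) (h ⊗ lact M a0 m)
  = \tsum_(h, m' <- g q) ((h * f p m) ⊗ m').
Variable t : tens P Q.
Hypothesis fg1 : \tsum_(p, q <- t) \tsum_(h, m <- g q) (f p m * h) = 1.

Local Notation n := (dim M).
(* Index 0 is the corner in which L lives; the other indices are the coordinates
   of M. *)
Let S : falgType k := 'M[k]_n.+1.
Let C : comodAlg H := talg_comodAlg H S.
Let e (j : 'I_n) : M := r2v (delta_mx 0 j).
Let e00 : S := delta_mx 0 0.
Let row (j : 'I_n) : S := delta_mx 0 (lift ord0 j).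
Let col_fun (m : M) : S := \sum_j v2r m 0 j *: delta_mx (lift ord0 j) 0.

Let col_fun_linear : linear col_fun.
Proof.
move=> c x y; rewrite /col_fun scaler_sumr -big_split /=; apply: eq_bigr => j _.
by rewrite linearP !mxE scalerDl scalerA.
Qed.

Let col : 'Hom(M, S) := linfun col_fun.

Let colE m : col m = \sum_j v2r m 0 j *: delta_mx (lift ord0 j) 0.
Proof. exact: (linfunE col_fun_linear). Qed.

Let e00_idem : e00 * e00 = e00.
Proof. exact: mul_delta_mx. Qed.

Let e00_row j : e00 * row j = row j.
Proof. exact: mul_delta_mx. Qed.

Let col_e00 m : col m * e00 = col m.
Proof.
rewrite colE mulr_suml; apply: eq_bigr => j _.
by rewrite -scalerAl; congr (_ *: _); apply: mul_delta_mx.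
Qed.

Let row_col j m : row j * col m = v2r m 0 j *: e00.
Proof.
rewrite colE mulr_sumr (bigD1 j) //= big1 => [|j' j'j].
  by rewrite addr0 -scalerAr; congr (_ *: _); apply: mul_delta_mx.
rewrite -scalerAr [_ * _](mul_delta_mx_0) ?scaler0 //.
by rewrite (inj_eq lift_inj) eq_sym.
Qed.

Let e00_neq0 : e00 != 0.
Proof.
by apply/eqP => /matrixP/(_ 0 0); rewrite !mxE !eqxx; apply/eqP/oner_neq0.
Qed.

Let corner_e00 (x : S) : e00 * x * e00 = (x : 'M_n.+1) 0 0 *: e00.
Proof.
apply/matrixP => a b; rewrite [LHS]mxE (bigD1 0) //= big1 => [|c c0]; last first.
  by rewrite [e00 c b]mxE (negPf c0) mulr0.
rewrite addr0 [X in X * _]mxE (bigD1 0) //= big1 => [|c c0]; last first.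
  by rewrite [e00 a c]mxE (negPf c0) andbF mul0r.
by rewrite addr0 !mxE eqxx andbT /=; case: eqP; case: eqP; rewrite ?mul0r ?mulr0 ?mul1r ?mulr1.
Qed.

(** The action on M as a block away from index 0; hence [rho 1] is an idempotent orthogonal to [e00]
    and not the unit matrix. *)
Let rho_fun (a : A0) : S := \sum_j col (lact M a (e j)) * row j.

Let rho_fun_linear : linear rho_fun.
Proof.
move=> c x y; rewrite /rho_fun scaler_sumr -big_split /=; apply: eq_bigr => j _.
by rewrite linearP add_lfunE scale_lfunE linearP mulrDl -scalerAl.
Qed.

Let rho : 'Hom(A0, S) := linfun rho_fun.

Let rhoE a : rho a = \sum_j col (lact M a (e j)) * row j.
Proof. exact: (linfunE rho_fun_linear). Qed.

Let rho_col a m : rho a * col m = col (lact M a m).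
Proof.
rewrite rhoE mulr_suml {2}(r2v_basis m) !linear_sum; apply: eq_bigr => j _.
by rewrite -mulrA row_col -scalerAr col_e00 !linearZ.
Qed.

Let rhoM a b : rho (a * b) = rho a * rho b.
Proof.
rewrite [rho b]rhoE mulr_sumr rhoE; apply: eq_bigr => j _.
by rewrite (lactP M).2 mulrA rho_col.
Qed.

Let row_rho1 j : row j * rho 1 = row j.
Proof.
rewrite rhoE mulr_sumr (bigD1 j) //= big1 => [|j' j'j].
  by rewrite (lactP M).1 mulrA row_col r2vK mxE !eqxx scale1r e00_row addr0.
by rewrite (lactP M).1 mulrA row_col r2vK mxE eqxx eq_sym (negPf j'j) scale0r mul0r.
Qed.

Let pureM (x y : H) (u v : S) : (x ⊗ u : C) * (y ⊗ v : C) = ((x * y) ⊗ (u * v) : C).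
Proof. exact: talg_pureM. Qed.

Let coactC_pure (h : H) (x : S) : coact C (h ⊗ x : C) =
  \tsum_(h1, h2 <- comul H h) (h1 ⊗ (h2 ⊗ x : C)).
Proof. exact: talg_coact_pure. Qed.

Let jH : 'Hom(H, C) := linfun (fun h : H => (h ⊗ e00 : C)).

Let jHE h : jH h = h ⊗ e00.
Proof. by rewrite linfunE //; lin. Qed.

Let jHM (x y : H) : jH (x * y) = jH x * jH y.
Proof. by rewrite !jHE pureM e00_idem. Qed.

Let jHc x : tmap \1%VF jH (comul H x) = coact C (jH x).
Proof.
rewrite jHE coactC_pure tmapE; apply: eq_tlift => h1 h2.
by rewrite id_lfunE jHE.
Qed.

Let jH_inj : lker jH == 0%VS.
Proof.
rewrite -subv0; apply/subvP => h; rewrite memv_ker jHE memv0.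
by apply: contraTT => h0; apply: tpure_eq0.
Qed.

Let jH_corner x : jH 1 * x * jH 1 \in limg jH.
Proof.
have lq : linear (fun x : C => jH 1 * x * jH 1) by lin.
have <- := linfunE lq x; rewrite memv_preim.
have <- := @tlift_id _ H S x; apply: tlift_memv => h u; rewrite -memv_preim (linfunE lq).
by rewrite !jHE !pureM corner_e00 mul1r mulr1 linearZ /= -jHE memvZ ?memv_img ?memvf.
Qed.

(** The representation a |-> a_(-1) (x) [rho (pr a_(0))]: the inflated module M is combined with the
    coaction so that the result is a map of H-comodule algebras. *)
Let jA : 'Hom(A, C) := (tmap (\1%VF : 'End(H)) (rho \o pr) \o coact A)%VF.

Let jAE a : jA a = \tsum_(h, a0 <- coact A a) (h ⊗ rho (pr a0) : C).
Proof.
rewrite /jA comp_lfunE tmapE; apply: eq_tlift => h a0.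
by rewrite id_lfunE comp_lfunE.
Qed.

Let jAM (x y : A) : jA (x * y) = jA x * jA y.
Proof.
rewrite !jAE coactM linear_tlift.
have l (c : C) : linear (fun x : C => x * c) by lin.
rewrite -[RHS]/(lin_of (l _) _) linear_tlift; apply: eq_tlift => h a0.
rewrite /= tlift_tlift; last by bilin.
have l' (c : C) : linear (fun x : C => c * x) by lin.
rewrite -[RHS]/(lin_of (l' _) _) linear_tlift; apply: eq_tlift => h' b0.
by rewrite /= pureM prM rhoM.
Qed.

(** Coassociativity of A: H coacts on C through the first tensor factor, while [rho \o pr] touches
    the second. *)
Let jAc x : tmap \1%VF jA (coact A x) = coact C (jA x).
Proof.
pose Phi : tens H (tens H A) -> tens H C :=
  tlift (fun h s => h ⊗ (\tsum_(h', a0 <- s) (h' ⊗ rho (pr a0) : C))).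
have lPhi : linear Phi by rewrite /Phi; lin.
have := congr1 (lin_of lPhi) ((coactP A).1 x); rewrite !linear_tlift /= => E.
transitivity (\tsum_(h, a0 <- coact A x) lin_of lPhi (h ⊗ coact A a0)).
  rewrite tmapE; apply: eq_tlift => h a0; rewrite /= /Phi tlift_pure; last by bilin.
  by rewrite id_lfunE jAE.
rewrite -E jAE linear_tlift; apply: eq_tlift => h a0.
rewrite -[LHS]/(lin_of lPhi _) linear_tlift [RHS]coactC_pure; apply: eq_tlift => h1 h2.
rewrite /= /Phi tlift_pure; last by bilin.
by rewrite tlift_pure //; bilin.
Qed.

Let Pin_fun (p : P) : C := \sum_j (iota (f p (e j)) ⊗ row j).
Let Pin : 'Hom(P, C) := linfun Pin_fun.

Let PinE p : Pin p = \sum_j (iota (f p (e j)) ⊗ row j).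
Proof.
rewrite linfunE // => c x y; rewrite /Pin_fun scaler_sumr -big_split /=.
apply: eq_bigr => j _; rewrite linearP add_lfunE scale_lfunE linearP.
by rewrite tpureDl tpureZl.
Qed.

Let Qin : 'Hom(Q, C) := (tmap iota col \o g)%VF.

Let QinE q : Qin q = \tsum_(h, m <- g q) (iota h ⊗ col m : C).
Proof. by rewrite /Qin comp_lfunE tmapE. Qed.

Let mulC_tlift (U V : vectType k) (F : U -> V -> C) s (c : C) :
  tlift F s * c = \tsum_(u, v <- s) (F u v * c).
Proof.
have l : linear (fun x : C => x * c) by lin.
by rewrite -[LHS]/(lin_of l _) linear_tlift.
Qed.

Let mulC_tliftr (U V : vectType k) (F : U -> V -> C) s (c : C) :
  c * tlift F s = \tsum_(u, v <- s) (c * F u v).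
Proof.
have l : linear (fun x : C => c * x) by lin.
by rewrite -[LHS]/(lin_of l _) linear_tlift.
Qed.

Let PQin p q : Pin p * Qin q = jH (iota (\tsum_(h, m <- g q) (f p m * h))).
Proof.
rewrite QinE mulC_tliftr !linear_tlift; apply: eq_tlift => h m /=.
rewrite PinE mulr_suml jHE {2}(r2v_basis m) linear_sum mulr_suml linear_sum.
have l : linear (fun x : H => (x ⊗ e00 : C)) by lin.
rewrite -[RHS]/(lin_of l _) linear_sum; apply: eq_bigr => j _ /=.
rewrite pureM row_col -iotaM [LHS]linearZ /=.
by rewrite [f p (_ *: _)]linearZ /= -scalerAl [iota (_ *: _)]linearZ /= tpureZl.
Qed.

Let QPin p q : exists a, Qin q * Pin p = jA a.
Proof.
have lc j : linear (fun x => col x * row j).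
  by move=> c x y; rewrite linearP mulrDl -scalerAl.
(* For a in A0, [ic] and [prK] give [jA (i a)] = iota(a_(-1)) (x) rho(a_(0)), so the witness over H0
   serves over H once included in A. *)
have [a aE] := gf p q; exists (i a).
transitivity (\tsum_(h, a0 <- coact A0 a) (iota h ⊗ rho a0 : C)); last first.
  rewrite jAE ic tlift_tmap; last by bilin.
  by apply: eq_tlift => h a0; rewrite prK.
transitivity (\sum_j tmap iota (linfun (fun x => col x * row j))
    (\tsum_(h, m' <- g q) ((h * f p (e j)) ⊗ m'))).
  rewrite QinE PinE mulr_sumr; apply: eq_bigr => j _.
  rewrite mulC_tlift linear_tlift; apply: eq_tlift => h m /=.
  by rewrite pureM tmap_pure iotaM (linfunE (lc j)).
under eq_bigr => j _ do rewrite -aE linear_tlift.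
rewrite /tlift exchange_big; apply: eq_bigr => u _ /=.
rewrite exchange_big; apply: eq_bigr => v _ /=.
rewrite -scaler_sumr; congr (_ *: _); rewrite rhoE linear_sum; apply: eq_bigr => j _.
by rewrite tmap_pure (linfunE (lc j)).
Qed.

Let Pin_coact p :
  tmap \1%VF Pin ((tmap iota \1 \o dP)%VF p) = coact C (Pin p).
Proof.
rewrite comp_lfunE tmap_comp PinE linear_sum.
transitivity (\tsum_(h, p0 <- dP p) \sum_j (iota h ⊗ (iota (f p0 (e j)) ⊗ row j : C))).
  rewrite tmapE; apply: eq_tlift => h p0.
  by rewrite !comp_lfunE !id_lfunE PinE linear_sum.
transitivity (\sum_j \tsum_(h, p0 <- dP p) (iota h ⊗ (iota (f p0 (e j)) ⊗ row j : C))).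
  rewrite /tlift [RHS]exchange_big; apply: eq_bigr => u _ /=.
  by rewrite [RHS]exchange_big; apply: eq_bigr => v _ /=; rewrite -scaler_sumr.
apply: eq_bigr => j _; rewrite [RHS]coactC_pure iotac fc.
rewrite tlift_tmap; last by bilin.
by rewrite tlift_tlift //; bilin.
Qed.

Let Qin_coact q :
  tmap \1%VF Qin ((tmap iota \1 \o dQ)%VF q) = coact C (Qin q).
Proof.
rewrite comp_lfunE tmap_comp QinE linear_tlift.
have lF : linear (tmap iota (tmap iota col) : tens H0 (tens H0 M) -> tens H C) by lin.
have := congr1 (lin_of lF) (gc q); rewrite !linear_tlift /= => E.
transitivity (\tsum_(h, q0 <- dQ q) lin_of lF (h ⊗ g q0)).
  rewrite tmapE; apply: eq_tlift => h q0.
  by rewrite /= tmap_pure !comp_lfunE !id_lfunE.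
rewrite -E; apply: eq_tlift => h m.
rewrite /= [RHS]coactC_pure iotac linear_tlift tlift_tmap; last by bilin.
by apply: eq_tlift => h1 h2; rewrite /= !tmap_pure.
Qed.

Let jA1 : jA 1 = 1 ⊗ rho 1.
Proof. by rewrite jAE coact1 tlift_pure ?pr1 //; bilin. Qed.

Let jH1 : jH 1 = 1 ⊗ e00. Proof. exact: jHE. Qed.

Lemma matrix_context_morita : exists L : lcoidealSubalg H, morita_equiv A (lcs_comodAlg L).
Proof.
have QPA : (limg Qin * limg Pin <= limg jA)%VS.
  apply/prodvP => _ _ /memv_imgP[q _ ->] /memv_imgP[p _ ->].
  by have [a ->] := QPin p q; rewrite memv_img ?memvf.
have PQ1 : jH 1 \in (limg Pin * limg Qin)%VS.
  rewrite -iota1 -fg1 !linear_tlift; apply: tlift_memv => p q /=.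
  by rewrite -PQin memv_mul ?memv_img ?memvf.
have Pl x : x \in limg Pin -> jH 1 * x = x.
  move=> /memv_imgP[p _ ->]; rewrite PinE mulr_sumr; apply: eq_bigr => j _.
  by rewrite jH1 pureM mul1r e00_row.
have Pr x : x \in limg Pin -> x * jA 1 = x.
  move=> /memv_imgP[p _ ->]; rewrite PinE mulr_suml; apply: eq_bigr => j _.
  by rewrite jA1 pureM mulr1 row_rho1.
have Ql x : x \in limg Qin -> jA 1 * x = x.
  move=> /memv_imgP[q _ ->]; rewrite QinE mulC_tliftr; apply: eq_tlift => h m.
  by rewrite jA1 pureM mul1r rho_col (lactP M).1.
have Qr x : x \in limg Qin -> x * jH 1 = x.
  move=> /memv_imgP[q _ ->]; rewrite QinE mulC_tlift; apply: eq_tlift => h m.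
  by rewrite jH1 pureM mulr1 col_e00.
eexists; exact: (corner_morita simpleA jAM jAc jHM jHc jH_inj jH_corner
  (limg_costable Pin_coact) (limg_costable Qin_coact) QPA PQ1 Pl Pr Ql Qr).
Qed.

End MatrixContext.

(** * The degree zero component *)

Section Gradings.
Variable k : fieldType.

Lemma grading_positive_part (V : vectType k) (gr : nat -> {vspace V}) :
  is_grading gr -> exists N, let W := (\sum_(j < N.+1 | j != ord0) gr j)%VS in
  [/\ (gr 0%N :&: W = 0)%VS, (gr 0%N + W = fullv)%VS
    & forall m, (0 < m)%N -> (gr m <= W)%VS].
Proof.
(* The range [N.+1] guarantees that index 0 occurs even if N = 0. *)
move=> [dgr [N Nfull]]; exists N => W.
have Sfull : (\sum_(j < N.+1) gr j)%VS = fullv.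
  apply/eqP; rewrite eqEsubv subvf /= -Nfull; apply/subv_sumP => i _.
  by apply: (sumv_sup (widen_ord (leqnSn N) i)).
split.
- exact: (elimT directv_sumP (dgr N.+1) ord0 isT).
- by rewrite -Sfull [in RHS](bigD1 ord0).
move=> m m0; case: (ltnP m N.+1) => mN.
  by apply: (sumv_sup (Ordinal mN)); rewrite // -val_eqE /= -lt0n.
(* Past N the earlier components already fill V, so directness up to m forces [gr m] to be 0. *)
have := elimT directv_sumP (dgr m.+1) ord_max isT.
have -> : (\sum_(j < m.+1 | true && (j != ord_max)) gr j)%VS = fullv.
  apply/eqP; rewrite eqEsubv subvf /= -Sfull; apply/subv_sumP => i _.
  have im : (i < m)%N by apply: leq_trans mN.
  apply: (sumv_sup (Ordinal (leq_trans im (leqnSn m)))) => //=.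
  by rewrite -val_eqE /= ltn_eqF.
by rewrite capvf /= => ->; rewrite sub0v.
Qed.

(** [W] is the sum of the positive degrees, a two-sided ideal complementary to degree 0; [p] is the
    projection along it. *)
Lemma alg_grading_proj (A : falgType k) (gr : nat -> {vspace A}) :
  is_alg_grading gr -> exists (p : 'End(A)) (W : {vspace A}),
  [/\ forall x, p x \in gr 0%N, forall x, x \in gr 0%N -> p x = x,
      forall w, w \in W -> p w = 0, forall x, x - p x \in W
    & forall x w, w \in W -> x * w \in W /\ w * x \in W].
Proof.
move=> [gr_gr gr1 grM]; have [N [dW SW grW]] := grading_positive_part gr_gr.
set W := (\sum_(j < N.+1 | j != ord0) gr j)%VS in dW SW grW.
pose p := daddv_pi (gr 0%N) W; exists p, W.
have p0 x : p x \in gr 0%N by apply: memv_pi.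
have pW x : x - p x \in W.
  have xS : x \in (gr 0%N + W)%VS by rewrite SW memvf.
  by rewrite -{1}(daddv_pi_add dW xS) addrC addKr memv_pi.
have Sfull : (\sum_(j < N.+1) gr j)%VS = fullv by rewrite (bigD1 ord0).
have Wl : (fullv * W <= W)%VS.
  rewrite -{1}Sfull big_distrl; apply/subv_sumP => i _ /=.
  rewrite big_distrr; apply/subv_sumP => j j0 /=.
  apply: subv_trans (grM i j) (grW _ _).
  by rewrite addn_gt0 (lt0n j) -[_ != 0%N]/(j != ord0) j0 orbT.
have Wr : (W * fullv <= W)%VS.
  rewrite -{1}Sfull big_distrr; apply/subv_sumP => i _ /=.
  rewrite big_distrl; apply/subv_sumP => j j0 /=.
  apply: subv_trans (grM j i) (grW _ _).
  by rewrite addn_gt0 (lt0n j) -[_ != 0%N]/(j != ord0) j0.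
split=> //.
- by move=> x x0; apply: daddv_pi_id.
- move=> w wW; apply/eqP; rewrite -memv0 -dW memv_cap p0 /=.
  by rewrite -(subKr w (p w)) rpredB ?pW.
- by move=> x w wW; split; [apply: (subvP Wl)|apply: (subvP Wr)]; rewrite memv_mul ?memvf.
Qed.

Lemma alg_grading_projM (A : falgType k) (gr : nat -> {vspace A}) (p : 'End(A))
    (W : {vspace A}) :
  is_alg_grading gr ->
  (forall x, p x \in gr 0%N) -> (forall x, x \in gr 0%N -> p x = x) ->
  (forall w, w \in W -> p w = 0) -> (forall x, x - p x \in W) ->
  (forall x w, w \in W -> x * w \in W /\ w * x \in W) ->
  forall x y, p (x * y) = p x * p y.
Proof.
move=> [_ _ grM] p0 pid pW0 pW idW x y.
rewrite -[in LHS](subrK (p x) x) mulrDl linearD /= pW0 ?add0r; last first.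
  by case: (idW y _ (pW x)).
rewrite -[in LHS](subrK (p y) y) mulrDr linearD /= pW0 ?add0r; last first.
  by case: (idW (p x) _ (pW y)).
by apply: pid; apply: (subvP (grM 0%N 0%N)); rewrite memv_mul.
Qed.

End Gradings.

Section ZeroComponent.
Variables (k : fieldType) (H0 H : hopfAlg k) (iota : 'Hom(H0, H)).
Hypothesis iotaM : forall x y : H0, iota (x * y) = iota x * iota y.
Hypothesis iota1 : iota 1 = 1.
Hypothesis iotac : forall x, comul H (iota x) = tmap iota iota (comul H0 x).
Hypothesis iotae : forall x, counit H (iota x) = counit H0 x.
Hypothesis iota_inj : lker iota == 0%VS.
Variables (A : comodAlg H) (E : {aspace A}).
Hypothesis E1 : 1 \in E.
Hypothesis cE : (coact A @: E <= tensv (limg iota) E)%VS.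

Let T : falgType k := subvs_of E.
Let inc : 'Hom(T, A) := linfun (vsval : subvs_of E -> A).
Let prj : 'Hom(A, T) := linfun (vsproj E).

Let incE x : inc x = vsval (x : subvs_of E). Proof. by rewrite lfunE. Qed.

Let incK : cancel inc prj.
Proof. by move=> x; rewrite !lfunE /= vsvalK. Qed.

Let prjK x : x \in E -> inc (prj x) = x.
Proof. by move=> xE; rewrite !lfunE /= vsprojK. Qed.

Let inc_mem x : inc x \in E. Proof. by rewrite incE (subvsP (x : subvs_of E)). Qed.

Let inc1 : inc 1 = 1.
Proof. by rewrite lfunE /=; apply/eqP; rewrite algid_eq1 E1. Qed.

Let incM x y : inc (x * y) = inc x * inc y.
Proof. by rewrite !lfunE. Qed.

Let iotaK : cancel iota (iota^-1)%VF. Proof. exact: lker0_lfunK. Qed.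

(** The linear inverse of [iota] is a true inverse on [limg iota], where [cE] places the first leg
    of the coaction on E. *)
Definition zero_coact : 'Hom(T, tens H0 T) :=
  (tmap (iota^-1)%VF prj \o (coact A \o inc))%VF.

Lemma zero_coact_in x : tmap iota inc (zero_coact x) = coact A (inc x).
Proof.
rewrite /zero_coact !comp_lfunE -[LHS]comp_lfunE -[RHS]id_lfunE.
apply: (@tensv_ext _ _ _ _ (limg iota) E) => [h y|].
  move=> hi yE; rewrite comp_lfunE !tmap_pure id_lfunE.
  by rewrite (limg_lfunVK hi) prjK.
by apply: (subvP cE); rewrite memv_img.
Qed.

Lemma zero_coactP : is_coaction zero_coact.
Proof.
have [C1 C2] := coactP A; split=> x; last first.
  apply: (can_inj incK); rewrite linear_tlift -[RHS]C2 -zero_coact_in tlift_tmap; last by bilin.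
  by apply: eq_tlift => h y; rewrite iotae linearZ.
have Jinj : injective (tmap iota (tmap iota inc)).
  exact: can_inj (tmapK iotaK (tmapK iotaK incK)).
apply: Jinj; rewrite !linear_tlift.
transitivity (\tsum_(h, y <- coact A (inc x)) \tsum_(h1, h2 <- comul H h) (h1 ⊗ (h2 ⊗ y))).
  rewrite -zero_coact_in tlift_tmap; last by bilin.
  apply: eq_tlift => h y; rewrite linear_tlift iotac tlift_tmap; last by bilin.
  by apply: eq_tlift => h1 h2; rewrite /= !tmap_pure.
rewrite C1 -zero_coact_in tlift_tmap; last by bilin.
by apply: eq_tlift => h y; rewrite /= tmap_pure zero_coact_in.
Qed.

Let Jinj : injective (tmap iota inc).
Proof. exact: can_inj (tmapK iotaK incK). Qed.

Lemma zero_coact1 : zero_coact 1 = 1 ⊗ 1.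
Proof. by apply: Jinj; rewrite zero_coact_in inc1 coact1 tmap_pure iota1 inc1. Qed.

Lemma zero_coactM x y : zero_coact (x * y) =
  \tsum_(g, a <- zero_coact x) \tsum_(h, b <- zero_coact y) ((g * h) ⊗ (a * b)).
Proof.
apply: Jinj; rewrite zero_coact_in incM coactM -!zero_coact_in linear_tlift.
rewrite tlift_tmap; last by bilin.
apply: eq_tlift => g a; rewrite linear_tlift tlift_tmap; last by bilin.
by apply: eq_tlift => h b; rewrite /= tmap_pure iotaM incM.
Qed.

Definition zero_comodAlg : comodAlg H0 :=
  ComodAlg zero_coactP zero_coact1 zero_coactM.

(** A coinvariant of A(0) is a coinvariant of A, and those are the scalars. *)
Lemma zero_coinvariants :
  \dim (coinvariants A) = 1%N -> \dim (coinvariants zero_comodAlg) = 1%N.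
Proof.
have coinvP (H' : hopfAlg k) (A' : comodAlg H') x :
    (x \in coinvariants A') = (coact A' x == 1 ⊗ x).
  by rewrite memv_ker add_lfunE opp_lfunE lfunE subr_eq0.
have one_coinv (H' : hopfAlg k) (A' : comodAlg H') : 1 \in coinvariants A'.
  by rewrite coinvP coact1.
move=> dA; have coA : coinvariants A = 1%VS.
  apply/eqP; rewrite eq_sym eqEdim dA dim_vline oner_neq0 andbT.
  by rewrite -memvE one_coinv.
suff -> : coinvariants zero_comodAlg = 1%VS by rewrite dim_vline oner_neq0.
apply/eqP; rewrite eqEsubv -[X in _ && X]memvE one_coinv andbT.
apply/subvP => x; rewrite coinvP => /eqP dx.
have : inc x \in coinvariants A.
  by rewrite coinvP -zero_coact_in [zero_coact x]dx tmap_pure iota1.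
rewrite coA => /vlineP[c xc]; apply/vlineP; exists c.
by apply: (can_inj incK); rewrite xc -inc1 -linearZ.
Qed.

Variables (p : 'End(A)) (W : {vspace A}).
Hypothesis p0 : forall x, p x \in E.
Hypothesis pid : forall x, x \in E -> p x = x.
Hypothesis pW0 : forall w, w \in W -> p w = 0.
Hypothesis pW : forall x, x - p x \in W.
Hypothesis idW : forall x w, w \in W -> x * w \in W /\ w * x \in W.

(** A right ideal and subcomodule J of A(0) generates the right ideal J A, a subcomodule of A. If J
    A = 0 then J = 0; if J A = A, projecting to degree 0 gives J A(0) = A(0), and J A(0) is
    contained in J. *)
Lemma zero_right_simple : right_simple A -> right_simple zero_comodAlg.
Proof.
move=> sA J rJ cJ; pose J' := (inc @: J)%VS.
have cJ' : costable J'.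
  apply/subvP => _ /memv_imgP[_ /memv_imgP[x xJ ->] ->]; rewrite -zero_coact_in.
  apply: (@tmap_sub _ _ _ _ _ _ _ fullv J); rewrite ?subvf ?subvv //.
  by apply: (subvP cJ); apply: memv_img.
have cA : costable (fullv : {vspace A}).
  by apply/subvP => x _; apply: tensvf.
have rK : right_ideal (J' * fullv)%VS.
  move=> a x xK; have /subvP := prodvSr J' (subvf (fullv * fullv)%VS); apply.
  by rewrite prodvA memv_mul ?memvf.
have J'K : (J' <= J' * fullv)%VS.
  by apply/subvP => x xJ; rewrite -[x]mulr1 memv_mul ?memvf.
case: (sA _ rK (costable_prod cJ' cA)) => [K0|Kfull]; [left|right].
  apply/eqP; rewrite -subv0; apply/subvP => x xJ; rewrite memv0.
  rewrite -(inj_eq (can_inj incK)) linear0 -memv0 -K0.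
  by apply: (subvP J'K); apply: memv_img.
have pK : (J' * fullv <= p @^-1: J')%VS.
  apply/prodvP => _ a /memv_imgP[x xJ ->] _; rewrite -memv_preim.
  rewrite -(subrK (p a) a) mulrDr linearD /= (pW0 (proj1 (idW (inc x) (pW a)))) add0r.
  have -> : inc x * p a = inc (x * prj (p a)) by rewrite incM prjK.
  rewrite (pid (inc_mem _)); apply/memv_imgP.
  by exists (x * prj (p a)) => //; apply: rJ.
apply/eqP; rewrite eqEsubv subvf /=; apply/subvP => x _.
have : inc x \in (p @^-1: J')%VS by apply: (subvP pK); rewrite Kfull memvf.
rewrite -memv_preim pid ?inc_mem // => /memv_imgP[y yJ] /(can_inj incK) ->.
exact: yJ.
Qed.

End ZeroComponent.

(** * Bosonizations *)

Section Bosonization.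
Variables (k : fieldType) (H0 : hopfAlg k) (B : braidedHopf H0) (H : hopfAlg k).
Variables (phi : 'Hom(tens B H0, H)) (bosH : is_bosonization phi).

Definition bos_incl : 'Hom(H0, H) := linfun (fun g : H0 => phi (1 ⊗ g)).

Lemma bos_inclE g : bos_incl g = phi (1 ⊗ g).
Proof. by rewrite linfunE //; lin. Qed.

Lemma bos_incl1 : bos_incl 1 = 1.
Proof. by rewrite bos_inclE (bos_one bosH). Qed.

Lemma bos_inclM (g h : H0) : bos_incl (g * h) = bos_incl g * bos_incl h.
Proof.
rewrite !bos_inclE (bos_mul bosH).
have l : linear (fun x : H0 => phi (1 ⊗ (x * h))) by lin.
rewrite -{1}(comul_counitl g) -[LHS]/(lin_of l _) linear_tlift.
apply: eq_tlift => g1 g2.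
by rewrite /= bh_act1 -scalerAl -scalerAr mulr1 linearZ /= -linearZ /= tpureZl linearZ.
Qed.

Lemma bos_incl_counit g : counit H (bos_incl g) = counit H0 g.
Proof. by rewrite bos_inclE (bos_counit bosH) bh_counit1 mul1r. Qed.

Lemma bos_incl_comul g : comul H (bos_incl g) = tmap bos_incl bos_incl (comul H0 g).
Proof.
rewrite bos_inclE (bos_comul bosH) bh_comul1 tlift_pure; last by bilin.
rewrite bh_coact1 tlift_pure; last by bilin.
rewrite tmapE; apply: eq_tlift => g1 g2.
by rewrite mul1r !bos_inclE.
Qed.

Lemma bos_incl_inj : lker bos_incl == 0%VS.
Proof.
have phi_inj : injective phi by apply/lker0P/eqP/(bos_inj bosH).
apply/lker0P => g h; rewrite !bos_inclE => /phi_inj /eqP.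
rewrite -subr_eq0 -linearB => gh; apply/eqP; rewrite -subr_eq0.
by apply: contraTT gh => gh; apply: tpure_eq0; rewrite ?oner_neq0.
Qed.

Lemma bos_grading0 (gB : nat -> {vspace B}) :
  gB 0%N = 1%VS -> (bos_grading phi gB 0 <= limg bos_incl)%VS.
Proof.
move=> gB0; apply/subvP => _ /memv_imgP[t tB ->]; rewrite memv_preim.
apply: subvP tB; apply: tensv_sub => u g; rewrite gB0 => /vlineP[c ->] _.
by rewrite -memv_preim tpureZl linearZ /= -bos_inclE memvZ ?memv_img ?memvf.
Qed.

End Bosonization.

Section CoidealCharacter.
Variables (k : fieldType) (H : hopfAlg k) (L : lcoidealSubalg H).

Definition lcs_char : 'Hom(lcs_comodAlg L, k^o) :=
  (counit H \o linfun (vsval : subvs_of L -> H))%VF.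

Lemma lcs_charE (x : lcs_comodAlg L) : lcs_char x = counit H (vsval (x : subvs_of L)).
Proof. by rewrite comp_lfunE lfunE. Qed.

Lemma lcs_char1 : lcs_char 1 = 1 :> k.
Proof.
have e : algid L = 1 by apply/eqP; rewrite algid_eq1 (lcs1 L).
by rewrite lcs_charE -[RHS](counit1 H) -[in RHS]e.
Qed.

Lemma lcs_charM (x y : lcs_comodAlg L) :
  lcs_char (x * y) = (lcs_char x : k) * (lcs_char y : k) :> k.
Proof. by rewrite !lcs_charE -counitM. Qed.

End CoidealCharacter.

Theorem corollary4p7 (k : closedFieldType) (char0 : [pchar k] =i pred0)
    (H0 : hopfAlg k) (ssH0 : semisimple H0)
    (V : vectType k) (yV : ydStruct H0 V)
    (B : braidedHopf H0) (gB : nat -> {vspace B}) (nicB : is_nichols yV gB)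
    (H : hopfAlg k) (phi : 'Hom(tens B H0, H)) (bosH : is_bosonization phi) :
  (forall A0 : comodAlg H0, AM_exact A0 ->
     exists L0 : lcoidealSubalg H0, morita_equiv A0 (lcs_comodAlg L0)) ->
  forall (A : comodAlg H) (gA : nat -> {vspace A}),
    loewy_graded (bos_grading phi gB) gA -> AM_exact A ->
    exists L : lcoidealSubalg H, morita_equiv A (lcs_comodAlg L).
Proof.
move=> repr0 A gA [algA _ coA] [sA dA].
have [_ g1 gM] := algA.
have [p [W [p0 pid pW0 pW idW]]] := alg_grading_proj algA.
have pM := alg_grading_projM algA p0 pid pW0 pW idW.
have aE : is_aspace (gA 0%N) by rewrite /is_aspace has_algid1 // (gM 0%N 0%N).
pose E := ASpace aE.
have cE : (coact A @: E <= tensv (limg (bos_incl phi)) E)%VS.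
  (* In degree 0 the graded coaction has the single term H(0) (x) A(0), and H(0) is the copy 1 # H0
     of H0 because B^0 consists of scalars. *)
  have := coA 0%N; rewrite big_ord1 => /subv_trans; apply.
  apply: tensv_sub => h y hH yE; apply: tpure_in_tensv => //.
  exact: (subvP (bos_grading0 phi (nichols0 nicB)) _ hH).
have incl_inj := bos_incl_inj bosH.
pose A0 := zero_comodAlg (bos_inclM bosH) (bos_incl1 bosH) (bos_incl_comul bosH)
  (bos_incl_counit bosH) incl_inj (E := E) g1 cE.
have [|L0 [F eF]] := repr0 A0.
  split; last exact: zero_coinvariants.
  refine (@zero_right_simple k H0 H _ _ _ _ _ _ A E g1 cE p W p0 pid pW0 pW idW sA).
(* The character of L0 is the restriction of the counit of H0. *)
have [M [P [Q [f [g [dP [dQ [fc gc gf [t tE]]]]]]]]] :=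
  character_matrix_context eF (lcs_char1 L0) (@lcs_charM _ _ L0).
pose i : 'Hom(A0, A) := linfun (vsval : subvs_of E -> A).
(* Multiplicative by [pM], since the positive part is an ideal; A0-modules are inflated to A along
   it. *)
pose pr : 'Hom(A, A0) := (linfun (vsproj E) \o p)%VF.
have iE x : i x = vsval (x : subvs_of E) by rewrite lfunE.
have prE x : i (pr x) = p x by rewrite iE /pr comp_lfunE lfunE /= vsprojK.
have iK : injective i by move=> x y; rewrite !iE => /val_inj.
have algidE : algid E = 1 by apply/eqP; rewrite algid_eq1.
have i1 : i 1 = 1 by rewrite iE -[RHS]algidE.
have iM x y : i (x * y) = i x * i y by rewrite !lfunE.
apply: (matrix_context_morita (bos_inclM bosH) (bos_incl1 bosH) (bos_incl_comul bosH)
  (i := i) (pr := pr) _ _ _ _ sA fc gc gf tE).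
- by move=> a; apply: esym; apply: zero_coact_in.
- by move=> x y; apply: iK; rewrite iM !prE pM.
- by apply: iK; rewrite prE i1 pid.
- by move=> x; apply: iK; rewrite prE pid // iE (subvsP (x : subvs_of E)).
Qed.
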